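(* Let $\mathcal I$ be an ultrastable Banach Lipschitz operator ideal. Then $(\mathrm{Lip}_0\circ\mathcal I)^{\max}=(\mathrm{Lip}_0\circ\mathcal I)^{\mathrm{reg}}$. In particular, for every Banach operator ideal $\mathcal A$, $(\mathrm{Lip}_0\circ\mathcal A^{\max}\circ\mathrm{Lip}_0)^{\max}=(\mathrm{Lip}_0\circ\mathcal A^{\max}\circ\mathrm{Lip}_0)^{\mathrm{reg}}$.
   Context: Banach spaces are real; $\mathcal L(E,F)$ is the space of bounded linear operators, $J_E\colon E\to E''$ the canonical inclusion. A Banach operator ideal $\mathcal A$ is a Banach ideal of bounded linear operators in the sense of Pietsch, with norm $\|\cdot\|_{\mathcal A}$. Its maximal hull $\mathcal A^{\max}$ consists of those $T\in\mathcal L(E,F)$ with $\|T\|_{\mathcal A^{\max}}:=\sup\|q_L^F\circ T\circ\iota_M^E\|_{\mathcal A}<\infty$, over all finite-dimensional subspaces $M\subset E$ (inclusion $\iota_M^E$) and closed finite-codimensional subspaces $L\subset F$ (quotient map $q_L^F\colon F\to F/L$). A pointed metric space has a distinguished point $0$ (for a Banach space, its origin). $\mathrm{Lip}_0(X,Y)$ is the set of Lipschitz maps $f\colon X\to Y$ with $f(0)=0$, and $\mathrm{Lip}(f)$ is the least Lipschitz constant. A Banach Lipschitz operator ideal $\mathcal I$ assigns to each pointed metric space $X$ and Banach space $E$ a linear subspace $\mathcal I(X,E)\subset \mathrm{Lip}_0(X,E)$ with a norm $\|\cdot\|_{\mathcal I}$ such that: $(\mathcal I(X,E),\|\cdot\|_{\mathcal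 I})$ is a Banach space and $\mathrm{Lip}(f)\le\|f\|_{\mathcal I}$; $Id_{\mathbb R}\in\mathcal I(\mathbb R,\mathbb R)$ with norm $1$; if $g\in\mathrm{Lip}_0(Y,X)$, $f\in\mathcal I(X,E)$, $S\in\mathcal L(E,F)$, then $S\circ f\circ g\in\mathcal I(Y,F)$ and $\|S\circ f\circ g\|_{\mathcal I}\le \|S\|\,\|f\|_{\mathcal I}\,\mathrm{Lip}(g)$. Equality of two such ideals means equal components and equal norms. $\mathrm{Lip}_0\circ\mathcal I(X,E)$ is the set of $f=g_2\circ g_1$ with $F$ a Banach space, $g_1\in\mathcal I(X,F)$, $g_2\in\mathrm{Lip}_0(F,E)$, with norm $\inf\|g_1\|_{\mathcal I}\mathrm{Lip}(g_2)$ over such factorizations; it is a Banach Lipschitz operator ideal. For a Banach operator ideal $\mathcal B$, $\mathrm{Lip}_0\circ\mathcal B\circ\mathrm{Lip}_0(X,E)$ is the set of $f=g_2\circ T\circ g_1$ with $g_1\in\mathrm{Lip}_0(X,G_1)$, $T\in\mathcal B(G_1,G_2)$, $g_2\in\mathrm{Lip}_0(G_2,E)$, $G_1,G_2$ Banach spaces, with norm $\inf \mathrm{Lip}(g_1)\|T\|_{\mathcal B}\mathrm{Lip}(g_2)$; it is a Banach Lipschitz operator ideal. Maximal hull of a Banach Lipschitz operator ideal $\mathcal I$: $f\in\mathcal I^{\max}(X,E)$ iff $\|f\|_{\mathcal I^{\max}}:=\sup\|q_L^E\circ f\circ\iota_{X_0}^X\|_{\mathcal I}<\infty$, over all finite subsets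 $X_0\subset X$ containing $0$ and all closed finite-codimensional subspaces $L\subset E$. Regular hull: $f\in\mathcal I^{\mathrm{reg}}(X,E)$ iff $J_E\circ f\in\mathcal I(X,E'')$, with norm $\|J_E\circ f\|_{\mathcal I}$. Ultraproducts: for an ultrafilter $\mathcal U$ on $I$, $(E_i)_{\mathcal U}$ is the Banach space ultraproduct; for pointed metric spaces, $(X_i)_{\mathcal U}$ is the ultralimit: classes of families with $\sup_i d(x_i,0_i)<\infty$, distance $\lim_{\mathcal U}d(x_i,y_i)$ (families at distance $0$ identified), base point $(0_i)_{\mathcal U}$; and $(f_i)^{\mathcal U}((x_i)_{\mathcal U})=(f_i(x_i))_{\mathcal U}$ for uniformly Lipschitz families $f_i\in\mathrm{Lip}_0(X_i,E_i)$. $\mathcal I$ is ultrastable if for all families $f_i\in\mathcal I(X_i,E_i)$, $i\in I$, with $\sup_i\|f_i\|_{\mathcal I}<\infty$ and every ultrafilter $\mathcal U$ on $I$, $(f_i)^{\mathcal U}\in\mathcal I((X_i)_{\mathcal U},(E_i)_{\mathcal U})$ and $\|(f_i)^{\mathcal U}\|_{\mathcal I}\le\lim_{\mathcal U}\|f_i\|_{\mathcal I}$. *)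

(* Defs.v *)
From HB Require Import structures.
From mathcomp Require Import all_boot all_order all_algebra generic_quotient.
From mathcomp Require Import boolp classical_sets functions cardinality reals.
From mathcomp Require Import ereal topology normedtype sequences lra.
From mathcomp Require ring_quotient.

Set Implicit Arguments.
Unset Strict Implicit.
Unset Printing Implicit Defensive.
Import Order.TTheory GRing.Theory Num.Theory.
Import numFieldNormedType.Exports.

Local Open Scope classical_set_scope.
Local Open Scope ring_scope.

Section completeness.
Context {R : realType}.

Lemma expr2N_small (e : R) : 0 < e -> exists n : nat, 2^-1 ^+ n < e.
Proof.
move=> e0; have /cvgrPdist_lt/(_ e e0)[n _ /(_ n (leqnn n))] :
    (2^-1 ^+ k : R) @[k --> \oo] --> 0.
  by apply: cvg_expr; rewrite ger0_norm ?invr_ge0// invf_lt1 ?ltr1n.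
by rewrite /= sub0r normrN ger0_norm ?exprn_ge0 ?invr_ge0// => ?; exists n.
Qed.

Lemma fast_tail (V : normedModType R) (C : R) (u : nat -> V) :
  (forall n, `|u n.+1 - u n| <= C * 2^-1 ^+ n) ->
  forall n k, `|u (n + k)%N - u n| <= 2 * C * 2^-1 ^+ n - 2 * C * 2^-1 ^+ (n + k).
Proof.
move=> fu n; elim=> [|k ih]; first by rewrite addn0 !subrr normr0.
rewrite addnS -(subrKA (u (n + k)%N)); apply: le_trans (ler_normD _ _) _.
apply: le_trans (lerD (fu _) ih) _.
rewrite [2^-1 ^+ (n + k).+1]exprS; lra.
Qed.

Lemma fast_cvg (E : completeNormedModType R) (C : R) (u : nat -> E) :
  (forall n, `|u n.+1 - u n| <= C * 2^-1 ^+ n) ->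
  exists l, forall n, `|l - u n| <= 2 * C * 2^-1 ^+ n.
Proof.
move=> fu; have C0 : 0 <= C by have := le_trans (normr_ge0 _) (fu 0%N); rewrite expr0 mulr1.
have tail n m : (n <= m)%N -> `|u m - u n| <= 2 * C * 2^-1 ^+ n.
  move=> nm; have := fast_tail fu n (m - n); rewrite subnKC// => /le_trans; apply.
  by rewrite lerBlDr lerDl !mulr_ge0 ?exprn_ge0 ?invr_ge0.
have cu : cvgn u.
  apply: cauchy_cvg; apply: cauchy_exP => e e0.
  have e'0 : 0 < e / (2 * C + 1) by rewrite divr_gt0// ltr_wpDl ?mulr_ge0.
  have [n ne] := expr2N_small e'0.
  exists (u n); exists n => // m /= /tail.
  rewrite -ball_normE /= distrC => /le_lt_trans; apply.
  rewrite ltr_pdivlMr ?ltr_wpDl ?mulr_ge0// in ne.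
  apply: le_lt_trans ne; rewrite mulrC ler_wpM2l ?exprn_ge0 ?invr_ge0//; lra.
exists (limn u) => n.
have : `|u m - u n| @[m --> \oo] --> `|limn u - u n|.
  by apply: cvg_norm; apply: cvgB => //; exact: cvg_cst.
move=> lim_u; apply: (@closed_cvg _ _ \oo _ (fun m => `|u m - u n|)
  (fun x : R => x <= 2 * C * 2^-1 ^+ n) _ _ _ lim_u).
  exact: closed_le.
by exists n => // m /= /tail.
Qed.

Lemma fast_complete (V : normedModType R) :
  (forall u : nat -> V, (forall n, `|u n.+1 - u n| <= 2^-1 ^+ n) ->
    exists l C, forall n, `|l - u n| <= C * 2^-1 ^+ n) ->
  forall F : set_system V, ProperFilter F -> cauchy F -> cvg F.
Proof.
move=> H F FF /cauchyP Fc.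
have pos n : 0 < 2^-1 ^+ n :> R by rewrite exprn_gt0 ?invr_gt0.
have /choice[x xF] : forall n : nat, exists x : V, F (ball x (2^-1 ^+ n.+2)).
  by move=> n; exact: Fc (pos _).
have [n|l [C lC]] := H x.
  have [y []] := @filter_ex _ F FF _ (filterI (xF n) (xF n.+1)).
  rewrite -ball_normE /= => h1 h2; rewrite distrC.
  rewrite -(subrKA y); apply: le_trans (ler_normD _ _) _.
  rewrite [X in _ + X]distrC; apply: le_trans (lerD (ltW h1) (ltW h2)) _.
  have := pos n; rewrite !exprS; lra.
apply/cvg_ex; exists l; apply/cvgrPdist_lt => e e0.
have C0 : 0 <= C by have := le_trans (normr_ge0 _) (lC 0%N); rewrite expr0 mulr1.
have C1 : 0 < C + 1 by lra.
have [n ne] := expr2N_small (divr_gt0 e0 C1).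
rewrite ltr_pdivlMr// in ne.
apply: filterS (xF n) => y; rewrite -ball_normE/= => h.
rewrite -(subrKA (x n)); apply: le_lt_trans (ler_normD _ _) _.
apply: le_lt_trans (lerD (lC n) (ltW h)) _.
have := pos n; move: ne; rewrite !exprS; nra.
Qed.

End completeness.

Definition linear_subspace (R : realType) (V : lmodType R) (A : set V) :=
  A 0 /\ forall (a : R) (u v : V), A u -> A v -> A (a *: u + v).

Section closed_subspaces.
Context {R : realType}.

Record closed_subspace (E : completeNormedModType R) := ClosedSubspace {
  csub_set :> set E;
  csub_linear : linear_subspace csub_set;
  csub_closed : closed csub_set }.

Definition csub_pred (E : completeNormedModType R) (M : closed_subspace E)
  : pred E := fun x => x \in csub_set M.

Lemma csub_pred_submod (E : completeNormedModType R) (M : closed_subspace E) :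
  subsemimod_closed (csub_pred M).
Proof.
have [M0 ML] := csub_linear M; split; first split.
- exact/mem_set.
- move=> x y /set_mem Mx /set_mem My; apply/mem_set.
  by have := ML 1 _ _ Mx My; rewrite scale1r.
- move=> a x /set_mem Mx; apply/mem_set.
  by have := ML a _ _ Mx M0; rewrite addr0.
Qed.

HB.instance Definition _ (E : completeNormedModType R) (M : closed_subspace E) :=
  GRing.isSubmodClosed.Build R E (csub_pred M) (csub_pred_submod M).

Section as_banach.
Variables (E : completeNormedModType R) (M : closed_subspace E).

Definition csub_space := {x : E | csub_pred M x}.

HB.instance Definition _ := SubChoice.on csub_space.
HB.instance Definition _ := [SubChoice_isSubLmodule of csub_space by <:].

Let norm (x : csub_space) := `|val x|.

Let ler_norm_add x y : norm (x + y) <= norm x + norm y.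
Proof. exact: ler_normD. Qed.

Let norm_scale (l : R) x : norm (l *: x) = `|l| * norm x.
Proof. exact: normrZ. Qed.

Let norm_eq0 x : norm x = 0 -> x = 0.
Proof. by move=> /normr0_eq0 x0; apply/val_inj; rewrite x0. Qed.

HB.instance Definition _ := Lmodule_isNormed.Build R csub_space
  ler_norm_add norm_scale norm_eq0.

Let complete (F : set_system csub_space) : ProperFilter F -> cauchy F -> cvg F.
Proof.
apply: fast_complete => u fu.
have [|l lu] := @fast_cvg R E 1 (fun n => val (u n)).
  by move=> n; rewrite mul1r; exact: fu.
have Ml : csub_set M l.
  apply: (@closed_cvg _ _ \oo _ (fun n => val (u n)) (csub_set M) _ _ l).
  - exact: csub_closed.
  - by apply: nearW => n; have /set_mem := valP (u n).
  - apply/cvgrPdist_lt => e e0.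
    have [n ne] := expr2N_small (divr_gt0 e0 (ltr0Sn _ 1)).
    exists n => // m /= nm; apply: le_lt_trans (lu m) _.
    rewrite mulr1 mulrC -ltr_pdivlMr//; apply: le_lt_trans ne.
    by rewrite ler_wiXn2l ?invr_ge0// invf_le1 ?ler1n.
exists (exist _ l (mem_set Ml)), 2 => n.
by have := lu n; rewrite mulr1.
Qed.

HB.instance Definition _ := Uniform_isComplete.Build csub_space complete.
End as_banach.

Section quotient.
Variables (E : completeNormedModType R) (L : closed_subspace E).

Definition csub_quot : Type := ring_quotient.Quotient.quot (GRing.ZmodClosed.clone E (csub_pred L) _).

HB.instance Definition _ := GRing.Zmodule.on csub_quot.

Definition csub_pi : E -> csub_quot := \pi_(csub_quot)%qT.

Lemma csub_piD : {morph csub_pi : x y / x + y}.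
Proof. by move=> x y; rewrite /csub_pi raddfD. Qed.

Lemma csub_piB : {morph csub_pi : x y / x - y}.
Proof. by move=> x y; rewrite /csub_pi raddfB. Qed.

Lemma csub_pi0 : csub_pi 0 = 0.
Proof. by rewrite /csub_pi raddf0. Qed.

Lemma csub_piP x y : csub_pi x = csub_pi y <-> csub_set L (x - y).
Proof.
have -> : csub_set L (x - y) <-> (x - y) \in csub_pred L.
  by split=> [/mem_set//|/set_mem].
by rewrite ring_quotient.Quotient.idealrBE; split => [xy|/eqP//]; exact/eqP.
Qed.

Lemma csub_pi_repr (c : csub_quot) : csub_pi (repr c) = c.
Proof. exact: reprK. Qed.

Let scale (a : R) (c : csub_quot) : csub_quot := csub_pi (a *: repr c).

Lemma csub_pi_scale a x : csub_pi (a *: x) = scale a (csub_pi x).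
Proof.
apply/csub_piP; rewrite -scalerBr -[_ *: _]addr0.
have [L0 LL] := csub_linear L; apply: LL => //.
by apply/csub_piP; rewrite csub_pi_repr.
Qed.

Let scalerA' a b c : scale a (scale b c) = scale (a * b) c.
Proof. by rewrite -(csub_pi_repr c) -!csub_pi_scale scalerA. Qed.

Let scale1r' : left_id 1 scale.
Proof. by move=> c; rewrite -(csub_pi_repr c) -csub_pi_scale scale1r. Qed.

Let scalerDr' : right_distributive scale +%R.
Proof.
move=> a c d; rewrite -(csub_pi_repr c) -(csub_pi_repr d).
by rewrite -csub_piD -!csub_pi_scale scalerDr csub_piD.
Qed.

Let scalerDl' c : {morph scale^~ c : a b / a + b}.
Proof.
by move=> a b; rewrite -(csub_pi_repr c) -!csub_pi_scale scalerDl csub_piD.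
Qed.

HB.instance Definition _ := GRing.Zmodule_isLmodule.Build R csub_quot
  scalerA' scale1r' scalerDr' scalerDl'.

Lemma csub_piZ a x : csub_pi (a *: x) = a *: csub_pi x.
Proof. exact: csub_pi_scale. Qed.

(* The quotient norm: infimum of the norms of the representatives. *)
Let norm (c : csub_quot) : R := inf [set `|x| | x in [set x | csub_pi x = c]].

Let norm_has_inf c : has_inf [set `|x| | x in [set x | csub_pi x = c]].
Proof.
split; first by exists `|repr c|, (repr c) => //=; exact: csub_pi_repr.
by exists 0 => _ [x _ <-].
Qed.

Let norm_le x : norm (csub_pi x) <= `|x|.
Proof. by apply: ge_inf; [exact: (norm_has_inf _).2|exists x]. Qed.

Let norm_ge0 c : 0 <= norm c.
Proof. by apply: lb_le_inf; [exact: (norm_has_inf _).1|move=> _ [x _ <-]]. Qed.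

Let norm_lt c (e : R) : norm c < e -> exists2 x, csub_pi x = c & `|x| < e.
Proof.
by move=> /(inf_lt (norm_has_inf c).1)[_ [x xc <-] xe]; exists x.
Qed.

Let ler_norm_add c d : norm (c + d) <= norm c + norm d.
Proof.
apply/ler_addgt0Pl => e e0; have e2 : 0 < e / 2 by rewrite divr_gt0.
have [|x <- xc] := @norm_lt c (norm c + e / 2); first by rewrite ltrDl.
have [|y <- yd] := @norm_lt d (norm d + e / 2); first by rewrite ltrDl.
rewrite -csub_piD; apply: le_trans (norm_le _) _.
apply: le_trans (ler_normD _ _) _; apply: le_trans (lerD (ltW xc) (ltW yd)) _.
lra.
Qed.

Let norm_scale_le (a : R) c : norm (a *: c) <= `|a| * norm c.
Proof.
apply/ler_addgt0Pl => e e0; have a1 : 0 < `|a| + 1 by rewrite ltr_wpDl.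
have [|x <- xc] := @norm_lt c (norm c + e / (`|a| + 1)).
  by rewrite ltrDl divr_gt0.
rewrite -csub_piZ; apply: le_trans (norm_le _) _; rewrite normrZ.
have /le_trans := ler_wpM2l (normr_ge0 a) (ltW xc); apply.
rewrite mulrDr addrC lerD2r mulrCA ger_pMr// ler_pdivrMr//; lra.
Qed.

Let norm_scale (a : R) c : norm (a *: c) = `|a| * norm c.
Proof.
apply/le_anti; rewrite norm_scale_le /=.
have [->|a0] := eqVneq a 0; first by rewrite normr0 mul0r norm_ge0.
rewrite -[in leLHS](scalerK a0 c) -ler_pdivlMl ?normr_gt0//.
by rewrite -normfV norm_scale_le.
Qed.

Let norm_eq0 c : norm c = 0 -> c = 0.
Proof.
move=> c0; rewrite -(csub_pi_repr c) -csub_pi0; apply/csub_piP; rewrite subr0.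
have /choice[y yP] : forall n : nat, exists y,
    csub_pi y = c /\ `|y| < 2^-1 ^+ n.
  move=> n; have [|y yc yn] := @norm_lt c (2^-1 ^+ n); last by exists y.
  by rewrite c0 exprn_gt0 ?invr_gt0.
apply: (@closed_cvg _ _ \oo _ (fun n => repr c - y n) (csub_set L) _ _ _).
- exact: csub_closed.
- apply: nearW => n; apply/csub_piP.
  by rewrite csub_pi_repr (yP n).1.
- apply/cvgrPdist_lt => e e0; have [n ne] := expr2N_small e0.
  exists n => // m /= nm; rewrite opprB addrC subrK.
  apply: lt_trans (yP m).2 _; apply: le_lt_trans ne.
  by rewrite ler_wiXn2l ?invr_ge0// invf_le1 ?ler1n.
Qed.

HB.instance Definition _ := Lmodule_isNormed.Build R csub_quot
  ler_norm_add norm_scale norm_eq0.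

Lemma csub_quot_normE (c : csub_quot) :
  `|c| = inf [set `|x| | x in [set x | csub_pi x = c]].
Proof. by []. Qed.

Lemma csub_quot_norm_le x : `|csub_pi x| <= `|x|.
Proof. exact: norm_le. Qed.

Lemma csub_quot_norm_lt c (e : R) : `|c| < e ->
  exists2 x, csub_pi x = c & `|x| < e.
Proof. exact: norm_lt. Qed.

Let complete (F : set_system csub_quot) : ProperFilter F -> cauchy F -> cvg F.
Proof.
apply: fast_complete => u fu.
have /choice[w wP] : forall n : nat, exists w,
    csub_pi w = u n.+1 - u n /\ `|w| < 2 * 2^-1 ^+ n.
  move=> n; have [|w wu wn] :=
    @csub_quot_norm_lt (u n.+1 - u n) (2 * 2^-1 ^+ n); last by exists w.
  apply: le_lt_trans (fu n) _.
  by rewrite ltr_pMl ?ltr1n// exprn_gt0 ?invr_gt0.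
pose v n := repr (u 0%N) + \sum_(k < n) w k.
have vu n : csub_pi (v n) = u n.
  elim: n => [|n ih]; first by rewrite /v big_ord0 addr0 csub_pi_repr.
  by rewrite /v big_ord_recr /= addrA csub_piD -/(v n) ih (wP n).1 addrC subrK.
have [|l lv] := @fast_cvg R E 2 v.
  move=> n; rewrite /v big_ord_recr /= addrA (addrC _ (w n)) addrK.
  exact: ltW (wP n).2.
exists (csub_pi l), (2 * 2) => n; rewrite -vu -csub_piB.
exact: le_trans (csub_quot_norm_le _) (lv n).
Qed.

HB.instance Definition _ := Uniform_isComplete.Build csub_quot complete.

End quotient.
End closed_subspaces.

Section bounded_operators.
Context {R : realType}.

Definition bounded_linear (E F : normedModType R) : set (E -> F) :=
  [set f | linear f /\ exists k : R, forall x, `|f x| <= k * `|x|].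

Definition bop_pred (E F : normedModType R) : pred (E -> F) :=
  fun f => f \in @bounded_linear E F.

Lemma bop_pred_submod (E F : normedModType R) :
  subsemimod_closed (@bop_pred E F).
Proof.
split; first split.
- apply/mem_set; split=> [a x y|]; first by rewrite scaler0 addr0.
  by exists 0 => x; rewrite normr0 mul0r.
- move=> f g /set_mem[fl [k fk]] /set_mem[gl [l gl']]; apply/mem_set; split.
    move=> a x y; rewrite !fctE fl gl scalerDr.
    by rewrite -!addrA; congr +%R; rewrite addrCA.
  exists (k + l) => x; rewrite mulrDl.
  exact: le_trans (ler_normD _ _) (lerD (fk x) (gl' x)).
- move=> a f /set_mem[fl [k fk]]; apply/mem_set; split.
    by move=> b x y; rewrite !fctE fl scalerDr !scalerA mulrC.
  exists (`|a| * k) => x; rewrite normrZ -mulrA.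
  exact: ler_wpM2l.
Qed.

HB.instance Definition _ (E F : normedModType R) :=
  GRing.isSubmodClosed.Build R (E -> F) (@bop_pred E F)
    (@bop_pred_submod E F).

Section space.
Variables (E F : normedModType R).

Definition bop := {f : E -> F | bop_pred f}.

HB.instance Definition _ := SubChoice.on bop.
HB.instance Definition _ := [SubChoice_isSubLmodule of bop by <:].

Definition bop_fun (f : bop) : E -> F := val f.
Coercion bop_fun : bop >-> Funclass.

Lemma bop_linear (f : bop) : linear f.
Proof. by have /set_mem[] := valP f. Qed.

HB.instance Definition _ (f : bop) :=
  GRing.isLinear.Build R E F *:%R (bop_fun f) (bop_linear f).

Definition mkbop (f : E -> F) (fP : bounded_linear f) : bop :=
  exist _ f (mem_set fP).

Lemma bop_ext (f g : bop) : f =1 g -> f = g.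
Proof. by move=> fg; apply/val_inj/funext. Qed.

Implicit Types f g : bop.

Let norm (f : bop) : R := sup [set `|f x| | x in [set x | `|x| <= 1]].

Let norm_has_sup f : has_sup [set `|f x| | x in [set x | `|x| <= 1]].
Proof.
split; first by exists `|f 0|, 0 => //=; rewrite normr0.
have /set_mem[_ [k fk]] := valP f; exists `|k| => _ [x /= x1 <-].
apply: le_trans (fk x) _; apply: le_trans (ler_norm _) _.
by rewrite normrM normr_id ler_piMr.
Qed.

Let norm_ge0 f : 0 <= norm f.
Proof.
apply: le_trans (normr_ge0 (f 0)) _; apply: sup_upper_bound.
  exact: norm_has_sup.
by exists 0 => //=; rewrite normr0.
Qed.

Let norm_ub f x : `|f x| <= norm f * `|x|.
Proof.
have [->|x0] := eqVneq x 0; first by rewrite linear0 !normr0 mulr0.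
rewrite -ler_pdivrMr ?normr_gt0// mulrC -[X in X * _]gtr0_norm ?invr_gt0 ?normr_gt0//.
rewrite -normrZ -linearZ; apply: sup_upper_bound; first exact: norm_has_sup.
exists (`|x|^-1 *: x) => //=; rewrite normrZ gtr0_norm ?invr_gt0 ?normr_gt0//.
by rewrite mulVf ?normr_eq0.
Qed.

Let norm_le f k : 0 <= k -> (forall x, `|f x| <= k * `|x|) -> norm f <= k.
Proof.
move=> k0 fk; apply: ge_sup; first exact: (norm_has_sup f).1.
by move=> _ [x /= x1 <-]; apply: le_trans (fk x) _; rewrite ler_piMr.
Qed.

Let ler_norm_add f g : norm (f + g) <= norm f + norm g.
Proof.
apply: norm_le => [|x]; first by rewrite addr_ge0.
rewrite mulrDl; apply: le_trans (ler_normD _ _) _.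
by apply: lerD; exact: norm_ub.
Qed.

Let norm_scale_le (a : R) f : norm (a *: f) <= `|a| * norm f.
Proof.
apply: norm_le => [|x]; first by rewrite mulr_ge0.
by rewrite normrZ -mulrA; apply: ler_wpM2l => //; exact: norm_ub.
Qed.

Let norm_scale (a : R) f : norm (a *: f) = `|a| * norm f.
Proof.
apply/le_anti; rewrite norm_scale_le /=.
have [->|a0] := eqVneq a 0; first by rewrite normr0 mul0r norm_ge0.
rewrite -[in leLHS](scalerK a0 f) -ler_pdivlMl ?normr_gt0//.
by rewrite -normfV norm_scale_le.
Qed.

Let norm_eq0 f : norm f = 0 -> f = 0.
Proof.
move=> f0; apply: bop_ext => x; apply/eqP; rewrite -normr_le0.
by have := norm_ub f x; rewrite f0 mul0r.
Qed.

HB.instance Definition _ := Lmodule_isNormed.Build R bop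
  ler_norm_add norm_scale norm_eq0.

Lemma bop_normE (f : bop) : `|f| = sup [set `|f x| | x in [set x | `|x| <= 1]].
Proof. by []. Qed.

Lemma bop_norm_ub (f : bop) x : `|f x| <= `|f| * `|x|.
Proof. exact: norm_ub. Qed.

Lemma bop_norm_le (f : bop) k : 0 <= k -> (forall x, `|f x| <= k * `|x|) ->
  `|f| <= k.
Proof. exact: norm_le. Qed.

Lemma bopBE (f g : bop) x : (f - g : bop) x = f x - g x.
Proof. by []. Qed.

End space.

Section complete.
Variables (E : normedModType R) (F : completeNormedModType R).

Let complete (G : set_system (bop E F)) : ProperFilter G -> cauchy G -> cvg G.
Proof.
apply: fast_complete => u fu.
have /choice[f fP] : forall x, exists l, forall n,
    `|l - bop_fun (u n) x| <= 2 * `|x| * 2^-1 ^+ n.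
  move=> x; apply: fast_cvg => n; rewrite -bopBE mulrC.
  exact: le_trans (bop_norm_ub _ _) (ler_wpM2r (normr_ge0 x) (fu n)).
have lim0 (v : F) (C : R) : (forall n, `|v| <= C * 2^-1 ^+ n) -> v = 0.
  move=> vC; apply/eqP; rewrite -normr_le0 leNgt; apply/negP => v0.
  have C0 : 0 <= C by have := le_trans (normr_ge0 _) (vC 0%N); rewrite expr0 mulr1.
  have C1 : 0 < C + 1 by lra.
  have [n] := expr2N_small (divr_gt0 v0 C1).
  rewrite ltr_pdivlMr// => h; have := vC n.
  have : 0 < 2^-1 ^+ n :> R by rewrite exprn_gt0 ?invr_gt0.
  nra.
have fl : linear f.
  move=> a x y; apply/eqP; rewrite -subr_eq0; apply/eqP.
  apply: (lim0 _ (2 * `|a *: x + y| + `|a| * (2 * `|x|) + 2 * `|y|)) => n.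
  rewrite (_ : f _ - _ = (f (a *: x + y) - bop_fun (u n) (a *: x + y)) -
      a *: (f x - bop_fun (u n) x) - (f y - bop_fun (u n) y)); last first.
    have regroup (A b c p q : F) : A - (b + c) = A - (p + q) - (b - p) - (c - q).
      by rewrite !opprB -[RHS]addrA (addrACA p) -opprD [RHS]addrA subrK.
    by rewrite (bop_linear (u n)) scalerBr; exact: regroup.
  rewrite (mulrDl _ (2 * `|y|)) (mulrDl _ (`|a| * _)); apply: le_trans (ler_normB _ _) _.
  apply: lerD; last exact: fP.
  apply: le_trans (ler_normB _ _) _; apply: lerD; first exact: fP.
  by rewrite normrZ -mulrA ler_wpM2l.
have fb : bounded_linear f.
  split=> //; exists (2 + `|u 0%N|) => x; rewrite mulrDl.
  rewrite -[f x](subrK (bop_fun (u 0%N) x)); apply: le_trans (ler_normD _ _) _.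
  apply: lerD; first by have := fP x 0%N; rewrite expr0 mulr1.
  exact: bop_norm_ub.
exists (mkbop fb), 2 => n; apply: bop_norm_le.
  by rewrite mulr_ge0// exprn_ge0 ?invr_ge0.
by move=> x; rewrite bopBE mulrAC; exact: fP.
Qed.

HB.instance Definition _ := Uniform_isComplete.Build (bop E F) complete.

End complete.
End bounded_operators.

Section l_infinity.
Context {R : realType} {I : Type} (E : I -> completeNormedModType R).

(* Alias of the dependent product, carrying the pointwise module structure. *)
Definition dprod : Type := forall i, E i.

HB.instance Definition _ := Choice.on dprod.

Let dadd (x y : dprod) : dprod := fun i => x i + y i.
Let dopp (x : dprod) : dprod := fun i => - x i.
Let dzero : dprod := fun i => 0.

Let daddA : associative dadd.
Proof. by move=> x y z; apply: functional_extensionality_dep => i; exact: addrA. Qed.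

Let daddC : commutative dadd.
Proof. by move=> x y; apply: functional_extensionality_dep => i; exact: addrC. Qed.

Let dadd0 : left_id dzero dadd.
Proof. by move=> x; apply: functional_extensionality_dep => i; exact: add0r. Qed.

Let daddN : left_inverse dzero dopp dadd.
Proof. by move=> x; apply: functional_extensionality_dep => i; exact: addNr. Qed.

HB.instance Definition _ := GRing.isZmodule.Build dprod daddA daddC dadd0 daddN.

Let dscale (a : R) (x : dprod) : dprod := fun i => a *: x i.

Let dscaleA a b x : dscale a (dscale b x) = dscale (a * b) x.
Proof. by apply: functional_extensionality_dep => i; exact: scalerA. Qed.

Let dscale1 : left_id 1 dscale.
Proof. by move=> x; apply: functional_extensionality_dep => i; exact: scale1r. Qed.

Let dscaleDr : right_distributive dscale +%R.
Proof. by move=> a x y; apply: functional_extensionality_dep => i; exact: scalerDr. Qed.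

Let dscaleDl x : {morph dscale^~ x : a b / a + b}.
Proof. by move=> a b; apply: functional_extensionality_dep => i; exact: scalerDl. Qed.

HB.instance Definition _ := GRing.Zmodule_isLmodule.Build R dprod
  dscaleA dscale1 dscaleDr dscaleDl.

Definition linf_set : set dprod := [set x | exists M : R, forall i, `|x i| <= M].

Definition linf_pred : pred dprod := fun x => x \in linf_set.

Lemma linf_pred_submod : subsemimod_closed linf_pred.
Proof.
split; first split.
- by apply/mem_set; exists 0 => i; rewrite normr0.
- move=> x y /set_mem[M xM] /set_mem[N yN]; apply/mem_set.
  exists (M + N) => i; rewrite [X in `|X|](_ : _ = x i + y i)//.
  by apply: le_trans (ler_normD _ _) _; apply: lerD.
- move=> a x /set_mem[M xM]; apply/mem_set; exists (`|a| * M) => i.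
  rewrite [X in `|X|](_ : _ = a *: x i)// normrZ; apply: ler_wpM2l => //.
  exact: xM.
Qed.

HB.instance Definition _ :=
  GRing.isSubmodClosed.Build R dprod linf_pred linf_pred_submod.

Definition linf := {x : dprod | linf_pred x}.

HB.instance Definition _ := SubChoice.on linf.
HB.instance Definition _ := [SubChoice_isSubLmodule of linf by <:].

Definition mklinf (x : forall i, E i) (xP : exists M : R, forall i, `|x i| <= M)
  : linf := exist _ (x : dprod) (mem_set xP).

Implicit Types x y : linf.

(* 0 is added to the set so that the supremum is 0 when I is empty. *)
Let norm x : R := sup [set r | r = 0 \/ exists i, r = `|val x i|].

Let norm_has_sup x : has_sup [set r | r = 0 \/ exists i, r = `|val x i|].
Proof.
split; first by exists 0; left.
have /set_mem[M xM] := valP x; exists `|M| => _ [->//|[i ->]].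
exact: le_trans (xM i) (ler_norm _).
Qed.

Let norm_ge0 x : 0 <= norm x.
Proof. by apply: sup_upper_bound; [exact: norm_has_sup|left]. Qed.

Let norm_ub x i : `|val x i| <= norm x.
Proof. by apply: sup_upper_bound; [exact: norm_has_sup|right; exists i]. Qed.

Let norm_le x k : 0 <= k -> (forall i, `|val x i| <= k) -> norm x <= k.
Proof.
by move=> k0 xk; apply: ge_sup; [exact: (norm_has_sup x).1|move=> _ [->|[i ->]]].
Qed.

Let ler_norm_add x y : norm (x + y) <= norm x + norm y.
Proof.
apply: norm_le => [|i]; first by rewrite addr_ge0.
rewrite [X in `|X|](_ : _ = val x i + val y i)//.
by apply: le_trans (ler_normD _ _) _; apply: lerD.
Qed.

Let norm_scale_le (a : R) x : norm (a *: x) <= `|a| * norm x.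
Proof.
apply: norm_le => [|i]; first by rewrite mulr_ge0.
rewrite [X in `|X|](_ : _ = a *: val x i)// normrZ.
by apply: ler_wpM2l => //; exact: norm_ub.
Qed.

Let norm_scale (a : R) x : norm (a *: x) = `|a| * norm x.
Proof.
apply/le_anti; rewrite norm_scale_le /=.
have [->|a0] := eqVneq a 0; first by rewrite normr0 mul0r norm_ge0.
rewrite -[in leLHS](scalerK a0 x) -ler_pdivlMl ?normr_gt0//.
by rewrite -normfV norm_scale_le.
Qed.

Let norm_eq0 x : norm x = 0 -> x = 0.
Proof.
move=> x0; apply/val_inj/functional_extensionality_dep => i.
by have := norm_ub x i; rewrite x0 normr_le0 => /eqP.
Qed.

HB.instance Definition _ := Lmodule_isNormed.Build R linf
  ler_norm_add norm_scale norm_eq0.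

Lemma linf_norm_ub x i : `|val x i| <= `|x|.
Proof. exact: norm_ub. Qed.

Lemma linf_norm_le x k : 0 <= k -> (forall i, `|val x i| <= k) -> `|x| <= k.
Proof. exact: norm_le. Qed.

Let complete (F : set_system linf) : ProperFilter F -> cauchy F -> cvg F.
Proof.
apply: fast_complete => u fu.
have lP i : exists l, forall n, `|l - val (u n) i| <= 2 * 1 * 2^-1 ^+ n.
  apply: fast_cvg => n; rewrite mul1r.
  by apply: le_trans (fu n); exact: (linf_norm_ub (u n.+1 - u n) i).
pose l i := sval (cid (lP i)).
have lE i n : `|l i - val (u n) i| <= 2 * 2^-1 ^+ n.
  by apply: le_trans (svalP (cid (lP i)) n) _; rewrite mulr1.
have lb : exists M : R, forall i, `|l i| <= M.
  exists (2 + `|u 0%N|) => i; rewrite -(subrK (val (u 0%N) i) (l i)).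
  apply: le_trans (ler_normD _ _) _; apply: lerD.
    by have := lE i 0%N; rewrite expr0 mulr1.
  exact: linf_norm_ub.
exists (mklinf lb), 2 => n; apply: linf_norm_le.
  by rewrite mulr_ge0// exprn_ge0 ?invr_ge0.
by move=> i; exact: lE.
Qed.

HB.instance Definition _ := Uniform_isComplete.Build linf complete.

End l_infinity.

Section ultraproducts.
Context {R : realType} {I : Type}.
Variables (U : set_system I) (UU : UltraFilter U).

Lemma ultra_cvg (r : I -> R) (M : R) :
  (forall i, `|r i| <= M) -> cvg (r @ U).
Proof.
move=> rM; have UrU : UltraFilter (r @ U).
  split; first exact: fmap_proper_filter.
  move=> G GG UG; apply/seteqP; split=> [A GA|]; last exact: UG.
  have [//|UA] := in_ultra_setVsetC (r @^-1` A) UU.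
  have GC : G (~` A) by apply: UG.
  by have [x []] := @filter_ex _ G _ _ (filterI GA GC).
have := @segment_compact R (- M) M; rewrite compact_ultra.
case/(_ _ UrU) => [|x [_ rx]]; last by apply/cvg_ex; exists x.
by apply: (@filterE _ U) => i /=; rewrite in_itv/= -ler_norml.
Qed.

Section banach.
Variable E : I -> completeNormedModType R.

Definition null_set : set (linf E) :=
  [set x | `|val x i| @[i --> U] --> (0 : R)].

Lemma null_linear : linear_subspace null_set.
Proof.
split.
  rewrite /null_set /=; apply: cvg_near_cst.
  by apply: nearW => i; rewrite normr0.
move=> a x y; rewrite /null_set/= => x0 y0.
apply/cvgr0Pnorm_le => e e0.
have a1 : 0 < `|a| + 1 by rewrite ltr_wpDl.
have e2 : 0 < e / 2 by rewrite divr_gt0.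
move/cvgr0Pnorm_le : x0 => /(_ _ (divr_gt0 e2 a1)) x0.
move/cvgr0Pnorm_le : y0 => /(_ _ e2) y0.
near=> i; rewrite normr_id.
have := ler_normD (a *: val x i) (val y i); rewrite normrZ => /le_trans; apply.
have : `|val x i| * (`|a| + 1) <= e / 2.
  by rewrite -ler_pdivlMr// -[leLHS]normr_id; near: i.
have : `|val y i| <= e / 2 by rewrite -[leLHS]normr_id; near: i.
have := normr_ge0 a; have := normr_ge0 (val x i); nra.
Unshelve. all: by end_near. Qed.

Lemma null_closed : closed null_set.
Proof.
move=> x xcl; rewrite /null_set/=; apply/cvgr0Pnorm_le => e e0.
have e2 : 0 < e / 2 by rewrite divr_gt0.
have [y [y0]] := xcl _ (nbhsx_ballx x _ e2).
rewrite -ball_normE /= => xy.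
move/cvgr0Pnorm_le : y0 => /(_ _ e2) y0.
near=> i; rewrite normr_id.
rewrite -(subrK (val y i) (val x i)); apply: le_trans (ler_normD _ _) _.
have : `|val y i| <= e / 2 by rewrite -[leLHS]normr_id; near: i.
have := le_lt_trans (linf_norm_ub (x - y) i) xy => /=.
rewrite [X in `|X|](_ : _ = val x i - val y i)//; lra.
Unshelve. all: by end_near. Qed.

Definition null_space : closed_subspace (linf E) :=
  ClosedSubspace null_linear null_closed.

(* The ultraproduct is l_infinity(E_i) modulo the families whose norms tend to
   0 along U; its norm is the limit of the norms (ultraproduct_normE). *)
Definition ultraproduct : completeNormedModType R := csub_quot null_space.

Definition ultraclass : linf E -> ultraproduct := @csub_pi R (linf E) null_space.

Lemma ultraclassP (x y : linf E) : ultraclass x = ultraclass y <->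
  `|val x i - val y i| @[i --> U] --> (0 : R).
Proof. exact: csub_piP. Qed.

Lemma ultraproduct_normE (x : linf E) :
  `|ultraclass x| = lim (`|val x i| @[i --> U]).
Proof.
have /cvg_ex[/= l xl] : cvg (`|val x i| @[i --> U]).
  by apply: (@ultra_cvg _ `|x|) => i; rewrite normr_id; exact: linf_norm_ub.
rewrite (cvg_lim _ xl)//; apply/le_anti/andP; split.
  apply/ler_addgt0Pl => e e0.
  have l0 : 0 <= l.
    apply: (@closed_cvg _ _ U _ (fun i => `|val x i|) (fun r : R => 0 <= r) _ _ _ xl).
      exact: closed_ge.
    exact: nearW.
  have yb : exists M : R, forall i,
      `|if `|val x i| <= e + l then val x i else 0| <= M.
    by exists (e + l) => i; case: ifP => //; rewrite normr0 addr_ge0// ltW.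
  have <- : ultraclass (mklinf yb) = ultraclass x.
    apply/ultraclassP; apply: cvg_near_cst.
    move/cvgrPdist_lt : xl => /(_ _ e0); apply: filterS => i /= xi.
    rewrite ifT ?subrr ?normr0//.
    by move: xi; rewrite ltr_norml; lra.
  apply: le_trans (csub_quot_norm_le _ _) _; apply: linf_norm_le => [|i /=].
    by rewrite addr_ge0// ltW.
  by case: ifP => //; rewrite normr0 addr_ge0// ltW.
apply/ler_addgt0Pl => e e0.
have [|y yx ye] := @csub_quot_norm_lt R _ null_space (ultraclass x)
  (e + `|ultraclass x|); first by rewrite ltrDr.
apply: le_trans (ltW ye).
have /ultraclassP xy : ultraclass x = ultraclass y by [].
apply/ler_addgt0Pr => d d0.
have d2 : 0 < d / 2 by rewrite divr_gt0.
move/cvgrPdist_lt : xy => /(_ _ d2) xy.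
move/cvgrPdist_lt : xl => /(_ _ d2) xl.
have [i [/=]] := @filter_ex _ U _ _ (filterI xy xl).
rewrite sub0r normrN normr_id ltr_norml => h1 h2.
have := linf_norm_ub y i.
have := ler_normD (val x i - val y i) (val y i); rewrite subrK.
lra.
Qed.

End banach.
End ultraproducts.

#[short(type="pmetricType")]
HB.structure Definition PointedMetric (K : numDomainType) :=
  {M of Metric K M & isPointed M}.

Section finite_dimension.
Context {R : realType}.

Definition lspan (V : lmodType R) (s : seq V) : set V :=
  [set x | exists c : nat -> R, x = \sum_(i < size s) c i *: s`_i].

Definition finite_dim (V : lmodType R) (A : set V) :=
  exists s : seq V, A = lspan s.

Lemma lspan_cons (V : lmodType R) (e : V) (s : seq V) x :
  lspan (e :: s) x <-> exists a m, lspan s m /\ x = a *: e + m.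
Proof.
split=> [[c ->]|[a [_ [[c ->] ->]]]].
  exists (c 0%N), (\sum_(i < size s) c i.+1 *: s`_i); split.
    by exists (fun i => c i.+1).
  by rewrite /= big_ord_recl.
by exists (fun i => if i is j.+1 then c j else a); rewrite /= big_ord_recl.
Qed.

Lemma lspan_linear (V : lmodType R) (s : seq V) : linear_subspace (lspan s).
Proof.
split; first by exists (fun=> 0); rewrite big1// => i _; rewrite scale0r.
move=> a _ _ [c ->] [d ->]; exists (fun i => a * c i + d i).
rewrite scaler_sumr -big_split/=; apply: eq_bigr => i _.
by rewrite scalerDl scalerA.
Qed.

Lemma lspan_closed (E : completeNormedModType R) (s : seq E) :
  closed (lspan s).
Proof.
elim: s => [|e s ih].
  rewrite (_ : lspan [::] = [set 0]); last first.
    apply/seteqP; split=> [x [c ->]|_ ->]; first by rewrite /= big_ord0.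
    by exists (fun=> 0); rewrite big_ord0.
  exact: accessible_closed_set1 (hausdorff_accessible (@norm_hausdorff _ E)) _.
have [s0 sL] := lspan_linear s.
have [es|es] := pselect (lspan s e).
  rewrite (_ : lspan (e :: s) = lspan s)//.
  apply/seteqP; split=> x.
    by move=> /lspan_cons[a [m [sm ->]]]; exact: sL.
  by move=> sx; apply/lspan_cons; exists 0, x; rewrite scale0r add0r.
have [d d0 ed] : exists2 d : R, 0 < d & forall m, lspan s m -> d <= `|e - m|.
  have : open (~` lspan s) by rewrite openC.
  rewrite openE => /(_ _ es); rewrite /interior -nbhs_ballE => -[d /= d0 de].
  exists d => // m sm; rewrite leNgt; apply/negP => em.
  by apply: (de m) => //; rewrite -ball_normE.
have bound a m : lspan s m -> `|a| * d <= `|a *: e + m|.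
  move=> sm; have [->|a0] := eqVneq a 0; first by rewrite normr0 mul0r.
  have -> : a *: e + m = a *: (e - (- a^-1) *: m).
    by rewrite scaleNr opprK scalerDr scalerA divff// scale1r.
  rewrite normrZ ler_wpM2l// ed// -[_ *: m]addr0; exact: sL.
move=> x xcl.
have /choice[y yP] : forall n : nat, exists y, lspan (e :: s) y /\ `|x - y| < 2^-1 ^+ n.+1.
  move=> n; have [|y [sy]] := xcl (ball x (2^-1 ^+ n.+1)).
    by apply: nbhsx_ballx; rewrite exprn_gt0 ?invr_gt0.
  by rewrite -ball_normE /= => xy; exists y.
have /choice[a aP] : forall n, exists a, exists m, lspan s m /\ y n = a *: e + m.
  by move=> n; have [/lspan_cons[a h] _] := yP n; exists a.
have [|b ab] := @fast_cvg R R (d^-1) a.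
  move=> n; rewrite ler_pdivlMl// mulrC.
  have [m [sm ym]] := aP n; have [m' [sm' ym']] := aP n.+1.
  have /bound : lspan s (m' - m) by rewrite addrC -scaleN1r; exact: sL.
  move=> /(_ (a n.+1 - a n)) /le_trans; apply.
  rewrite scalerBl addrACA -opprD -ym -ym' -(subrKA x).
  apply: le_trans (ler_normD _ _) _; rewrite distrC.
  apply: le_trans (lerD (ltW (yP n.+1).2) (ltW (yP n).2)) _.
  have : 0 < 2^-1 ^+ n :> R by rewrite exprn_gt0 ?invr_gt0.
  rewrite !exprS; lra.
apply/lspan_cons; exists b, (x - b *: e); split; last by rewrite addrC subrK.
apply: (@closed_cvg _ _ \oo _ (fun n => y n - a n *: e) (lspan s) _ _ _ _).
- exact: ih.
- by apply: nearW => n; have [m [sm ->]] := aP n; rewrite addrC addKr.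
- have C0 : 0 < 1 + 2 * d^-1 * `|e| by rewrite ltr_pwDl// !mulr_ge0// invr_ge0 ltW.
  apply/cvgrPdist_lt => r r0; have [n nr] := expr2N_small (divr_gt0 r0 C0).
  rewrite ltr_pdivlMr// in nr.
  exists n => // k /= nk.
  have -> : x - b *: e - (y k - a k *: e) = (x - y k) - (b - a k) *: e.
    rewrite scalerBl !opprB [LHS]addrACA [RHS]addrACA; congr +%R.
    exact: addrC.
  apply: le_lt_trans (ler_normB _ _) _; apply: le_lt_trans nr.
  have kn : 2^-1 ^+ k <= 2^-1 ^+ n :> R.
    by rewrite ler_wiXn2l ?invr_ge0// invf_le1 ?ler1n.
  rewrite mulrC mulrDl mul1r; apply: lerD.
    apply: le_trans (ltW (yP k).2) _; apply: le_trans kn.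
    by rewrite ler_wiXn2l ?invr_ge0// invf_le1 ?ler1n.
  rewrite normrZ mulrAC; apply: ler_wpM2r => //; apply: le_trans (ab k) _.
  by apply: ler_wpM2l => //; rewrite mulr_ge0// invr_ge0 ltW.
Qed.

(* Finite-dimensional subspaces are closed (lspan_closed), hence are Banach
   spaces through fd_csub and csub_space. *)
Record fd_subspace (E : completeNormedModType R) := FdSubspace {
  fd_set : set E;
  fd_linear : linear_subspace fd_set;
  fd_finite_dim : finite_dim fd_set }.

Lemma fd_closed (E : completeNormedModType R) (M : fd_subspace E) :
  closed (fd_set M).
Proof. by have [s ->] := fd_finite_dim M; exact: lspan_closed. Qed.

Definition fd_csub (E : completeNormedModType R) (M : fd_subspace E) :
  closed_subspace E := ClosedSubspace (fd_linear M) (@fd_closed E M).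

Record fc_subspace (E : completeNormedModType R) := FcSubspace {
  fc_csub :> closed_subspace E;
  fc_finite_dim : finite_dim [set: csub_quot fc_csub] }.

End finite_dimension.

Section banach_as_pointed_metric.
Context {R : realType} (E : completeNormedModType R).

(* A Banach space as a pointed metric space with base point 0. The alias is
   needed because the point that comes with a completeNormedModType is
   arbitrary. *)
Definition bpm : Type := E.

HB.instance Definition _ := PseudoMetric.copy bpm E.

Let bpm_dist (x y : bpm) : R := `|(x : E) - (y : E)|.

Let bpm_dist_ge0 x y : 0 <= bpm_dist x y.
Proof. exact: normr_ge0. Qed.

Let bpm_dist_eq0 x y : bpm_dist x y = 0 -> x = y.
Proof. by move=> /normr0_eq0/eqP; rewrite subr_eq0 => /eqP. Qed.

Let bpm_ball (x : bpm) (d : R) : ball x d = [set y | bpm_dist x y < d].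
Proof. by rewrite (_ : ball x d = ball (x : E) d)// -ball_normE. Qed.

HB.instance Definition _ := PseudoMetric_isMetric.Build R bpm
  bpm_dist_ge0 bpm_dist_eq0 bpm_ball.
HB.instance Definition _ := isPointed.Build bpm 0.

Lemma bpm_distE (x y : bpm) : mdist x y = `|(x : E) - (y : E)|.
Proof. by []. Qed.

End banach_as_pointed_metric.

Section finite_subspaces.
Context {R : realType} (X : pmetricType R).

(* Finite subsets containing the base point. *)
Record pointed_finset := PointedFinset {
  pf_set : set X;
  pf_finite : finite_set pf_set;
  pf_point : pf_set point }.

Variable X0 : pointed_finset.

Definition pf_space : Type := {x : X | x \in pf_set X0}.

HB.instance Definition _ := SubChoice.on pf_space.

Let dist (x y : pf_space) : R := mdist (val x) (val y).

Let distxx x : dist x x = 0. Proof. exact: mdistxx. Qed.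

Let dist_eq0 x y : dist x y = 0 -> x = y.
Proof. by move=> /mdist_positivity xy; exact: val_inj. Qed.

Let dist_sym x y : dist x y = dist y x. Proof. exact: metric_sym. Qed.

Let dist_triangle y x z : dist x z <= dist x y + dist y z.
Proof. exact: metric_triangle. Qed.

HB.instance Definition _ := isMetric.Build R pf_space
  distxx dist_eq0 dist_sym dist_triangle.
HB.instance Definition _ :=
  isPointed.Build pf_space (exist _ point (mem_set (pf_point X0))).

Definition pf_incl (x : pf_space) : X := val x.

End finite_subspaces.

Section lim_ultrafilter.
Context {R : realType} {I : Type} (U : set_system I) (UU : UltraFilter U).
Implicit Types r s t : I -> R.

Lemma ulim_ge0 r : cvg (r @ U) -> (forall i, 0 <= r i) -> 0 <= lim (r @ U).
Proof. by move=> rc r0; apply: limr_ge => //; exact: nearW. Qed.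

Lemma ulim_leD r s t : cvg (r @ U) -> cvg (s @ U) -> cvg (t @ U) ->
  (forall i, t i <= r i + s i) -> lim (t @ U) <= lim (r @ U) + lim (s @ U).
Proof.
move=> rc sc tc rst; have rsc : cvg (r + s @ U) by exact: is_cvgD.
rewrite -(limD rc sc) -subr_ge0 -(limB rsc tc).
apply: limr_ge; first exact: is_cvgB.
by apply: nearW => i; rewrite subr_ge0; exact: rst.
Qed.

End lim_ultrafilter.

Section ultralimits.
Context {R : realType} {I : Type}.
Variables (U : set_system I) (UU : UltraFilter U) (X : I -> pmetricType R).

Definition bfam_set : set (forall i, X i) :=
  [set x | exists M : R, forall i, mdist (x i) point <= M].

Definition bfam := {x : forall i, X i | x \in bfam_set}.

HB.instance Definition _ := Choice.on bfam.

Let D (x y : bfam) i : R := mdist (val x i) (val y i).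

Let D_cvg x y : cvg (D x y @ U).
Proof.
have /set_mem[M xM] := valP x; have /set_mem[N yN] := valP y.
apply: (@ultra_cvg _ _ _ _ _ (M + N)) => i; rewrite ger0_norm ?mdist_ge0//.
apply: le_trans (metric_triangle _ point _) _.
by apply: lerD; [exact: xM|rewrite metric_sym; exact: yN].
Qed.

Let lim_ge0 x y : 0 <= lim (D x y @ U).
Proof. by apply: ulim_ge0 => [|i]; [exact: D_cvg|exact: mdist_ge0]. Qed.

Let lim_triangle y x z : lim (D x z @ U) <= lim (D x y @ U) + lim (D y z @ U).
Proof.
by apply: ulim_leD => [|||i]; [exact: D_cvg..|exact: metric_triangle].
Qed.

Let limxx x : lim (D x x @ U) = 0.
Proof.
rewrite (_ : D x x = cst 0) ?lim_cst//.
by apply/funext => i; exact: mdistxx.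
Qed.

Let lim_sym x y : lim (D x y @ U) = lim (D y x @ U).
Proof.
by rewrite (_ : D x y = D y x)//; apply/funext => i; exact: metric_sym.
Qed.

Definition ueq (x y : bfam) : bool :=
  lim (mdist (val x i) (val y i) @[i --> U]) == 0.

Let ueq_equiv : equiv_class_of ueq.
Proof.
split=> [x|x y|y x z]; rewrite /ueq.
- by apply/eqP; exact: limxx.
- by congr (_ == 0); exact: lim_sym.
- move=> /eqP xy /eqP yz; apply/eqP/le_anti; rewrite lim_ge0 andbT.
  by apply: le_trans (lim_triangle y _ _) _; rewrite {1}/D xy {1}/D yz addr0.
Qed.

Canonical ueq_equivrel := EquivRelPack ueq_equiv.

Definition ultralimit : Type := {eq_quot ueq}%qT.

HB.instance Definition _ := Choice.on ultralimit.

Definition ulim_class (x : bfam) : ultralimit := \pi_(ultralimit)%qT x.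

Lemma ulim_classP (x y : bfam) : ulim_class x = ulim_class y <->
  lim (mdist (val x i) (val y i) @[i --> U]) = 0.
Proof. by split=> [/eqmodP/eqP|xy]; [|apply/eqmodP/eqP]. Qed.

Let dist (c d : ultralimit) : R :=
  lim (mdist (val (repr c) i) (val (repr d) i) @[i --> U]).

Let distE x y : dist (ulim_class x) (ulim_class y) = lim (D x y @ U).
Proof.
have rep z : lim (D (repr (ulim_class z)) z @ U) = 0.
  by apply/ulim_classP; exact: reprK.
have le x1 y1 x2 y2 : lim (D x1 x2 @ U) = 0 -> lim (D y1 y2 @ U) = 0 ->
    lim (D x1 y1 @ U) <= lim (D x2 y2 @ U).
  move=> xx yy; apply: le_trans (lim_triangle x2 _ _) _; rewrite xx add0r.
  by apply: le_trans (lim_triangle y2 _ _) _; rewrite (lim_sym y2) yy addr0.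
by apply/le_anti/andP; split; apply: le => //; rewrite lim_sym.
Qed.

Let distxx c : dist c c = 0.
Proof. exact: limxx. Qed.

Let dist_eq0 c d : dist c d = 0 -> c = d.
Proof.
by rewrite -[c]reprK -[d]reprK => cd; apply/ulim_classP; rewrite -cd distE.
Qed.

Let dist_sym c d : dist c d = dist d c.
Proof. exact: lim_sym. Qed.

Let dist_triangle d c e : dist c e <= dist c d + dist d e.
Proof. exact: lim_triangle. Qed.

HB.instance Definition _ := isMetric.Build R ultralimit
  distxx dist_eq0 dist_sym dist_triangle.

Lemma bfam_point_subproof : (fun i => point) \in bfam_set.
Proof. by apply/mem_set; exists 0 => i; rewrite mdistxx. Qed.

Definition bfam_point : bfam := exist _ (fun i => point) bfam_point_subproof.

HB.instance Definition _ := isPointed.Build ultralimit (ulim_class bfam_point).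

Lemma ultralimit_distE (x y : bfam) :
  mdist (ulim_class x) (ulim_class y) =
  lim (mdist (val x i) (val y i) @[i --> U]).
Proof. exact: distE. Qed.

Lemma ultralimit_dist_cvg (x y : bfam) :
  mdist (val x i) (val y i) @[i --> U] -->
  mdist (ulim_class x) (ulim_class y).
Proof. by rewrite ultralimit_distE; exact: D_cvg. Qed.

End ultralimits.

Section lipschitz.
Context {R : realType}.

Definition lipschitz_const (X Y : pmetricType R) (f : X -> Y) : set R :=
  [set k | 0 <= k /\ forall x y, mdist (f x) (f y) <= k * mdist x y].

Definition lip0 (X Y : pmetricType R) : set (X -> Y) :=
  [set f | f point = point /\ exists k, lipschitz_const f k].

Definition Lip (X Y : pmetricType R) (f : X -> Y) : R :=
  inf (lipschitz_const f).

Lemma LipP (X Y : pmetricType R) (f : X -> Y) :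
  lip0 f -> lipschitz_const f (Lip f).
Proof.
move=> [_ [k fk]].
have hi : has_inf (lipschitz_const f).
  by split; [exists k|exists 0 => ? []].
split; first by apply: lb_le_inf => [|? []]; first by exists k.
move=> x y; have := mdist_ge0 x y; rewrite le_eqVlt => /predU1P[xy|xy].
  by have := fk.2 x y; rewrite -xy !mulr0.
rewrite -ler_pdivrMr//; apply: lb_le_inf; first by exists k.
by move=> l [_ /(_ x y)]; rewrite ler_pdivrMr.
Qed.

End lipschitz.

Section ultraproduct_maps.
Context {R : realType} {I : Type} (U : set_system I) (UU : UltraFilter U).
Variables (X : I -> pmetricType R) (E : I -> completeNormedModType R).

(* (x_i)_U |-> (f_i(x_i))_U. It is defined for arbitrary f: a family
   (f_i(x_i))_i that is not bounded is sent to 0. For uniformly Lipschitz f_i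
   with f_i(0) = 0 this never happens and the value does not depend on the
   representative (ultramapE). *)
Definition ultramap (f : forall i, X i -> E i) (c : ultralimit UU X) :
    ultraproduct UU E :=
  ultraclass UU (insubd (0 : linf E)
    ((fun i => f i (val (repr c) i)) : dprod E)).

Lemma ultramapE (f : forall i, X i -> E i) (k : R) :
  (forall i, f i point = 0) ->
  (forall i, lipschitz_const (f i : X i -> bpm (E i)) k) ->
  forall (x : bfam X) (xb : exists M : R, forall i, `|f i (val x i)| <= M),
    ultramap f (ulim_class UU x) = ultraclass UU (mklinf xb).
Proof.
move=> f0 fk x xb; rewrite /ultramap.
set y := repr _; have yx : ulim_class UU y = ulim_class UU x by exact: reprK.
have yb : linf_pred ((fun i => f i (val y i)) : dprod E).
  apply/mem_set; have /set_mem[M yM] := valP y; exists (k * M) => i.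
  have := (fk i).2 (val y i) point; rewrite bpm_distE f0 subr0 => /le_trans.
  by apply; apply: ler_wpM2l; [exact: (fk i).1|exact: yM].
apply/ultraclassP.
have := @ultralimit_dist_cvg R I U UU X y x; rewrite yx mdistxx => yx0.
have kyx : k * mdist (val y i) (val x i) @[i --> U] --> (0 : R).
  by rewrite -(mulr0 k); apply: cvgM => //; exact: cvg_cst.
apply: (squeeze_cvgr _ (cvg_cst 0) kyx).
apply: nearW => i; rewrite normr_ge0/= val_insubd yb.
exact: (fk i).2.
Qed.

End ultraproduct_maps.
Arguments ultramap {R I U} UU {X E} f c.

Section bounded_operator_constructions.
Context {R : realType}.

Lemma bop_comp_subproof (E F G : normedModType R) (S : bop F G) (T : bop E F) :
  bounded_linear (S \o T).
Proof.
split=> [a x y|]; first by rewrite /= !linearP.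
exists (`|S| * `|T|) => x /=; apply: le_trans (bop_norm_ub _ _) _.
by rewrite -mulrA; apply: ler_wpM2l => //; exact: bop_norm_ub.
Qed.

Definition bop_comp (E F G : normedModType R) (S : bop F G) (T : bop E F) :
  bop E G := mkbop (bop_comp_subproof S T).

Lemma bop_id_subproof (E : normedModType R) : bounded_linear (@idfun E).
Proof. by split=> //; exists 1 => x; rewrite mul1r. Qed.

Definition bop_id (E : normedModType R) : bop E E :=
  mkbop (bop_id_subproof E).

Lemma csub_incl_subproof (E : completeNormedModType R) (M : closed_subspace E) :
  bounded_linear (val : csub_space M -> E).
Proof. by split=> [//|]; exists 1 => x; rewrite mul1r. Qed.

Definition csub_incl (E : completeNormedModType R) (M : closed_subspace E) :
  bop (csub_space M) E := mkbop (csub_incl_subproof M).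

Lemma csub_proj_subproof (E : completeNormedModType R) (L : closed_subspace E) :
  bounded_linear (@csub_pi R E L).
Proof.
split=> [a x y|]; first by rewrite csub_piD csub_piZ.
by exists 1 => x; rewrite mul1r; exact: csub_quot_norm_le.
Qed.

Definition csub_proj (E : completeNormedModType R) (L : closed_subspace E) :
  bop E (csub_quot L) := mkbop (csub_proj_subproof L).

Definition dual (E : completeNormedModType R) : completeNormedModType R :=
  bop E R.

Definition bidual (E : completeNormedModType R) : completeNormedModType R :=
  dual (dual E).

Lemma bidual_incl_subproof (E : completeNormedModType R) (x : E) :
  bounded_linear (fun phi : bop E R => phi x).
Proof.
split=> [//|]; exists `|x| => phi; rewrite mulrC; exact: bop_norm_ub.
Qed.

Definition bidual_incl (E : completeNormedModType R) (x : E) : bidual E :=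
  mkbop (bidual_incl_subproof x).

End bounded_operator_constructions.

Section operator_ideals.
Variable R : realType.
Local Notation banach := (completeNormedModType R).

(* A is a linear subspace of V on which N is a complete norm. *)
Record complete_norm_on (V : lmodType R) (A : set V) (N : V -> R) : Prop := {
  cno_linear : linear_subspace A;
  cno_triangle : forall u v, A u -> A v -> N (u + v) <= N u + N v;
  cno_scale : forall (a : R) u, A u -> N (a *: u) = `|a| * N u;
  cno_eq0 : forall u, A u -> N u = 0 -> u = 0;
  cno_complete : forall u : nat -> V, (forall n, A (u n)) ->
    (forall e, 0 < e -> exists n0, forall m n,
      (n0 <= m)%N -> (n0 <= n)%N -> N (u m - u n) < e) ->
    exists2 l, A l & N (u n - l) @[n --> \oo] --> (0 : R) }.

(* A class of operators with a function standing for its norm; nothing is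
   assumed here, the axioms are in banach_op_ideal. The values of op_norm
   outside op_mem are irrelevant. *)
Record op_class := OpClass {
  op_mem : forall E F : banach, set (bop E F);
  op_norm : forall E F : banach, bop E F -> R }.

Record banach_op_ideal (A : op_class) : Prop := {
  boi_banach : forall E F : banach,
    complete_norm_on (op_mem A (E := E) (F := F)) (op_norm A (E := E) (F := F));
  boi_id : op_mem A (bop_id R);
  boi_id_norm : op_norm A (bop_id R) = 1;
  boi_ideal : forall (E0 E F F0 : banach)
      (S : bop F F0) (T : bop E F) (Q : bop E0 E), op_mem A T ->
    op_mem A (bop_comp S (bop_comp T Q)) /\
    op_norm A (bop_comp S (bop_comp T Q)) <= `|S| * op_norm A T * `|Q| }.

(* The norm of the class, with the convention +oo outside the class. *)
Definition op_enorm (A : op_class) (E F : banach) (T : bop E F) : \bar R :=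
  if `[< op_mem A T >] then (op_norm A T)%:E else +oo%E.

Definition op_max_enorm (A : op_class) (E F : banach) (T : bop E F) : \bar R :=
  ereal_sup [set r | exists (M : fd_subspace E) (L : fc_subspace F),
    r = op_enorm A (bop_comp (csub_proj L) (bop_comp T (csub_incl (fd_csub M))))].

Definition op_max (A : op_class) : op_class := {|
  op_mem := fun E F => [set T | (op_max_enorm A T < +oo)%E];
  op_norm := fun E F T => fine (op_max_enorm A T) |}.

(* As op_class, for maps from pointed metric spaces to Banach spaces; the
   axioms are in banach_lip_ideal. *)
Record lip_class := LipClass {
  lip_mem : forall (X : pmetricType R) (E : banach), set (X -> E);
  lip_norm : forall (X : pmetricType R) (E : banach), (X -> E) -> R }.

Record banach_lip_ideal (I : lip_class) : Prop := {
  bli_lip0 : forall (X : pmetricType R) (E : banach) (f : X -> E),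
    lip_mem I f -> lip0 (f : X -> bpm E) /\ Lip (f : X -> bpm E) <= lip_norm I f;
  bli_banach : forall (X : pmetricType R) (E : banach),
    complete_norm_on (lip_mem I (X := X) (E := E)) (lip_norm I (X := X) (E := E));
  bli_id : lip_mem I (idfun : bpm R -> R);
  bli_id_norm : lip_norm I (idfun : bpm R -> R) = 1;
  bli_ideal : forall (Y X : pmetricType R) (E F : banach)
      (g : Y -> X) (f : X -> E) (S : bop E F), lip0 g -> lip_mem I f ->
    lip_mem I (S \o f \o g) /\
    lip_norm I (S \o f \o g) <= `|S| * lip_norm I f * Lip g }.

Definition lip_class_eq (I J : lip_class) :=
  forall (X : pmetricType R) (E : banach) (f : X -> E),
    (lip_mem I f <-> lip_mem J f) /\
    (lip_mem I f -> lip_norm I f = lip_norm J f).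

Definition lip0_comp (I : lip_class) : lip_class := {|
  lip_mem := fun X E => [set f | exists (F : banach) (g1 : X -> F) (g2 : F -> E),
    [/\ lip_mem I g1, lip0 (g2 : bpm F -> bpm E) & f = g2 \o g1]];
  lip_norm := fun X E f => inf [set r | exists (F : banach) (g1 : X -> F) (g2 : F -> E),
    [/\ lip_mem I g1, lip0 (g2 : bpm F -> bpm E), f = g2 \o g1 &
        r = lip_norm I g1 * Lip (g2 : bpm F -> bpm E)]] |}.

Definition lip0_op_lip0 (B : op_class) : lip_class := {|
  lip_mem := fun X E => [set f |
    exists (G1 G2 : banach) (g1 : X -> G1) (T : bop G1 G2) (g2 : G2 -> E),
    [/\ lip0 (g1 : X -> bpm G1), op_mem B T, lip0 (g2 : bpm G2 -> bpm E) &
        f = g2 \o T \o g1]];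
  lip_norm := fun X E f => inf [set r |
    exists (G1 G2 : banach) (g1 : X -> G1) (T : bop G1 G2) (g2 : G2 -> E),
    [/\ lip0 (g1 : X -> bpm G1), op_mem B T, lip0 (g2 : bpm G2 -> bpm E),
        f = g2 \o T \o g1 &
        r = Lip (g1 : X -> bpm G1) * op_norm B T * Lip (g2 : bpm G2 -> bpm E)]] |}.

Definition lip_enorm (I : lip_class) (X : pmetricType R) (E : banach)
    (f : X -> E) : \bar R :=
  if `[< lip_mem I f >] then (lip_norm I f)%:E else +oo%E.

Definition lip_max_enorm (I : lip_class) (X : pmetricType R) (E : banach)
    (f : X -> E) : \bar R :=
  ereal_sup [set r | exists (X0 : pointed_finset X) (L : fc_subspace E),
    r = lip_enorm I (csub_proj L \o f \o @pf_incl R X X0)].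

Definition lip_max (I : lip_class) : lip_class := {|
  lip_mem := fun X E => [set f |
    lip0 (f : X -> bpm E) /\ (lip_max_enorm I f < +oo)%E];
  lip_norm := fun X E f => fine (lip_max_enorm I f) |}.

Definition lip_reg (I : lip_class) : lip_class := {|
  lip_mem := fun X E => [set f |
    lip0 (f : X -> bpm E) /\ lip_mem I (@bidual_incl R E \o f)];
  lip_norm := fun X E f => lip_norm I (@bidual_incl R E \o f) |}.

Definition ultrastable (I : lip_class) :=
  forall (J : Type) (U : set_system J) (UU : UltraFilter U)
    (X : J -> pmetricType R) (E : J -> banach) (f : forall j, X j -> E j),
  (forall j, lip_mem I (f j)) ->
  (exists M : R, forall j, lip_norm I (f j) <= M) ->
  lip_mem I (ultramap UU f) /\
  lip_norm I (ultramap UU f) <= lim (lip_norm I (f j) @[j --> U]).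

End operator_ideals.

(* Main.v *)
(* A class K of Lipschitz maps that is stable under composition with
   nonexpansive maps on both sides and under ultraproducts satisfies
   K^max = K^reg. Given f in K^max(X, E), take an ultrafilter on the pairs
   (X0, L) refining the order by X0 increasing and L decreasing. The maps
   q_L f on X0 have an ultraproduct in K; precomposing with X -> (X0)_U and
   postcomposing with the map (E/L)_U -> E'' that sends (e_L)_U to
   phi |-> lim_U phi(e_L) (phi in E' factors through E/L as soon as L is in
   ker phi) gives J_E f. Conversely, q_L extends to a norm-one operator
   E'' -> E/L because E/L is reflexive.

   Lip0 o I inherits ultrastability from I. For Lip0 o A^max o Lip0 the point
   is that A^max is closed under ultraproducts: let M be a finite-dimensional
   subspace of (E_i)_U and q a quotient map of (F_i)_U onto a
   finite-dimensional N. M lifts almost isometrically to E_i, and q can be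
   approximated on finitely many vectors by operators F_i -> N of almost the
   same norm, by a Hahn-Banach argument in a direct sum of finitely many copies
   of F_i. So q T_U on M is close to operators factoring through
   finite-dimensional pieces of T_i; an operator of small norm between
   finite-dimensional spaces has small A-norm. *)

From HB Require Import structures.
Require Import Defs.
From mathcomp Require Import all_boot all_order all_algebra.
From mathcomp Require Import boolp classical_sets functions cardinality reals.
From mathcomp Require Import ereal topology normedtype lra.

Set Implicit Arguments.
Unset Strict Implicit.
Unset Printing Implicit Defensive.
Import Order.TTheory GRing.Theory Num.Theory.
Import numFieldNormedType.Exports.

Local Open Scope classical_set_scope.
Local Open Scope ring_scope.

(** * The Hahn-Banach theorem *)

Section hahn_banach.
Context {R : realType} {V : lmodType R}.
Variable Q : V -> R.
Hypothesis Q_add : forall x y, Q (x + y) <= Q x + Q y.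
Hypothesis Q_pos : forall a x, 0 < a -> Q (a *: x) = a * Q x.

Let sublinear0 : Q 0 = 0.
Proof.
by have := @Q_pos 2 0 (ltr0Sn _ 1); rewrite scaler0; lra.
Qed.

(** Partial linear functionals dominated by [Q] are encoded by their graphs, so that Zorn's lemma
    can form unions of chains directly. *)
Let below (r : set (V * R)) :=
  (forall a p q, r p -> r q -> r (a *: p.1 + q.1, a * p.2 + q.2)) /\
  (forall p, r p -> p.2 <= Q p.1).

(* A dominated linear relation is the graph of a function, because
   [(0, c)] and [(0, - c)] are both dominated. *)
Let below_fun r x c d : below r -> r (x, c) -> r (x, d) -> c = d.
Proof.
move=> [rl rQ] rc rd.
have h := rQ _ (rl (-1) _ _ rc rd); have h' := rQ _ (rl (-1) _ _ rd rc).
move: h h'; rewrite /= scaleN1r addNr sublinear0; lra.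
Qed.

(** One-dimensional extension: a value [b] at [x] works if it lies between all [q.2 - Q (q.1 - x)]
    and all [Q (q'.1 + x) - q'.2]. Subadditivity puts the former below the latter, and [b] is the
    supremum of the former. *)
Let extend (r : set (V * R)) (x : V) : below r -> r (0, 0) ->
  exists b, below [set p | exists a q, r q /\ p = (a *: x + q.1, a * b + q.2)].
Proof.
move=> [rl rQ] r0.
have step q q' : r q -> r q' -> q.2 - Q (q.1 - x) <= Q (q'.1 + x) - q'.2.
  move=> rq rq'; rewrite lerBlDr addrAC lerBrDr.
  have := rQ _ (rl 1 _ _ rq rq'); rewrite /= scale1r mul1r => /le_trans; apply.
  rewrite (_ : q.1 + q'.1 = (q'.1 + x) + (q.1 - x)); first exact: Q_add.
  by rewrite addrACA subrr addr0 addrC.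
pose S := [set q.2 - Q (q.1 - x) | q in r].
have S0 : S !=set0 by exists (0 - Q (0 - x)), (0, 0).
have Sub q' : r q' -> ubound S (Q (q'.1 + x) - q'.2).
  by move=> rq' _ [q rq <-]; exact: step.
have lo q : r q -> q.2 - Q (q.1 - x) <= sup S.
  move=> rq; apply: sup_upper_bound; last by exists q.
  by split=> //; exists (Q (0 + x) - 0); exact: (Sub (0, 0)).
have hi q : r q -> sup S <= Q (q.1 + x) - q.2.
  by move=> rq; apply: ge_sup => // y; exact: Sub.
have sc a q : r q -> r (a *: q.1, a * q.2).
  by move=> rq; have := rl a _ _ rq r0; rewrite /= !addr0.
exists (sup S); split.
  move=> a _ _ [c [q [rq ->]]] [d [q' [rq' ->]]] /=.
  exists (a * c + d), (a *: q.1 + q'.1, a * q.2 + q'.2); split; first exact: rl.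
  rewrite /= !scalerDr scalerDl scalerA !mulrDr mulrDl mulrA.
  by congr pair; rewrite addrACA.
move=> _ [a [q [rq ->]]] /=.
have [a0|a0|->] := ltgtP a 0; last by rewrite scale0r mul0r !add0r; exact: rQ.
- have a1 : 0 < - a by lra.
  have /lo/= := sc (- a)^-1 _ rq.
  rewrite -(ler_pM2l a1) mulrBr mulrA divff ?gt_eqF// mul1r -Q_pos//.
  rewrite scalerBr scalerA divff ?gt_eqF// scale1r scaleNr opprK addrC.
  rewrite [q.1 + _]addrC; lra.
- have /hi/= := sc a^-1 _ rq.
  rewrite -(ler_pM2l a0) mulrBr mulrA divff ?gt_eqF// mul1r -Q_pos//.
  rewrite scalerDr scalerA divff ?gt_eqF// scale1r [q.1 + _]addrC; lra.
Qed.

Theorem hahn_banach (g : set (V * R)) : g (0, 0) ->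
  (forall a p q, g p -> g q -> g (a *: p.1 + q.1, a * p.2 + q.2)) ->
  (forall p, g p -> p.2 <= Q p.1) ->
  exists h : V -> R, [/\ forall a x y, h (a *: x + y) = a * h x + h y,
    forall x, h x <= Q x & forall p, g p -> h p.1 = p.2].
Proof.
move=> g0 gl gQ; have gb : below g by split.
(* Zorn's lemma is applied to the [r] with [r] united with [g] dominated, rather than to the
   extensions of [g], because the union of the empty chain must qualify too. *)
have [F FP Ft|A [Ab Amax]] := @Zorn_bigcup _ [set r | below (r `|` g)].
  split.
    move=> a p q [[X FX Xp]|gp] [[Y FY Yq]|gq].
    - have [XY|YX] := Ft _ _ FX FY.
      + by have [|?] := (FP _ FY).1 a p q (or_introl (XY _ Xp)) (or_introl Yq);
          [left; exists Y|right].
      + by have [|?] := (FP _ FX).1 a p q (or_introl Xp) (or_introl (YX _ Yq));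
          [left; exists X|right].
    - by have [|?] := (FP _ FX).1 a p q (or_introl Xp) (or_intror gq);
        [left; exists X|right].
    - by have [|?] := (FP _ FY).1 a p q (or_intror gp) (or_introl Yq);
        [left; exists Y|right].
    - by right; exact: gb.1.
  move=> p [[X FX Xp]|gp]; last exact: gb.2.
  by apply: (FP _ FX).2; left.
set r := A `|` g in Ab.
have r0 : r (0, 0) by right.
have total x : exists c, r (x, c).
  apply: contrapT => xr; have [b] := extend x Ab r0.
  set r1 := (X in below X) => r1b.
  have rr1 : r `<=` r1.
    by move=> [y c] ryc; exists 0, (y, c); rewrite scale0r mul0r !add0r.
  apply: (Amax r1).
    split; first by move=> p Ap; apply: rr1; left.
    move=> r1A; apply: xr; exists b; left; apply: r1A.
    by exists 1, (0, 0); rewrite scale1r mul1r !addr0.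
  rewrite /= (_ : r1 `|` g = r1)//; apply/seteqP; split=> [p [//|gp]|p]; last by left.
  by apply: rr1; right.
have [h hr] := choice total.
exists h; split=> [a x y|x|[x c] gx].
- by apply: (below_fun Ab (hr _)); exact: (Ab.1 a _ _ (hr x) (hr y)).
- exact: (Ab.2 _ (hr x)).
- by apply: (below_fun Ab (hr _)); right.
Qed.

End hahn_banach.

(** * Bounded functionals and the norm *)

Section dual_space.
Context {R : realType}.

Lemma bopZ (E F : normedModType R) (T : bop E F) a x : T (a *: x) = a *: T x.
Proof. exact: linearZZ. Qed.

Lemma bop_sum (E F : normedModType R) (T : bop E F) I (r : seq I) (f : I -> E) :
  T (\sum_(i <- r) f i) = \sum_(i <- r) T (f i).
Proof. exact: linear_sum. Qed.

Lemma bop_sumE (E F : normedModType R) I (r : seq I) (T : I -> bop E F) x :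
  (\sum_(i <- r) T i : bop E F) x = \sum_(i <- r) T i x.
Proof. exact: (big_morph (fun S : bop E F => S x)). Qed.

Lemma hahn_banach_bounded (E : normedModType R) (g : set (E * R)) (C : R) :
  0 <= C -> g (0, 0) ->
  (forall a p q, g p -> g q -> g (a *: p.1 + q.1, a * p.2 + q.2)) ->
  (forall p, g p -> p.2 <= C * `|p.1|) ->
  exists phi : bop E R, `|phi| <= C /\ forall p, g p -> phi p.1 = p.2.
Proof.
move=> C0 g0 gl gC.
have [x y|a x a0|h [hl hC hg]] := @hahn_banach R E (fun x => C * `|x|) _ _ g g0 gl gC.
- by rewrite -mulrDr ler_wpM2l// ler_normD.
- by rewrite normrZ gtr0_norm// mulrCA.
have hb x : `|h x| <= C * `|x|.
  (* The upper bound at [- x] is the lower bound at [x]. *)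
  rewrite ler_norml hC andbT lerNl -normrN.
  have h0 : h 0 = 0 by have := hl 1 0 0; rewrite scaler0 addr0; lra.
  have := hl (-1) x 0; rewrite !addr0 h0 scaleN1r => hN.
  by have := hC (- x); rewrite hN; lra.
have hB : bounded_linear (h : E -> R^o) by split; [exact: hl|exists C].
exists (mkbop hB); split; first by apply: bop_norm_le.
by move=> p /hg.
Qed.

(** Extends [a *: x |-> a * |x|] from the line through [x]; for [x = 0] the relation reduces to
    [(0, 0)], so no case distinction arises. *)
Lemma norming_functional (E : normedModType R) (x : E) :
  exists phi : bop E R, `|phi| <= 1 /\ phi x = `|x|.
Proof.
have [||||phi [phi1 phix]] :=
    @hahn_banach_bounded E [set (a *: x, a * `|x|) | a in [set: R]] 1.
- by [].
- by exists 0; rewrite // scale0r mul0r.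
- move=> a _ _ [b _ <-] [c _ <-] /=; exists (a * b + c) => //.
  by rewrite scalerDl scalerA mulrDl mulrA.
- by move=> _ [a _ <-] /=; rewrite mul1r normrZ ler_wpM2r// ler_norm.
exists phi; split=> //.
by apply: (phix (x, `|x|)); exists 1 => //; rewrite scale1r mul1r.
Qed.

Lemma norm_le_dual (E : normedModType R) (x : E) (C : R) :
  (forall phi : bop E R, `|phi| <= 1 -> phi x <= C) -> `|x| <= C.
Proof. by move=> xC; have [phi [phi1 <-]] := norming_functional x; exact: xC. Qed.

End dual_space.

(** * Finite-dimensional spaces *)

Section finite_dimension.
Context {R : realType}.

Lemma linear_subspaceT (V : lmodType R) : linear_subspace [set: V].
Proof. by []. Qed.

(** Induction on the number of forms: the zeros of the last form in [A] have a spanning list, and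
    one vector of [A] on which that form does not vanish, if there is any, completes it. *)
Lemma finite_dim_separated (V : lmodType R) d (phi : nat -> V -> R) (A : set V) :
  linear_subspace A ->
  (forall l a x y, phi l (a *: x + y) = a * phi l x + phi l y) ->
  (forall x, A x -> (forall l, (l < d)%N -> phi l x = 0) -> x = 0) ->
  finite_dim A.
Proof.
move=> Al phil; elim: d A Al => [|d ih] A [A0 Al] sepA.
  exists [::]; apply/seteqP; split=> [x Ax|x [c ->]].
    by exists (fun=> 0); rewrite big_ord0; exact: sepA.
  by rewrite big_ord0.
have phi0 l : phi l 0 = 0.
  by have := phil l 1 0 0; rewrite scaler0 addr0; lra.
have [|x [Ax xd] xl|s Bs] := ih [set x | A x /\ phi d x = 0].
- split=> [|a x y [Ax xd] [Ay yd]]; first by split.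
  by split; [exact: Al|rewrite phil xd yd mulr0 addr0].
- apply: sepA => // l; rewrite ltnS leq_eqVlt => /predU1P[->//|]; exact: xl.
have [[e [Ae ed]]|Ad] := pselect (exists e, A e /\ phi d e != 0); last first.
  exists s; rewrite -Bs; apply/seteqP; split=> [x Ax|x []//].
  by split=> //; apply/eqP/negPn/negP => xd; apply: Ad; exists x.
exists (e :: s); apply/seteqP; split=> x; last first.
  move=> /lspan_cons[a [m []]]; rewrite -Bs => -[Am _] ->; exact: Al.
move=> Ax; apply/lspan_cons.
exists (phi d x / phi d e), (- (phi d x / phi d e) *: e + x); split.
  rewrite -Bs; split; first exact: Al.
  by rewrite phil mulNr divfK// addNr.
by rewrite scaleNr addrA subrr add0r.
Qed.

(** Coordinates on a span that are bounded on all of [E]. A new vector [e] outside the span has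
    distance at least some [d > 0] from it, as the span is closed, and Hahn-Banach gives [psi] of
    norm at most [1 / d] with [psi e = 1] and [psi = 0] on the span. *)
Lemma lspan_frame (E : completeNormedModType R) (s : seq E) :
  exists t : seq (E * bop E R),
    forall x, lspan s x -> x = \sum_(p <- t) p.2 x *: p.1.
Proof.
elim: s => [|e s [t tP]].
  by exists [::] => x [c ->]; rewrite big_ord0 big_nil.
have [es|es] := pselect (lspan s e).
  exists t => x /lspan_cons[a [m [sm ->]]]; apply: tP.
  exact: (lspan_linear s).2.
have [d d0 ed] : exists2 d : R, 0 < d & forall m, lspan s m -> d <= `|e - m|.
  have : open (~` lspan s) by rewrite openC; exact: lspan_closed.
  rewrite openE => /(_ _ es); rewrite /interior -nbhs_ballE => -[d /= d0 de].
  exists d => // m sm; rewrite leNgt; apply/negP => em.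
  by apply: (de m) => //; rewrite -ball_normE.
have [s0 sl] := lspan_linear s.
have [||||psi [_ psiP]] := @hahn_banach_bounded R E
    [set p | exists a m, lspan s m /\ p = (a *: e + m, a)] d^-1.
- by rewrite invr_ge0 ltW.
- by exists 0, 0; rewrite scale0r addr0.
- move=> a _ _ [b [m [sm ->]]] [c [n [sn ->]]] /=.
  exists (a * b + c), (a *: m + n); split; first exact: sl.
  by rewrite scalerDr scalerA scalerDl addrACA.
- move=> _ [a [m [sm ->]]] /=; rewrite ler_pdivlMl//.
  have [->|a0] := eqVneq a 0; first by rewrite mulr0.
  have -> : a *: e + m = a *: (e - (- a^-1) *: m).
    by rewrite scaleNr opprK scalerDr scalerA divff// scale1r.
  rewrite normrZ; apply: (@le_trans _ _ (`|a| * d)).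
    by rewrite mulrC ler_wpM2r ?ler_norm// ltW.
  by rewrite ler_wpM2l// ed// -[_ *: m]addr0; exact: sl.
(* Subtracting [p.2 e *: psi] makes the old coordinates vanish at [e] and leaves them unchanged on
   [lspan s]. *)
exists ((e, psi) ::
    [seq (p.1, (p.2 - p.2 e *: psi : bop E R)) | p : E * bop E R <- t]) => x.
move=> /lspan_cons[a [m [sm ->]]].
rewrite big_cons big_map /=.
have psia : psi (a *: e + m) = a.
  by apply: (psiP (a *: e + m, a)); exists a, m.
rewrite psia; congr +%R; rewrite [LHS]tP//; apply: eq_bigr => p _; congr (_ *: _).
rewrite bopBE [X in _ - X](_ : _ = p.2 e * psi (a *: e + m))// psia.
by rewrite bop_linear /GRing.scale/= mulrC addrAC subrr add0r.
Qed.

(** This reconstruction formula with bounded coordinates stands in for a basis in all that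
    follows. *)
Lemma finite_dim_frame (E : completeNormedModType R) : finite_dim [set: E] ->
  exists d (e : 'I_d -> E) (phi : 'I_d -> bop E R),
    forall x, x = \sum_l phi l x *: e l.
Proof.
move=> [s Es]; have [t tP] := lspan_frame s.
exists (size t), (fun l => (tnth (in_tuple t) l).1),
  (fun l => (tnth (in_tuple t) l).2) => x.
by rewrite {1}(tP x) ?(big_tnth _ _ t)// -Es.
Qed.

Lemma csub_space_finite_dim (E : completeNormedModType R) (M : fd_subspace E) :
  finite_dim [set: csub_space (fd_csub M)].
Proof.
have [s Ms] := fd_finite_dim M; have [t tP] := lspan_frame s.
apply: (@finite_dim_separated (csub_space (fd_csub M)) (size t)
    (fun l x => (nth ((0 : E), (0 : bop E R)) t l).2 (val x))).
- exact: linear_subspaceT.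
- by move=> l a x y; rewrite linearP.
- move=> x _ x0; apply/val_inj; rewrite [LHS]tP.
    rewrite (big_nth ((0 : E), (0 : bop E R))) big_mkord big1// => l _.
    by rewrite x0// scale0r.
  by rewrite -Ms; have /set_mem := valP x.
Qed.

(** With its converse [fc_subspace_forms], this describes subspaces of finite codimension as common
    kernels of finitely many forms, a description that passes at once to kernels and
    intersections. *)
Lemma csub_quot_finite_dim (E : completeNormedModType R) (L : closed_subspace E)
    d (phi : nat -> E -> R) :
  (forall l a x y, phi l (a *: x + y) = a * phi l x + phi l y) ->
  (forall l x, csub_set L x -> phi l x = 0) ->
  (forall x, (forall l, (l < d)%N -> phi l x = 0) -> csub_set L x) ->
  finite_dim [set: csub_quot L].
Proof.
move=> phil phiL Lphi.
have phi_pi l x y : csub_pi L x = csub_pi L y -> phi l x = phi l y.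
  move=> /csub_piP/(phiL l); rewrite addrC -scaleN1r phil; lra.
apply: (@finite_dim_separated (csub_quot L) d (fun l c => phi l (repr c))).
- exact: linear_subspaceT.
- move=> l a x y; rewrite -phil; apply: phi_pi.
  by rewrite csub_piD csub_piZ !csub_pi_repr.
- move=> c _ c0; rewrite -(csub_pi_repr c) -(csub_pi0 L); apply/csub_piP.
  by rewrite subr0; exact: Lphi.
Qed.

Lemma fc_subspace_forms (E : completeNormedModType R) (L : fc_subspace E) :
  exists d (phi : nat -> E -> R),
    [/\ forall l a x y, phi l (a *: x + y) = a * phi l x + phi l y,
        forall l x, csub_set L x -> phi l x = 0 &
        forall x, (forall l, (l < d)%N -> phi l x = 0) -> csub_set L x].
Proof.
have [d [e [phi ephi]]] := finite_dim_frame (fc_finite_dim L).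
(* Forms with an index outside ['I_d] are zero. *)
exists d, (fun l x => if insub l is Some k then phi k (csub_pi L x) else 0).
split=> [l a x y|l x Lx|x x0].
- case: insub => [k|]; last by rewrite mulr0 addr0.
  by rewrite csub_piD csub_piZ linearP.
- case: insub => // k; rewrite (_ : csub_pi L x = 0) ?linear0//.
  by rewrite -(csub_pi0 L); apply/csub_piP; rewrite subr0.
- rewrite -[x]subr0; apply/csub_piP; rewrite (csub_pi0 L) (ephi (csub_pi L x)).
  apply: big1 => l _.
  by have := x0 l (ltn_ord l); rewrite valK => ->; rewrite scale0r.
Qed.

Section kernel.
Variables (E N : completeNormedModType R) (T : bop E N).
Hypothesis Nfd : finite_dim [set: N].

Lemma ker_linear : linear_subspace [set x | T x = 0].
Proof.
split; first by rewrite /= linear0.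
by move=> a x y /= x0 y0; rewrite bop_linear x0 y0 scaler0 addr0.
Qed.

Lemma ker_closed : closed [set x | T x = 0].
Proof.
move=> x xcl; apply/eqP; rewrite -normr_le0; apply/ler_addgt0Pl => e e0.
have e1 : 0 < e / (`|T| + 1) by rewrite divr_gt0// ltr_wpDl.
have [y [/= y0]] := xcl _ (nbhsx_ballx x _ e1).
rewrite -ball_normE /= ltr_pdivlMr ?ltr_wpDl// => xy.
rewrite addr0 -[T x]subr0 -y0 -linearB; apply: le_trans (bop_norm_ub _ _) _.
by have := normr_ge0 (x - y); move: xy; nra.
Qed.

Lemma ker_fc_subproof :
  finite_dim [set: csub_quot (ClosedSubspace ker_linear ker_closed)].
Proof.
have [d [e [phi ephi]]] := finite_dim_frame Nfd.
apply: (@csub_quot_finite_dim _ _ d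
    (fun l x => if insub l is Some k then phi k (T x) else 0)).
- move=> l a x y; case: insub => [k|]; last by rewrite mulr0 addr0.
  by rewrite !linearP.
- by move=> l x /= x0; case: insub => // k; rewrite x0 linear0.
- move=> x x0 /=; rewrite (ephi (T x)); apply: big1 => l _.
  by have := x0 l (ltn_ord l); rewrite valK => ->; rewrite scale0r.
Qed.

(** These kernels are the subspaces [L] at which the maximal hulls get tested, for operators into
    finite-dimensional spaces and for single functionals. *)
Definition ker_fc : fc_subspace E := FcSubspace ker_fc_subproof.

End kernel.

Section intersection.
Variables (E : completeNormedModType R) (L M : fc_subspace E).

Lemma fcI_linear : linear_subspace (csub_set L `&` csub_set M).
Proof.
have [L0 Ll] := csub_linear L; have [M0 Ml] := csub_linear M.
split=> // a x y [Lx Mx] [Ly My]; split; [exact: Ll|exact: Ml].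
Qed.

Lemma fcI_closed : closed (csub_set L `&` csub_set M).
Proof. by apply: closedI; exact: csub_closed. Qed.

Lemma fcI_subproof :
  finite_dim [set: csub_quot (ClosedSubspace fcI_linear fcI_closed)].
Proof.
have [d [phi [phil phiL Lphi]]] := fc_subspace_forms L.
have [d' [psi [psil psiM Mpsi]]] := fc_subspace_forms M.
apply: (@csub_quot_finite_dim _ _ (d + d')
    (fun l => if (l < d)%N then phi l else psi (l - d)%N)).
- by move=> l a x y; case: ifP.
- by move=> l x [Lx Mx]; case: ifP => _; [exact: phiL|exact: psiM].
- move=> x x0; split.
    apply: Lphi => l ld; have := x0 l; rewrite ld; apply.
    exact: leq_trans ld (leq_addr _ _).
  apply: Mpsi => l ld; have := x0 (d + l)%N.
  by rewrite ltn_add2l ld [(_ < d)%N]ltnNge leq_addr addKn; exact.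
Qed.

Definition fcI : fc_subspace E := FcSubspace fcI_subproof.

End intersection.

End finite_dimension.

(** * Ultrafilters, and compactness in finite dimension *)

Section ultrafilters.

Lemma ultraN (T : Type) (U : set_system T) (UU : UltraFilter U) (A : set T) :
  ~ U A -> U (~` A).
Proof. by have [|] := in_ultra_setVsetC A UU. Qed.

(** The tails of a directed preorder generate a proper filter, and any ultrafilter containing it
    will do. *)
Lemma directed_ultrafilter (J : Type) (le : J -> J -> Prop) (j0 : J) :
  (forall j, le j j) -> (forall i j k, le i j -> le j k -> le i k) ->
  (forall i j, exists k, le i k /\ le j k) ->
  exists U : set_system J, UltraFilter U /\ forall j, U (le j).
Proof.
move=> lexx letr ledir.
pose F : set_system J := [set A | exists j, le j `<=` A].
have FF : ProperFilter F.
  apply: Build_ProperFilter_ex; first by move=> A [j jA]; exists j; exact: jA.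
  split; first by exists j0.
  - move=> A B [i iA] [j jB]; have [k [ik jk]] := ledir i j.
    by exists k => l kl; split; [apply: iA|apply: jB]; exact: letr kl.
  - by move=> A B AB [i iA]; exists i => l il; exact: AB (iA _ il).
have [U [UU FU]] := ultraFilterLemma FF.
by exists U; split=> // j; apply: FU; exists j.
Qed.

End ultrafilters.

Section finite_dimensional_limits.
Context {R : realType} {J : Type} (U : set_system J) (UU : UltraFilter U).

Lemma ultra_ler_cvg (f g : J -> R) (a b : R) :
  f @ U --> a -> g @ U --> b -> (\forall j \near U, f j <= g j) -> a <= b.
Proof.
move=> fa gb fg; have gfb : g j - f j @[j --> U] --> b - a by exact: cvgB.
rewrite -subr_ge0 -(cvg_lim _ gfb); last exact: Rhausdorff.
apply: limr_ge; first by apply/cvg_ex; exists (b - a).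
by apply: filterS fg => j; rewrite subr_ge0.
Qed.

Lemma bop_cvg (E F : completeNormedModType R) (T : bop E F) (x : J -> E) y :
  x @ U --> y -> T (x j) @[j --> U] --> T y.
Proof.
move=> xy; apply/cvgrPdist_lt => e e0.
have T1 : 0 < `|T| + 1 by rewrite ltr_wpDl.
move/cvgrPdist_lt : xy => /(_ _ (divr_gt0 e0 T1)); apply: filterS => j.
rewrite ltr_pdivlMr// => h; rewrite -linearB.
apply: le_lt_trans (bop_norm_ub _ _) _.
by have := normr_ge0 (y - x j); move: h; nra.
Qed.

(** The coordinates are bounded real families, so each has a limit along [U]. *)
Lemma finite_dim_ultra_cvg (E : completeNormedModType R) (x : J -> E) (M : R) :
  finite_dim [set: E] -> (forall j, `|x j| <= M) -> exists y : E, x @ U --> y.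
Proof.
move=> Efd xM; have [d [e [phi xphi]]] := finite_dim_frame Efd.
exists (\sum_l lim (phi l (x j) @[j --> U]) *: e l).
rewrite [X in X @ _](_ : x = fun j => \sum_l phi l (x j) *: e l); last first.
  by apply/funext => j; exact: xphi.
apply: cvg_big => [|l _]; first exact: add_continuous.
  apply: cvgZr_tmp.
apply: (@ultra_cvg _ _ _ UU _ (`|phi l| * M)) => j.
apply: le_trans (bop_norm_ub _ _) _; exact: ler_wpM2l.
Qed.

End finite_dimensional_limits.

(** Compactness of the unit sphere. If every finite list [s] of functionals failed at some unit
    vector [x s], the limit of the [x s] along an ultrafilter on the lists would have norm 1, while
    each functional of norm at most 1 would be at most [(1 + delta)^-1] there. *)
Lemma finite_norming_set (R : realType) (N : completeNormedModType R) (delta : R) :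
  finite_dim [set: N] -> 0 < delta ->
  exists m (a : 'I_m -> bop N R), (forall k, `|a k| <= 1) /\
    forall x C, 0 <= C -> (forall k, a k x <= C) -> `|x| <= (1 + delta) * C.
Proof.
move=> Nfd d0.
have d1 : 0 < 1 + delta by lra.
have d1V : (1 + delta)^-1 < 1 by rewrite invf_lt1//; lra.
(* By homogeneity it is enough to look at unit vectors; the members of [s] of norm at most 1 then
   form the family. *)
suff [s sP] : exists s : seq (bop N R), forall x,
    (forall a : bop N R, a \in s -> `|a| <= 1 -> a x <= (1 + delta)^-1) -> `|x| != 1.
  pose t := [seq a <- s | `|a| <= 1].
  exists (size t), (tnth (in_tuple t)); split=> [k|x C C0 xC].
    by have := mem_tnth k (in_tuple t); rewrite mem_filter => /andP[].
  rewrite leNgt; apply/negP => Cx.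
  have x0 : 0 < `|x| by apply: le_lt_trans Cx; rewrite mulr_ge0// ltW.
  have : `| `|x|^-1 *: x| == 1 by rewrite normrZ gtr0_norm ?invr_gt0// mulVf// gt_eqF.
  apply/negP/sP => a sa a1.
  have : a \in t by rewrite mem_filter a1 sa.
  move=> /(tnthP (in_tuple t))[k ak].
  rewrite linearZ /= /GRing.scale/= ler_pdivrMl// ler_pdivlMr// mulrC.
  apply: le_trans (ltW Cx); rewrite ler_pM2l// ak; exact: xC.
apply: contrapT => sN.
have /choice[x xP] : forall s : seq (bop N R), exists x,
    (forall a : bop N R, a \in s -> `|a| <= 1 -> a x <= (1 + delta)^-1) /\ `|x| = 1.
  move=> s; apply: contrapT => sx; apply: sN; exists s => x xs.
  by apply/eqP => x1; apply: sx; exists x.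
have [|||U [UU Us]] :=
    @directed_ultrafilter (seq (bop N R)) (fun s t => {subset s <= t}) [::].
- by move=> s a.
- by move=> s t u st tu a /st/tu.
- by move=> s t; exists (s ++ t); split=> a; rewrite mem_cat => ->; rewrite ?orbT.
have [|y xy] := @finite_dim_ultra_cvg _ _ U UU N x 1 Nfd.
  by move=> s; rewrite (xP s).2.
have y1 : `|y| = 1.
  have /cvg_lim <- : `|x s| @[s --> U] --> `|y| by exact: cvg_norm.
    rewrite (_ : (fun s => `|x s|) = cst 1) ?lim_cst//.
    by apply/funext => s; exact: (xP s).2.
  exact: Rhausdorff.
have : `|y| <= (1 + delta)^-1; last by rewrite y1 leNgt d1V.
apply: norm_le_dual => a a1.
have xa := bop_cvg UU (T := a) xy.
rewrite -(cvg_lim _ xa); last exact: Rhausdorff.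
apply: limr_le; first by apply/cvg_ex; exists (a y).
(* The lists that contain the given [a] form a tail, hence a set in [U]. *)
apply: filterS (Us [:: a]) => s sa; apply: (xP s).1 => //.
by apply: sa; rewrite mem_head.
Qed.

(** * Local duality for ultraproducts *)

Section finite_rank_interpolation.
Context {R : realType} (F N : completeNormedModType R).
Variables (d : nat) (e : 'I_d -> N) (phi : 'I_d -> bop N R).
Hypothesis frame : forall x, x = \sum_l phi l x *: e l.
Variables (m : nat) (a : 'I_m -> bop N R) (delta eps : R).
Hypothesis norming :
  forall x C, 0 <= C -> (forall k, a k x <= C) -> `|x| <= (1 + delta) * C.
Hypotheses (delta0 : 0 <= delta) (eps0 : 0 <= eps).
Variables (p : nat) (y : 'I_p -> F) (r : 'I_p -> N).

Local Notation K := ('I_m + 'I_d)%type.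

(* An operator [F -> N] amounts to a functional on [F^K] that kills the families
   [w] with [\sum_k b k v *: w k = 0] for all [v : N]: the coordinates [phi] are
   among the [b k], so the operator is read off the components. The weight 1 on
   the norming functionals [a] is what bounds its norm by [1 + delta]. *)
Definition interp_form (k : K) : bop N R :=
  match k with inl i => a i | inr l => phi l end.

(** On the coordinates the weight dominates [|phi l|]; the added 1 keeps it at least 1, which later
    bounds the obstructions [w]. *)
Definition interp_weight (k : K) : R :=
  match k with inl _ => 1 | inr l => 1 + `|phi l| end.

Local Notation b := interp_form.
Local Notation c := interp_weight.

Let c0 k : 0 <= c k.
Proof. by case: k => //= l; rewrite addr_ge0. Qed.

Let V := ((K -> F) * ('I_p -> K -> R^o))%type.

Let rho (v : N) (q : V) : F :=
  \sum_k b k v *: (q.1 k - \sum_j q.2 j k *: y j).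

Let rel (q : V) := forall v : N, rho v q = 0.

(** The value of [\sum_k b k (T (w k))] on a relation [(w, t)], for any operator [T] with
    [T (y j) = r j] for all [j]. *)
Let val_rel (q : V) : R := \sum_k \sum_j q.2 j k * b k (r j).

(** The first sum controls the norm of the operator. The second is the price for missing the
    targets: a functional below [Q] has size at most [eps] on the unit vectors of the [t]-part, and
    these values are the errors at the [y j]. *)
Let Q (q : V) : R :=
  \sum_k c k * `|q.1 k| + eps * \sum_k \sum_j `|q.2 j k|.

(** With [t] normalized, a failure of this inequality is a bounded obstruction with a fixed gap
    [eps], so it can be followed along an ultrafilter. *)
Hypothesis dominated : forall (w : K -> F) (t : 'I_p -> K -> R),
  (forall v : N, \sum_k b k v *: (w k - \sum_j t j k *: y j) = 0) ->
  \sum_k \sum_j `|t j k| = 1 ->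
  \sum_k \sum_j t j k * b k (r j) <= \sum_k c k * `|w k| + eps.

Let rho_linear v : linear (rho v).
Proof.
move=> s q q'; rewrite /rho.
rewrite scaler_sumr -big_split/=; apply: eq_bigr => k _.
rewrite scalerA [s * _]mulrC -scalerA -scalerDr; congr (_ *: _).
rewrite scalerBr addrACA -opprD scaler_sumr -big_split/=; congr (_ - _).
by apply: eq_bigr => j _; rewrite scalerA -scalerDl.
Qed.

Let rhoL v : {linear V -> F} :=
  HB.pack (rho v) (GRing.isLinear.Build R V F *:%R (rho v) (rho_linear v)).

Let val_rel_linear : linear (val_rel : V -> R^o).
Proof.
move=> s q q'; rewrite /val_rel scaler_sumr -big_split/=; apply: eq_bigr => k _.
rewrite scaler_sumr -big_split/=; apply: eq_bigr => j _.
by rewrite /GRing.scale/= mulrA -mulrDl.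
Qed.

Let val_relL : {linear V -> R^o} := HB.pack (val_rel : V -> R^o)
  (GRing.isLinear.Build R V R^o *:%R (val_rel : V -> R^o) val_rel_linear).

Let Q_add q q' : Q (q + q') <= Q q + Q q'.
Proof.
rewrite /Q addrACA -mulrDr; apply: lerD.
  rewrite -big_split/=; apply: ler_sum => k _.
  by rewrite -mulrDr ler_wpM2l// ler_normD.
rewrite ler_wpM2l// -big_split/=; apply: ler_sum => k _.
rewrite -big_split/=; apply: ler_sum => j _; exact: ler_normD.
Qed.

Let Q_pos s q : 0 < s -> Q (s *: q) = s * Q q.
Proof.
move=> s0; rewrite /Q mulrDr; congr +%R.
  rewrite mulr_sumr; apply: eq_bigr => k _ /=.
  by rewrite normrZ gtr0_norm// mulrCA.
rewrite mulrCA; congr (_ * _); rewrite mulr_sumr; apply: eq_bigr => k _.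
rewrite mulr_sumr; apply: eq_bigr => j _ /=.
by rewrite normrM gtr0_norm.
Qed.

Let tnorm (q : V) : R := \sum_k \sum_j `|q.2 j k|.

Let tnorm_ge0 q : 0 <= tnorm q.
Proof. by apply: sumr_ge0 => k _; exact: sumr_ge0. Qed.

Let tnorm_eq0 q : tnorm q = 0 -> forall j k, q.2 j k = 0.
Proof.
move=> /eqP q0 j k; apply/normr0_eq0; move: q0.
rewrite psumr_eq0; last by move=> k' _; exact: sumr_ge0.
move=> /allP/(_ k (mem_index_enum _)) /=.
by rewrite psumr_eq0// => /allP/(_ j (mem_index_enum _)) /= /eqP.
Qed.

Let tnormZ s q : 0 < s -> tnorm (s *: q) = s * tnorm q.
Proof.
move=> s0; rewrite /tnorm mulr_sumr; apply: eq_bigr => k _.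
by rewrite mulr_sumr; apply: eq_bigr => j _ /=; rewrite normrM gtr0_norm.
Qed.

(** Homogeneity reduces to [tnorm q = 1], which is [dominated]; if [tnorm q = 0] the left side
    vanishes. *)
Let rel_dominated q : rel q -> val_relL q <= Q q.
Proof.
have := tnorm_ge0 q; rewrite le_eqVlt => /predU1P[/esym/tnorm_eq0 q0 _|].
  rewrite [leLHS]big1 => [|k _]; last by apply: big1 => j _; rewrite q0 mul0r.
  by rewrite /Q addr_ge0// ?mulr_ge0 ?sumr_ge0// => k _; rewrite ?mulr_ge0 ?sumr_ge0.
have [n nE] : exists n, tnorm q = n by exists (tnorm q).
rewrite nE => n0 rq.
have [q' qE] : exists q', q = n *: q'.
  by exists (n^-1 *: q); rewrite scalerA divff ?gt_eqF// scale1r.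
move: rq nE; rewrite {}qE tnormZ// => rq nE.
have q'1 : tnorm q' = 1 by apply: (mulfI (lt0r_neq0 n0)); rewrite mulr1.
have rq' v : rho v q' = 0.
  have := rq v; rewrite -[rho v _]/(rhoL v _) linearZ => /eqP.
  by rewrite scaler_eq0 gt_eqF// => /eqP.
rewrite linearZ Q_pos//= (ler_wpM2l (ltW n0))//.
rewrite /Q -/(tnorm q') q'1 mulr1.
exact: (dominated rq' q'1).
Qed.

Let single (k : K) (x : F) : V := (fun k' => if k' == k then x else 0, 0).

Let single_linear k s x z : single k (s *: x + z) = s *: single k x + single k z.
Proof.
congr pair; last first.
  by apply/funext => j; apply/funext => k' /=; rewrite !fctE /= scaler0 addr0.
by apply/funext => k'; rewrite !fctE /= !fctE; case: ifP; rewrite // scaler0 addr0.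
Qed.

Let Q_single k x : Q (single k x) = c k * `|x|.
Proof.
rewrite /Q [X in _ + _ * X]big1 ?mulr0 ?addr0 => [|k' _]; last first.
  by apply: big1 => j _; rewrite normr0.
rewrite (bigD1 k)//= eqxx big1 ?addr0// => k' /negbTE ->.
by rewrite normr0 mulr0.
Qed.

Let unit_t (j : 'I_p) (k : K) (s : R) : V :=
  (0, fun j' k' => if (j' == j) && (k' == k) then s else 0).

Let Q_unit_t j k s : Q (unit_t j k s) = eps * `|s|.
Proof.
rewrite /Q big1 ?add0r => [|k' _]; last by rewrite normr0 mulr0.
congr (_ * _); rewrite (bigD1 k)//= [X in _ + X]big1 ?addr0 => [|k' /negbTE k'k].
  rewrite (bigD1 j)//= !eqxx big1 ?addr0// => j' /negbTE ->.
  by rewrite normr0.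
by apply: big1 => j' _; rewrite k'k andbF normr0.
Qed.

Let rho_single v k x : rhoL v (single k x) = b k v *: x.
Proof.
rewrite /rhoL/= /rho (bigD1 k)//= eqxx [X in x - X]big1 ?subr0 => [|j _]; last first.
  by rewrite scale0r.
rewrite [X in _ + X]big1 ?addr0// => k' /negbTE ->.
by rewrite big1 ?subr0 ?scaler0// => j _; rewrite scale0r.
Qed.

Let rho_unit_t v j k s : rhoL v (unit_t j k s) = - (s * b k v) *: y j.
Proof.
rewrite /rhoL/= /rho (bigD1 k)//=.
rewrite [X in _ + X]big1 ?addr0 => [|k' /negbTE k'k]; last first.
  by rewrite big1 ?subr0 ?scaler0// => j' _; rewrite k'k andbF scale0r.
rewrite (bigD1 j)//= !eqxx [X in _ - (_ + X)]big1 => [|j' /negbTE ->]; last first.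
  by rewrite scale0r.
by rewrite addr0 sub0r scalerN scalerA scaleNr mulrC.
Qed.

Let val_rel_single k x : val_relL (single k x) = 0.
Proof. by apply: big1 => k' _; apply: big1 => j _; rewrite mul0r. Qed.

Let val_rel_unit_t j k s : val_relL (unit_t j k s) = s * b k (r j).
Proof.
rewrite /val_relL/= /val_rel (bigD1 k)//=.
rewrite [X in _ + X]big1 ?addr0 => [|k' /negbTE k'k]; last first.
  by apply: big1 => j' _; rewrite k'k andbF mul0r.
rewrite (bigD1 j)//= !eqxx [X in _ + X]big1 ?addr0// => j' /negbTE ->.
by rewrite mul0r.
Qed.

(** Hahn-Banach extends [val_rel] from the relations to a functional [H] below [Q]. Its components
    at the coordinates [phi] define [T], and the norm and the errors of [T] are measured by the
    functionals [a]. *)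
Lemma interpolation : exists T : bop F N, `|T| <= 1 + delta /\
  forall j, `|T (y j) - r j| <= (1 + delta) * eps.
Proof.
have [|||h [hl hQ hv]] := @hahn_banach R V Q Q_add Q_pos
    [set z | rel z.1 /\ z.2 = val_rel z.1].
- split=> [v|]; first exact: (linear0 (rhoL v)).
  by apply/esym; exact: (linear0 val_relL).
- move=> s [q _] [q' _] [/= rq ->] [/= rq' ->]; split=> [v|] /=.
    by rewrite [LHS](linearP (rhoL v)) /= rq rq' scaler0 addr0.
  by rewrite [RHS](linearP val_relL).
- by move=> [q _] [/= rq ->]; exact: rel_dominated.
have [H HE] : exists H : {linear V -> R^o}, forall q, H q = h q.
  pose H : {linear V -> R^o} := HB.pack (h : V -> R^o)
    (GRing.isLinear.Build R V R^o *:%R (h : V -> R^o) hl).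
  by exists H.
have {hv} Hv q : rel q -> H q = val_relL q.
  by move=> rq; rewrite HE; exact: (hv (q, val_rel q)).
have {hQ} HQ q : H q <= Q q by rewrite HE; exact: hQ.
have s_le k x : H (single k x) <= c k * `|x| by rewrite -Q_single.
have s_bound k x : `|H (single k x)| <= c k * `|x|.
  rewrite ler_norml s_le andbT lerNl -linearN.
  have -> : - single k x = single k (- x).
    congr pair; last exact: oppr0.
    by apply/funext => k'; rewrite !fctE /=; case: ifP; rewrite ?oppr0.
  by rewrite -(normrN x).
pose Tf (x : F) : N := \sum_l H (single (inr l) x) *: e l.
have TfP : bounded_linear Tf.
  split=> [s x z|].
    rewrite /Tf scaler_sumr -big_split/=; apply: eq_bigr => l _.
    by rewrite single_linear linearP scalerDl scalerA.
  exists (\sum_l c (inr l) * `|e l|) => x.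
  apply: le_trans (ler_norm_sum _ _ _) _; rewrite mulr_suml.
  apply: ler_sum => l _; rewrite normrZ mulrAC; exact: ler_wpM2r.
pose T := mkbop TfP.
have bT k x : b k (T x) = H (single k x).
  have -> : b k (T x) = \sum_l b k (e l) * H (single (inr l) x).
    rewrite (_ : T x = Tf x)// /Tf linear_sum; apply: eq_bigr => l _.
    by rewrite linearZ /GRing.scale/= mulrC.
  (* This is a relation because [b k] is the combination of the [phi l] with coefficients
     [b k (e l)]. *)
  pose q : V := single k x - \sum_l b k (e l) *: single (inr l) x.
  have rq : rel q.
    move=> v; change (rhoL v q = 0).
    rewrite (linearB (rhoL v)) (linear_sum (rhoL v)) rho_single.
    under eq_bigr do rewrite (linearZZ (rhoL v)) rho_single scalerA.
    rewrite -scaler_suml -scalerBl (_ : b k v = \sum_l b k (e l) * phi l v).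
      by rewrite subrr scale0r.
    rewrite [in LHS](frame v) linear_sum; apply: eq_bigr => l _.
    by rewrite linearZ /GRing.scale/= mulrC.
  have := Hv q rq; rewrite (linearB H) (linearB val_relL).
  rewrite (linear_sum H) (linear_sum val_relL) val_rel_single.
  rewrite [X in _ = 0 - X]big1 => [|l _]; last first.
    by rewrite (linearZZ val_relL) val_rel_single scaler0.
  under eq_bigr do rewrite (linearZZ H) /GRing.scale/=.
  by rewrite subr0 => /eqP; rewrite subr_eq0 => /eqP ->.
exists T; split.
  apply: bop_norm_le => [|x]; first by rewrite addr_ge0.
  apply: norming => // k; rewrite (bT (inl k)).
  by apply: le_trans (s_le _ _) _; rewrite /= mul1r.
move=> j; apply: norming => // k.
rewrite linearB /= (bT (inl k)).
(* The relation [y j - y j = 0] in component [k], whose prescribed value is [a k (r j)]. *)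
pose q : V := single (inl k) (y j) + unit_t j (inl k) 1.
have rq : rel q.
  move=> v; change (rhoL v q = 0).
  by rewrite (linearD (rhoL v)) rho_single rho_unit_t mul1r scaleNr subrr.
have := Hv q rq; rewrite (linearD H) (linearD val_relL).
rewrite val_rel_single val_rel_unit_t add0r mul1r.
move=> /= <-; rewrite opprD addrA subrr add0r -linearN.
have -> : - unit_t j (inl k) 1 = unit_t j (inl k) (-1).
  congr pair; first exact: oppr0.
  apply/funext => j'; apply/funext => k'; rewrite !fctE /=.
  by case: ifP => // _; exact: oppr0.
by apply: le_trans (HQ _) _; rewrite Q_unit_t normrN1 mulr1.
Qed.

End finite_rank_interpolation.

(** * Linear structure of Banach space ultraproducts, and local duality *)

Section ultraproduct_theory.
Context {R : realType} {J : Type} (U : set_system J) (UU : UltraFilter U).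
Implicit Types E F : J -> completeNormedModType R.

(** A name for the evaluation, so that it can carry a linear structure. *)
Definition linf_eval E i (x : linf E) : E i := val x i.

Lemma linf_eval_linear E i : linear (@linf_eval E i).
Proof. by []. Qed.

HB.instance Definition _ E i := GRing.isLinear.Build R (linf E) (E i) *:%R
  (@linf_eval E i) (@linf_eval_linear E i).

Lemma ultraclass_linear E : linear (@ultraclass R J U UU E).
Proof. by move=> a x y; rewrite /ultraclass csub_piD csub_piZ. Qed.

HB.instance Definition _ E := GRing.isLinear.Build R (linf E) (ultraproduct UU E)
  *:%R (@ultraclass R J U UU E) (@ultraclass_linear E).

Lemma ultraclass_repr E (c : ultraproduct UU E) : ultraclass UU (repr c) = c.
Proof. exact: csub_pi_repr. Qed.

Lemma ultraclass_eq0 E (x : linf E) :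
  `|linf_eval i x| @[i --> U] --> (0 : R) -> ultraclass UU x = 0.
Proof.
move=> x0; rewrite -(linear0 (@ultraclass R J U UU E)); apply/ultraclassP.
suff -> : (fun i => `|val x i - val (0 : linf E) i|) =
    (fun i => `|linf_eval i x|) by [].
by apply/funext => i; rewrite (_ : val (0 : linf E) i = 0) ?subr0.
Qed.

Lemma ultraclass_norm_cvg E (x : linf E) :
  `|linf_eval i x| @[i --> U] --> `|ultraclass UU x|.
Proof.
rewrite ultraproduct_normE; apply: (@ultra_cvg _ _ _ UU _ `|x|) => i.
by rewrite normr_id; exact: linf_norm_ub.
Qed.

(** The uniform bound [C] makes the class of [(T i (x i))] independent of the representative [x];
    linearity and the norm bound are then read off representatives. *)
Lemma ultraproduct_bop E F (T : forall i, bop (E i) (F i)) (C : R) :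
  0 <= C -> (forall i, `|T i| <= C) ->
  exists TU : bop (ultraproduct UU E) (ultraproduct UU F), `|TU| <= C /\
    forall (x : linf E) (y : linf F),
      (forall i, linf_eval i y = T i (linf_eval i x)) ->
      TU (ultraclass UU x) = ultraclass UU y.
Proof.
move=> C0 TC.
have Tle i (z : E i) : `|T i z| <= C * `|z|.
  by apply: le_trans (bop_norm_ub _ _) _; exact: ler_wpM2r.
have xb (x : linf E) : exists M : R, forall i, `|T i (linf_eval i x)| <= M.
  exists (C * `|x|) => i; apply: le_trans (Tle _ _) _.
  by apply: ler_wpM2l => //; exact: linf_norm_ub.
pose f (c : ultraproduct UU E) : ultraproduct UU F :=
  ultraclass UU (mklinf (xb (repr c))).
have fE x y : (forall i, linf_eval i y = T i (linf_eval i x)) ->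
    f (ultraclass UU x) = ultraclass UU y.
  move=> xy; apply/ultraclassP.
  have /ultraclassP h := ultraclass_repr (ultraclass UU x).
  have Ch : C * `|linf_eval i (repr (ultraclass UU x)) - linf_eval i x|
      @[i --> U] --> (0 : R).
    by rewrite -(mulr0 C); apply: cvgM => //; exact: cvg_cst.
  apply: (squeeze_cvgr _ (cvg_cst 0) Ch); apply: nearW => i.
  by rewrite normr_ge0 [val y i]xy /= -linearB Tle.
have fE' x : f (ultraclass UU x) = ultraclass UU (mklinf (xb x)) by exact: fE.
have fl : linear f.
  move=> a c d; rewrite -(ultraclass_repr c) -(ultraclass_repr d).
  rewrite !fE' -[in LHS]linearP -[RHS]linearP.
  by apply: fE => i; rewrite linearP [RHS]linearP.
have fb c : `|f c| <= C * `|c|.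
  rewrite -(ultraclass_repr c) fE'.
  have h := @ultraclass_norm_cvg _ (repr c).
  have Ch : C * `|linf_eval i (repr c)| @[i --> U] -->
      C * `|ultraclass UU (repr c)|.
    by apply: cvgM => //; exact: cvg_cst.
  apply: (ultra_ler_cvg UU (@ultraclass_norm_cvg _ (mklinf (xb (repr c)))) Ch).
  by apply: nearW => i; exact: Tle.
have fB : bounded_linear f by split=> //; exists C.
by exists (mkbop fB); split; [apply: bop_norm_le|exact: fE].
Qed.

Section local_duality.
Variables (F : J -> completeNormedModType R) (N : completeNormedModType R).
Variables (S : bop (ultraproduct UU F) N) (p : nat) (y : 'I_p -> linf F).
Hypotheses (Nfd : finite_dim [set: N]) (S1 : `|S| <= 1).

(* Finitely many values of a finite-rank operator on an ultraproduct are
   attained, up to [eps], by operators on the factors with almost the same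
   norm. Otherwise the dual obstructions [(w, t)] given by the failure of
   [interpolation] pass to the limit, where [S] itself refutes them. *)
Lemma ultraproduct_local_duality (delta eps : R) : 0 < delta -> 0 < eps ->
  U [set i | exists T : bop (F i) N, `|T| <= 1 + delta /\
    forall j, `|T (linf_eval i (y j)) - S (ultraclass UU (y j))| <=
              (1 + delta) * eps].
Proof.
move=> d0 e0; set A := (X in U X).
have [n [e [phi frame]]] := finite_dim_frame Nfd.
have [m [a [a1 norming]]] := finite_norming_set Nfd d0.
pose K := ('I_m + 'I_n)%type.
pose b : K -> bop N R := interp_form phi a.
pose c : K -> R := interp_weight phi (m := m).
have c1 k : 1 <= c k by case: k => //= l; rewrite lerDl.
have bc k : `|b k| <= c k.
  by case: k => [k|l] /=; [exact: a1|rewrite lerDr].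
pose r j := S (ultraclass UU (y j)).
apply: contrapT => /(ultraN UU) UA.
(* A violation of the hypothesis [dominated] of [interpolation] in the factor [F i]. *)
pose bad i (w : K -> F i) (t : 'I_p -> K -> R) := [/\
  forall v : N, \sum_k b k v *: (w k - \sum_j t j k *: linf_eval i (y j)) = 0,
  \sum_k \sum_j `|t j k| = 1 &
  \sum_k c k * `|w k| + eps < \sum_k \sum_j t j k * b k (r j)].
(* [M] bounds each [|w k|] uniformly in [i]: the weights are at least 1 and all [|t j k|] are at
   most 1. On [A], where there is no obstruction to record, zeros are chosen. *)
pose M := \sum_k \sum_j `|b k (r j)|.
have M0 : 0 <= M by apply: sumr_ge0 => k _; exact: sumr_ge0.
have choose i : exists wt : (K -> F i) * ('I_p -> K -> R),
    [/\ ~ A i -> bad i wt.1 wt.2, forall k, `|wt.1 k| <= M &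
        forall j k, `|wt.2 j k| <= 1].
  have [Ai|nAi] := pselect (A i).
    by exists (fun=> 0, fun _ _ => 0); split=> // *; rewrite normr0.
  have [w [t wt]] : exists w t, bad i w t.
    apply: contrapT => nbad; apply: nAi.
    apply: (interpolation frame norming (ltW d0) (ltW e0)).
    move=> w t wt t1; rewrite leNgt; apply/negP => lt.
    by apply: nbad; exists w, t.
  have [_ t1 lt] := wt.
  have tle j k : `|t j k| <= 1.
    rewrite -t1 (bigD1 k)//= (bigD1 j)//= -addrA lerDl addr_ge0//.
      exact: sumr_ge0.
    by apply: sumr_ge0 => k' _; exact: sumr_ge0.
  exists (w, t); split=> // k /=.
  apply: (@le_trans _ _ (\sum_k \sum_j t j k * b k (r j))); last first.
    apply: ler_sum => k' _; apply: ler_sum => j _.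
    apply: le_trans (ler_norm _) _; rewrite normrM.
    by rewrite ler_piMl.
  apply: le_trans (ltW lt); rewrite (bigD1 k)//= -addrA.
  apply: (@le_trans _ _ (c k * `|w k|)).
    by rewrite ler_peMl.
  rewrite lerDl; apply: addr_ge0; last exact: ltW.
  apply: sumr_ge0 => k' _.
  by rewrite mulr_ge0// (le_trans ler01).
pose w i := (sval (cid (choose i))).1.
pose t i := (sval (cid (choose i))).2.
have wtbad i : ~ A i -> bad i (w i) (t i).
  by have [h _ _] := svalP (cid (choose i)).
have wb k : exists M : R, forall i, `|w i k| <= M.
  by exists M => i; have [_ h _] := svalP (cid (choose i)); exact: h.
pose W k := mklinf (wb k).
pose t' j k := lim (t i j k @[i --> U]).
have tt' j k : t i j k @[i --> U] --> t' j k.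
  apply: (@ultra_cvg _ _ _ UU _ 1) => i.
  by have [_ _ h] := svalP (cid (choose i)); exact: h.
(* The limiting relation has coefficients [t']; replacing [t i] by [t'] costs at most the sum in
   [lim0], which tends to 0. *)
pose D k := W k - \sum_j t' j k *: y j.
have D0 v : \sum_k b k v *: ultraclass UU (D k) = 0.
  under eq_bigr do rewrite -linearZ.
  rewrite -linear_sum; apply: ultraclass_eq0.
  have lim0 : \sum_k \sum_j `|b k v| * (`|t' j k - t i j k| * `|y j|)
      @[i --> U] --> (0 : R).
    rewrite [X in _ --> X](_ : 0 = \sum_(k : K) \sum_(j < p) (0 : R)); last first.
      by rewrite big1// => k _; rewrite big1.
    apply: cvg_big => [|k _]; first exact: add_continuous.
    apply: cvg_big => [|j _]; first exact: add_continuous.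
    rewrite -(mulr0 `|b k v|); apply: cvgM; first exact: cvg_cst.
    rewrite -(mul0r `|y j|); apply: cvgM; last exact: cvg_cst.
    rewrite -(normr0 R) -(subrr (t' j k)); apply: cvg_norm.
    by apply: cvgB => //; exact: cvg_cst.
  apply: (squeeze_cvgr _ (cvg_cst 0) lim0); apply: filterS UA => i nAi.
  have [rel _ _] := wtbad i nAi.
  have -> : linf_eval i (\sum_k b k v *: D k) =
      \sum_k b k v *: \sum_j (t i j k - t' j k) *: linf_eval i (y j).
    transitivity (linf_eval i (\sum_k b k v *: D k) -
        \sum_k b k v *: (w i k - \sum_j t i j k *: linf_eval i (y j))).
      by rewrite rel subr0.
    rewrite linear_sum -sumrB; apply: eq_bigr => k _.
    rewrite linearZ /= -scalerBr; congr (_ *: _).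
    rewrite linearB linear_sum /= opprB addrC subrKA -sumrB.
    by apply: eq_bigr => j _; rewrite scalerBl (linearZZ (@linf_eval F i)).
  rewrite normr_ge0; apply: le_trans (ler_norm_sum _ _ _) _.
  apply: ler_sum => k _; rewrite normrZ -mulr_sumr; apply: ler_wpM2l => //.
  apply: le_trans (ler_norm_sum _ _ _) _; apply: ler_sum => j _.
  by rewrite normrZ distrC; apply: ler_wpM2l => //; exact: linf_norm_ub.
(* Expanding [S] in the frame reduces this to [D0] at each [e l]. *)
have key : \sum_k \sum_j t' j k * b k (r j) = \sum_k b k (S (ultraclass UU (W k))).
  have : \sum_k b k (S (ultraclass UU (D k))) = 0.
    transitivity (\sum_l phi l (S (\sum_k b k (e l) *: ultraclass UU (D k)))).
      under [RHS]eq_bigr do rewrite !bop_sum.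
      rewrite exchange_big; apply: eq_bigr => k _.
      rewrite [in LHS](frame (S _)) bop_sum; apply: eq_bigr => l _.
      by rewrite !bopZ /GRing.scale/= mulrC.
    by apply: big1 => l _; rewrite D0 !linear0.
  have -> : \sum_k b k (S (ultraclass UU (D k))) =
      \sum_k b k (S (ultraclass UU (W k))) - \sum_k \sum_j t' j k * b k (r j).
    rewrite -sumrB; apply: eq_bigr => k _; rewrite !linearB; congr (_ - _).
    rewrite (linear_sum (@ultraclass R J U UU F)) /= !bop_sum.
    apply: eq_bigr => j _.
    by rewrite (linearZZ (@ultraclass R J U UU F)) !bopZ.
  by move=> /eqP; rewrite subr_eq0 => /eqP.
have lims : (\sum_k \sum_j t i j k * b k (r j) - \sum_k c k * `|w i k|)
    @[i --> U] --> \sum_k \sum_j t' j k * b k (r j) -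
      \sum_k c k * `|ultraclass UU (W k)|.
  apply: cvgB.
    apply: cvg_big => [|k _]; first exact: add_continuous.
    apply: cvg_big => [|j _]; first exact: add_continuous.
    by apply: cvgM => //; exact: cvg_cst.
  apply: cvg_big => [|k _]; first exact: add_continuous.
  by apply: cvgM; [exact: cvg_cst|exact: (@ultraclass_norm_cvg _ (W k))].
have : eps <= \sum_k \sum_j t' j k * b k (r j) -
      \sum_k c k * `|ultraclass UU (W k)|.
  apply: (ultra_ler_cvg UU (cvg_cst eps) lims); apply: filterS UA => i nAi.
  by have [_ _] := wtbad i nAi; rewrite /=; lra.
(* The gap [eps] survives in the limit, yet every summand is at most 0 because [|b k| <= c k] and
   [|S| <= 1]. *)
rewrite key -sumrB => /(lt_le_trans e0); rewrite ltNge => /negP; apply.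
apply: sumr_le0 => k _; rewrite subr_le0.
apply: le_trans (ler_norm _) _; apply: le_trans (bop_norm_ub _ _) _.
apply: ler_pM => //; apply: le_trans (bop_norm_ub _ _) _.
by rewrite ler_piMl.
Qed.

End local_duality.
End ultraproduct_theory.

(** * Ultrastability of the maximal hull *)

Section factorizations.
Context {R : realType}.

(** The norm does not grow because representatives can be chosen with norm arbitrarily close to the
    quotient norm. *)
Lemma bop_quot_factor (F N : completeNormedModType R) (L : closed_subspace F)
    (T : bop F N) : (forall x, csub_set L x -> T x = 0) ->
  exists T' : bop (csub_quot L) N, `|T'| <= `|T| /\
    forall x, T' (csub_pi L x) = T x.
Proof.
move=> TL; pose f (c : csub_quot L) : N := T (repr c).
have fE x : f (csub_pi L x) = T x.
  apply/eqP; rewrite -subr_eq0 -linearB; apply/eqP/TL/csub_piP.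
  by rewrite csub_pi_repr.
have fb c : `|f c| <= `|T| * `|c|.
  apply/ler_addgt0Pr => e e0.
  have T1 : 0 < `|T| + 1 by rewrite ltr_wpDl.
  have [|x xc xe] := @csub_quot_norm_lt R F L c (`|c| + e / (`|T| + 1)).
    by rewrite ltrDl divr_gt0.
  rewrite -{1}xc fE; apply: le_trans (bop_norm_ub _ _) _.
  apply: le_trans (ler_wpM2l (normr_ge0 T) (ltW xe)) _.
  rewrite mulrDr lerD2l mulrA ler_pdivrMr// mulrC ler_wpM2l ?ltW//; lra.
have fB : bounded_linear f.
  split; last by exists `|T|.
  move=> a c c'; rewrite -(csub_pi_repr c) -(csub_pi_repr c').
  by rewrite -csub_piZ -csub_piD !fE linearP.
by exists (mkbop fB); split; [apply: bop_norm_le|].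
Qed.

Lemma bop_corestrict (M E : completeNormedModType R) (L : closed_subspace E)
    (T : bop M E) : (forall x, csub_set L (T x)) ->
  exists T' : bop M (csub_space L), `|T'| <= `|T| /\ forall x, val (T' x) = T x.
Proof.
move=> TL; pose f x : csub_space L := exist _ (T x) (mem_set (TL x)).
have fB : bounded_linear f.
  split; last by exists `|T| => x; exact: bop_norm_ub.
  by move=> a x y; apply/val_inj; rewrite /= linearP.
exists (mkbop fB); split=> //; apply: bop_norm_le => // x; exact: bop_norm_ub.
Qed.

Lemma scalar_map_subproof (E : completeNormedModType R) (x : E) :
  bounded_linear (fun a : R => a *: x).
Proof.
split=> [a b c|]; first by rewrite scalerDl scalerA.
by exists `|x| => a; rewrite normrZ mulrC.
Qed.

Definition scalar_map (E : completeNormedModType R) (x : E) : bop R E :=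
  mkbop (scalar_map_subproof x).

Lemma scalar_map_norm (E : completeNormedModType R) (x : E) :
  `|scalar_map x| <= `|x|.
Proof. by apply: bop_norm_le => // a; rewrite normrZ mulrC. Qed.

Lemma finite_dim_real : finite_dim [set: R].
Proof.
exists [:: 1]; apply/seteqP; split=> // x _; exists (fun=> x).
by rewrite big_ord_recl big_ord0 addr0 /= /GRing.scale/= mulr1.
Qed.

End factorizations.

(** * Banach operator ideals and their maximal hulls *)

Section operator_ideals.
Context {R : realType}.
Local Notation banach := (completeNormedModType R).
Variable A : op_class R.
Hypothesis HA : banach_op_ideal A.

Let Alin (E F : banach) := cno_linear (boi_banach HA E F).

Lemma op_memD (E F : banach) (T S : bop E F) :
  op_mem A T -> op_mem A S -> op_mem A (T + S).
Proof. by move=> AT AS; have := (Alin E F).2 1 _ _ AT AS; rewrite scale1r. Qed.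

Lemma op_memZ (E F : banach) a (T : bop E F) : op_mem A T -> op_mem A (a *: T).
Proof.
by move=> AT; have := (Alin E F).2 a _ _ AT (Alin E F).1; rewrite addr0.
Qed.

Lemma op_norm0 (E F : banach) : op_norm A (0 : bop E F) = 0.
Proof.
have := cno_scale (boi_banach HA E F) 0 (Alin E F).1.
by rewrite scaler0 normr0 mul0r.
Qed.

Lemma op_norm_ge0 (E F : banach) (T : bop E F) : op_mem A T -> 0 <= op_norm A T.
Proof.
move=> AT; have AN : op_mem A (-1 *: T) by exact: op_memZ.
have := cno_triangle (boi_banach HA E F) AT AN.
rewrite (cno_scale (boi_banach HA E F))// normrN1 mul1r scaleN1r subrr op_norm0.
lra.
Qed.

Lemma op_rank_one (E F : banach) (psi : bop E R) (y : F) :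
  op_mem A (bop_comp (scalar_map y) psi) /\
  op_norm A (bop_comp (scalar_map y) psi) <= `|psi| * `|y|.
Proof.
have [] := boi_ideal HA (scalar_map y) psi (boi_id HA).
have -> : bop_comp (bop_id R) psi = psi by apply: bop_ext.
move=> mem; rewrite (boi_id_norm HA) mulr1 => le; split=> //.
apply: le_trans le _; rewrite mulrC; apply: ler_wpM2l => //.
exact: scalar_map_norm.
Qed.

(** A sum of rank-one operators, each factoring through the identity of the scalars. The bound shows
    that an operator that is small on a frame has small [A]-norm. *)
Lemma op_finite_rank (E F : banach) d (e : 'I_d -> E) (phi : 'I_d -> bop E R)
    (T : bop E F) : (forall x, x = \sum_l phi l x *: e l) ->
  op_mem A T /\ op_norm A T <= \sum_l `|phi l| * `|T (e l)|.
Proof.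
move=> frame.
have TE : T = \sum_l bop_comp (scalar_map (T (e l))) (phi l).
  apply: bop_ext => x; rewrite bop_sumE {1}(frame x) bop_sum.
  by apply: eq_bigr => l _; rewrite bopZ.
suff : op_mem A (\sum_l bop_comp (scalar_map (T (e l))) (phi l)) /\
    op_norm A (\sum_l bop_comp (scalar_map (T (e l))) (phi l)) <=
    \sum_l `|phi l| * `|T (e l)| by rewrite -TE.
apply: (big_ind2 (fun (S : bop E F) s => op_mem A S /\ op_norm A S <= s))
  => [|S s S' s' [AS Ss] [AS' Ss']|l _].
- by rewrite op_norm0; split=> //; exact: (Alin E F).1.
- split; first exact: op_memD.
  by apply: le_trans (cno_triangle (boi_banach HA E F) AS AS') _; exact: lerD.
- exact: op_rank_one.
Qed.

Lemma op_max_le (E F : banach) (T : bop E F) : op_mem (op_max A) T ->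
  forall (M : fd_subspace E) (L : fc_subspace F),
  let T' := bop_comp (csub_proj L) (bop_comp T (csub_incl (fd_csub M))) in
  op_mem A T' /\ op_norm A T' <= op_norm (op_max A) T.
Proof.
move=> /= Tmax M L; set T' := bop_comp _ _.
have : (op_enorm A T' <= op_max_enorm A T)%E.
  by apply: ereal_sup_ubound; exists M, L.
rewrite /op_enorm; case: asboolP => [AT' le|_]; last first.
  by rewrite leye_eq => /eqP h; move: Tmax; rewrite h ltxx.
split=> //; rewrite -lee_fin fineK// fin_numE.
by rewrite gt_eqF ?(lt_le_trans (ltNyr _) le)// lt_eqF.
Qed.

Lemma op_maxI (E F : banach) (T : bop E F) (C : R) : 0 <= C ->
  (forall (M : fd_subspace E) (L : fc_subspace F),
    let T' := bop_comp (csub_proj L) (bop_comp T (csub_incl (fd_csub M))) in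
    op_mem A T' /\ op_norm A T' <= C) ->
  op_mem (op_max A) T /\ op_norm (op_max A) T <= C.
Proof.
move=> C0 TC.
have le : (op_max_enorm A T <= C%:E)%E.
  apply: ge_ereal_sup => _ [M [L ->]]; have [AT' T'C] := TC M L.
  by rewrite /op_enorm; case: asboolP => //; rewrite lee_fin.
split; first by rewrite /= (le_lt_trans le)// ltry.
rewrite /=; move: le; case: (op_max_enorm A T) => //= r.
Qed.

(** [S] corestricts to the span of the images of a frame and [Q] factors through the quotient by its
    kernel, so the composite passes through one piece of [T]. *)
Lemma op_max_factor (M E F N : banach) (S : bop M E) (T : bop E F) (Q : bop F N) :
  finite_dim [set: M] -> finite_dim [set: N] -> op_mem (op_max A) T ->
  op_mem A (bop_comp Q (bop_comp T S)) /\
  op_norm A (bop_comp Q (bop_comp T S)) <= `|Q| * op_norm (op_max A) T * `|S|.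
Proof.
move=> Mfd Nfd Tmax; have [d [e [phi frame]]] := finite_dim_frame Mfd.
pose s := [seq S (e l) | l : 'I_d].
pose M' : fd_subspace E :=
  FdSubspace (lspan_linear s) (ex_intro _ s erefl).
have SM x : csub_set (fd_csub M') (S x).
  exists (fun i => if insub i is Some l then phi l x else 0).
  rewrite size_map size_enum_ord {1}(frame x) bop_sum; apply: eq_bigr => l _.
  by rewrite valK (nth_map l) ?size_enum_ord// nth_ord_enum bopZ.
have [S' [S'S S'E]] := bop_corestrict SM.
have [Q' [Q'Q Q'E]] := @bop_quot_factor _ _ _ (ker_fc Q Nfd) Q (fun x xL => xL).
have [AT' T'T] := op_max_le Tmax M' (ker_fc Q Nfd).
set T' := bop_comp _ _ in AT' T'T.
have -> : bop_comp Q (bop_comp T S) = bop_comp Q' (bop_comp T' S').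
  apply: bop_ext => x.
  by rewrite -[RHS]/(Q' (csub_pi (ker_fc Q Nfd) (T (val (S' x))))) S'E Q'E.
have [AQ le] := boi_ideal HA Q' S' AT'; split=> //; apply: le_trans le _.
have T'0 := op_norm_ge0 AT'.
by do 2?[apply: ler_pM => //]; rewrite mulr_ge0.
Qed.

Lemma op_max_norm_ge0 (E F : banach) (T : bop E F) :
  op_mem (op_max A) T -> 0 <= op_norm (op_max A) T.
Proof.
move=> Tmax.
have M : fd_subspace E by exact: FdSubspace (lspan_linear [::]) (ex_intro _ _ erefl).
have L : fc_subspace F := ker_fc (0 : bop F R) finite_dim_real.
by have [AT'] := op_max_le Tmax M L; apply: le_trans; exact: op_norm_ge0.
Qed.

(** Between [scalar_map x] and a functional [phi], the operator [T] becomes [phi (T x)] times the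
    identity of the scalars, whose [A]-norm is [|phi (T x)|]. *)
Lemma op_max_opnorm (E F : banach) (T : bop E F) :
  op_mem (op_max A) T -> `|T| <= op_norm (op_max A) T.
Proof.
move=> Tmax; have N0 := op_max_norm_ge0 Tmax.
apply: bop_norm_le => // x; apply: norm_le_dual => phi phi1.
have [_] := op_max_factor (scalar_map x) phi finite_dim_real finite_dim_real Tmax.
have -> : bop_comp phi (bop_comp T (scalar_map x)) = phi (T x) *: bop_id R.
  apply: bop_ext => a; rewrite -[LHS]/(phi (T (a *: x))) !bopZ.
  by rewrite -[RHS]/(phi (T x) * a) mulrC.
rewrite (cno_scale (boi_banach HA R R)); last exact: boi_id.
rewrite (boi_id_norm HA) mulr1 => le.
apply: le_trans (ler_norm _) _; apply: le_trans le _.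
apply: ler_pM => //; first by rewrite mulr_ge0.
  by rewrite ler_piMl.
exact: scalar_map_norm.
Qed.

Lemma op_maxZ (E F : banach) a (T : bop E F) : op_mem (op_max A) T ->
  op_mem (op_max A) (a *: T) /\
  op_norm (op_max A) (a *: T) <= `|a| * op_norm (op_max A) T.
Proof.
move=> Tmax; apply: op_maxI => [|M L /=].
  by rewrite mulr_ge0// op_max_norm_ge0.
have [AT' T'T] := op_max_le Tmax M L; set T' := bop_comp _ _ in AT' T'T.
have -> : bop_comp (csub_proj L) (bop_comp (a *: T) (csub_incl (fd_csub M))) =
    a *: T'.
  apply: bop_ext => x.
  rewrite -[RHS]/(a *: csub_proj L (T (csub_incl (fd_csub M) x))).
  by rewrite -bopZ.
split; first exact: op_memZ.
by rewrite (cno_scale (boi_banach HA _ _))// ler_wpM2l.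
Qed.

End operator_ideals.

(** * Ultraproducts of operators in a maximal hull *)

Section maximal_hull_ultrastable.
Context {R : realType} {J : Type} (U : set_system J) (UU : UltraFilter U).
Local Notation banach := (completeNormedModType R).

(** Lifting the frame vectors defines [z] and the [S i]. If the norms exceeded [1 + delta] on a set
    in [U], almost norming vectors [x i] would converge to some [y] in the unit ball with
    [|iota y| >= 1 + delta]. *)
Lemma ultraproduct_lift (E : J -> banach) (M : banach)
    (iota : bop M (ultraproduct UU E)) (delta : R) :
  finite_dim [set: M] -> `|iota| <= 1 -> 0 < delta ->
  exists (S : forall i, bop M (E i)) (z : M -> linf E),
    [/\ forall x i, linf_eval i (z x) = S i x,
        forall x, ultraclass UU (z x) = iota x &
        U [set i | `|S i| <= 1 + delta]].
Proof.
move=> Mfd iota1 d0; have [d [e [phi frame]]] := finite_dim_frame Mfd.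
pose z x : linf E := \sum_l phi l x *: repr (iota (e l)).
have zl : linear z.
  move=> a x y; rewrite /z scaler_sumr -big_split/=; apply: eq_bigr => l _.
  by rewrite linearP scalerDl scalerA.
pose B := \sum_l `|phi l| * `|repr (iota (e l))|.
have zB x : `|z x| <= B * `|x|.
  apply: le_trans (ler_norm_sum _ _ _) _; rewrite mulr_suml; apply: ler_sum => l _.
  by rewrite normrZ mulrAC; apply: ler_wpM2r => //; exact: bop_norm_ub.
have SP i : bounded_linear (fun x => linf_eval i (z x)).
  split=> [a x y|]; first by rewrite zl linearP.
  by exists B => x; apply: le_trans (zB x); exact: linf_norm_ub.
pose S i := mkbop (SP i).
have zi x : ultraclass UU (z x) = iota x.
  rewrite [in RHS](frame x) linear_sum bop_sum; apply: eq_bigr => l _.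
  by rewrite linearZ /= ultraclass_repr bopZ.
exists S, z; split=> //; apply: contrapT => /(ultraN UU) US.
have choose i : exists x : M,
    `|x| <= 1 /\ (1 + delta < `|S i| -> 1 + delta <= `|S i x|).
  have [Si|Si] := leP `|S i| (1 + delta).
    by exists 0; rewrite normr0.
  apply: contrapT => nx; move: Si; rewrite ltNge => /negP; apply.
  apply: bop_norm_le => [|x]; first lra.
  have [->|x0] := eqVneq x 0; first by rewrite linear0 !normr0 mulr0.
  have x1 : 0 < `|x| by rewrite normr_gt0.
  rewrite leNgt; apply/negP => lt; apply: nx; exists (`|x|^-1 *: x); split.
    by rewrite normrZ gtr0_norm ?invr_gt0// mulVf ?gt_eqF.
  by move=> _; rewrite bopZ normrZ gtr0_norm ?invr_gt0// ler_pdivlMl// mulrC ltW.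
pose x i := sval (cid (choose i)).
have x1 i : `|x i| <= 1 by have [] := svalP (cid (choose i)).
have [y xy] := @finite_dim_ultra_cvg _ _ U UU M x 1 Mfd x1.
have y1 : `|iota y| <= 1.
  apply: le_trans (bop_norm_ub _ _) _; apply: mulr_ile1 => //.
  have xyn : `|x i| @[i --> U] --> `|y| by exact: cvg_norm.
  by apply: (ultra_ler_cvg UU xyn (cvg_cst (1 : R))); exact: nearW.
have Bxy : B * `|y - x i| @[i --> U] --> (0 : R).
  rewrite -(mulr0 B); apply: cvgM; first exact: cvg_cst.
  rewrite -(normr0 M) -(subrr y); apply: cvg_norm.
  by apply: cvgB => //; exact: cvg_cst.
have lim : `|linf_eval i (z y)| + B * `|y - x i| @[i --> U] --> `|iota y| + 0.
  by apply: cvgD => //; rewrite -zi; exact: (@ultraclass_norm_cvg _ _ _ UU E (z y)).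
have : 1 + delta <= `|iota y| + 0.
  apply: (ultra_ler_cvg UU (cvg_cst (1 + delta)) lim).
  apply: filterS US => i /negP; rewrite -ltNge => Si.
  have [_ /(_ Si) le] := svalP (cid (choose i)).
  (* [S i (x i)] is replaced by [S i y] at the cost [B * |y - x i|], where [B] bounds all the
     [S i]. *)
  apply: le_trans le _; rewrite -lerBlDl.
  apply: le_trans (lerB_dist _ _) _.
  rewrite distrC -[linf_eval i (z y)]/(S i y) -linearB.
  exact: le_trans (linf_norm_ub _ _) (zB _).
by rewrite addr0; lra.
Qed.

Variable A : op_class R.
Hypothesis HA : banach_op_ideal A.

(** A piece [u] of [TU] is compared with the composite [v] of [S i], [T i] and [Q] for a single [i]:
    [v] factors through finite-dimensional spaces, and [u - v] is small on a frame. *)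
Lemma op_max_ultraproduct (E F : J -> banach) (T : forall i, bop (E i) (F i))
    (C : R) (TU : bop (ultraproduct UU E) (ultraproduct UU F)) : 0 <= C ->
  (forall i, op_mem (op_max A) (T i)) ->
  (forall i, op_norm (op_max A) (T i) <= C) ->
  (forall (x : linf E) (y : linf F),
    (forall i, linf_eval i y = T i (linf_eval i x)) ->
    TU (ultraclass UU x) = ultraclass UU y) ->
  op_mem (op_max A) TU /\ op_norm (op_max A) TU <= C.
Proof.
move=> C0 Tmax TC TUE; apply: (op_maxI C0) => M L /=.
set u := bop_comp _ _; pose q := csub_proj L; pose iota := csub_incl (fd_csub M).
have Mfd := csub_space_finite_dim M; have Lfd := fc_finite_dim L.
have q1 : `|q| <= 1.
  by apply: bop_norm_le => // x; rewrite mul1r; exact: csub_quot_norm_le.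
have iota1 : `|iota| <= 1 by apply: bop_norm_le => // x; rewrite mul1r.
have [d [e [phi frame]]] := finite_dim_frame Mfd.
split; first by have [] := op_finite_rank HA u frame.
apply/ler_addgt0Pr => eta eta0.
pose P := \sum_l `|phi l|.
have P0 : 0 <= P by apply: sumr_ge0.
have k0 : 0 < 3 * C + 2 * P + 1 by lra.
(* For [delta <= 1] the bound [(1 + delta)^2 C + P (1 + delta) delta] exceeds [C] by at most
   [(3 C + 2 P) delta]; the 1 keeps the denominator positive. *)
pose delta := Num.min 1 (eta / (3 * C + 2 * P + 1)).
have d0 : 0 < delta by rewrite lt_min ltr01 divr_gt0.
have d1 : delta <= 1 by rewrite ge_min lexx.
have dk : delta * (3 * C + 2 * P + 1) <= eta.
  by rewrite -ler_pdivlMr// ge_min lexx orbT.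
have [S [z [zS zi US]]] := ultraproduct_lift Mfd iota1 d0.
have yb l : exists B : R, forall i, `|T i (S i (e l))| <= B.
  exists (C * `|z (e l)|) => i; apply: le_trans (bop_norm_ub _ _) _.
  apply: ler_pM => //; last by rewrite -zS; exact: linf_norm_ub.
  exact: le_trans (op_max_opnorm HA (Tmax i)) (TC i).
pose y l := mklinf (yb l).
have TUe l : TU (iota (e l)) = ultraclass UU (y l).
  by rewrite -zi; apply: TUE => i; rewrite zS.
have /(filterI US) := ultraproduct_local_duality y Lfd q1 d0 d0.
move=> /filter_ex[i [/= Si [Q [Q1 Qy]]]].
have [Av vle] := op_max_factor HA (S i) Q Mfd Lfd (Tmax i).
set v := bop_comp Q _ in Av vle.
have [Auv uvle] := op_finite_rank HA (u - v) frame.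
have uvd : op_norm A (u - v) <= P * ((1 + delta) * delta).
  apply: le_trans uvle _; rewrite mulr_suml; apply: ler_sum => l _.
  apply: ler_wpM2l => //; rewrite bopBE distrC.
  by have := Qy l; rewrite -TUe.
have vd : op_norm A v <= (1 + delta) * C * (1 + delta).
  apply: le_trans vle _; have N0 := op_max_norm_ge0 HA (Tmax i).
  by do 2?[apply: ler_pM => //]; rewrite mulr_ge0.
rewrite -[u](subrK v).
apply: le_trans (cno_triangle (boi_banach HA _ _) Auv Av) _.
apply: le_trans (lerD uvd vd) _.
have dd : delta * delta <= delta by rewrite ler_piMl// ltW.
have : P * (delta * delta) <= P * delta by rewrite ler_wpM2l.
have : C * (delta * delta) <= C * delta by rewrite ler_wpM2l.
lra.
Qed.

End maximal_hull_ultrastable.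

(** * Maximal and regular hulls of Lipschitz ideals *)

Section nonexpansive_maps.
Context {R : realType}.
Local Notation banach := (completeNormedModType R).

(** Constant 1 suffices for the outer maps of a factorization, since [lip0_absorb] and
    [lip0_normalize] move Lipschitz constants into the middle factor. *)
Definition nonexpansive (X Y : pmetricType R) (f : X -> Y) :=
  f point = point /\ forall x y, mdist (f x) (f y) <= mdist x y.

Lemma nonexpansive_lip0 (X Y : pmetricType R) (f : X -> Y) :
  nonexpansive f -> lip0 f.
Proof.
by move=> [f0 f1]; split=> //; exists 1; split=> // x y; rewrite mul1r.
Qed.

Lemma nonexpansive_Lip (X Y : pmetricType R) (f : X -> Y) :
  nonexpansive f -> Lip f <= 1.
Proof.
move=> [_ f1]; apply: ge_inf; first by exists 0 => ? [].
by split=> // x y; rewrite mul1r.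
Qed.

Lemma nonexpansive_comp (X Y Z : pmetricType R) (g : Y -> Z) (f : X -> Y) :
  nonexpansive g -> nonexpansive f -> nonexpansive (g \o f).
Proof.
move=> [g0 g1] [f0 f1]; split=> [|x y]; first by rewrite /= f0.
exact: le_trans (g1 _ _) (f1 _ _).
Qed.

Lemma bop_nonexpansive (E F : banach) (T : bop E F) : `|T| <= 1 ->
  nonexpansive (T : bpm E -> bpm F).
Proof.
move=> T1; split=> [|x y]; first exact: linear0.
rewrite !bpm_distE -linearB; apply: le_trans (bop_norm_ub _ _) _.
by rewrite ler_piMl.
Qed.

Lemma pf_incl_nonexpansive (X : pmetricType R) (X0 : pointed_finset X) :
  nonexpansive (@pf_incl R X X0).
Proof. by []. Qed.

End nonexpansive_maps.

(** * Finite-dimensional quotients and the bidual *)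

Section biduals.
Context {R : realType}.
Local Notation banach := (completeNormedModType R).

(** [P] is the second adjoint of the quotient map followed by the identification of [(E/L)''] with
    [E/L] in coordinates; the identity [Pdual] gives its norm. *)
Lemma bidual_finite_quotient (E : banach) (L : fc_subspace E) :
  exists P : bop (bidual E) (csub_quot L), `|P| <= 1 /\
    forall x, P (bidual_incl x) = csub_pi L x.
Proof.
have [d [e [phi frame]]] := finite_dim_frame (fc_finite_dim L).
pose q := csub_proj L.
have q1 : `|q| <= 1.
  by apply: bop_norm_le => // x; rewrite mul1r; exact: csub_quot_norm_le.
pose P (psi : bidual E) : csub_quot L :=
  \sum_l (psi : bop (dual E) R) (bop_comp (phi l) q) *: e l.
have Pdual (chi : bop (csub_quot L) R) (psi : bop (dual E) R) :
    chi (P psi) = psi (bop_comp chi q).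
  rewrite bop_sum.
  have -> : bop_comp chi q = \sum_l chi (e l) *: (bop_comp (phi l) q : bop E R).
    apply: bop_ext => x; rewrite -[LHS]/(chi (q x)) [in LHS](frame (q x)).
    rewrite bop_sum bop_sumE; apply: eq_bigr => l _; rewrite bopZ.
    by rewrite -[RHS]/(chi (e l) * phi l (q x)) mulrC.
  rewrite [RHS]bop_sum; apply: eq_bigr => l _.
  by rewrite !bopZ /GRing.scale/= mulrC.
have Pb (psi : bop (dual E) R) : `|P psi| <= 1 * `|psi|.
  rewrite mul1r; apply: norm_le_dual => chi chi1; rewrite Pdual.
  apply: le_trans (ler_norm _) _; apply: le_trans (bop_norm_ub _ _) _.
  rewrite ler_piMr//; apply: bop_norm_le => // x; rewrite mul1r.
  apply: (@le_trans _ _ (`|chi| * `|q x|)).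
    exact: (bop_norm_ub chi (q x)).
  apply: (@le_trans _ _ `|q x|); first by rewrite ler_piMl.
  exact: csub_quot_norm_le.
have PB : bounded_linear P.
  split; last by exists 1.
  move=> a x y; rewrite /P scaler_sumr -big_split/=; apply: eq_bigr => l _.
  by rewrite scalerA -scalerDl.
exists (mkbop PB); split; first exact: bop_norm_le.
by move=> x; rewrite [RHS](frame (csub_pi L x)).
Qed.

Section ultraproduct_of_quotients.
Variables (E : banach) (J : Type) (U : set_system J) (UU : UltraFilter U).
Variable L : J -> fc_subspace E.
Hypothesis L_small : forall phi : bop E R,
  U [set j | forall x, csub_set (L j) x -> phi x = 0].

Local Notation EL := (fun j => csub_quot (L j) : banach).

Lemma ultraproduct_quotients_bidual :
  exists Q : bpm (ultraproduct UU EL) -> bpm (bidual E), nonexpansive Q /\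
    forall (c : linf EL) x,
      (\forall j \near U, linf_eval j c = csub_pi (L j) x) ->
      Q (ultraclass UU c) = bidual_incl x.
Proof.
have descend (phi : bop E R) j : exists phi' : bop (EL j) R, `|phi'| <= `|phi| /\
    ((forall x, csub_set (L j) x -> phi x = 0) ->
     forall x, phi' (csub_pi (L j) x) = phi x).
  have [Lphi|nLphi] := pselect (forall x, csub_set (L j) x -> phi x = 0).
    by have [phi' [le E']] := bop_quot_factor Lphi; exists phi'.
  (* Where [phi] does not descend, 0 is taken; this happens only off a set in [U]. *)
  by exists 0; rewrite normr0.
pose D phi j := sval (cid (descend phi j)).
have Dle phi j : `|D phi j| <= `|phi| by have [] := svalP (cid (descend phi j)).
have DE phi : \forall j \near U, forall x : E, D phi j (csub_pi (L j) x) = phi x.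
  apply: filterS (L_small phi) => j Lphi.
  by have [_] := svalP (cid (descend phi j)); exact.
have Dbound phi (c : linf EL) j :
    `|D phi j (linf_eval j c)| <= `|phi| * `|linf_eval j c|.
  by apply: le_trans (bop_norm_ub _ _) _; apply: ler_wpM2r.
pose v (c : linf EL) (phi : bop E R) : R := lim (D phi j (linf_eval j c) @[j --> U]).
have vP c phi : D phi j (linf_eval j c) @[j --> U] --> v c phi.
  apply: (@ultra_cvg _ _ _ UU _ (`|phi| * `|c|)) => j.
  apply: le_trans (Dbound _ _ _) _; apply: ler_wpM2l => //.
  exact: (linf_norm_ub c j).
have vb c phi : `|v c phi| <= `|ultraclass UU c| * `|phi|.
  have h1 : `|D phi j (linf_eval j c)| @[j --> U] --> `|v c phi|.
    by apply: cvg_norm; exact: vP.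
  have h2 : `|phi| * `|linf_eval j c| @[j --> U] --> `|phi| * `|ultraclass UU c|.
    by apply: cvgM; [exact: cvg_cst|exact: (@ultraclass_norm_cvg _ _ _ UU EL c)].
  by rewrite mulrC; apply: (ultra_ler_cvg UU h1 h2); exact: nearW.
have vB c : bounded_linear (v c : bop E R -> R^o).
  split; last by exists `|ultraclass UU c|.
  move=> a phi psi; apply: cvg_lim; first exact: Rhausdorff.
  apply: cvg_trans (near_eq_cvg _)
    (cvgD (cvgM (cvg_cst a) (vP c phi)) (vP c psi)).
  (* The choice [D chi j] is evidently linear in [chi] only where [chi] descends: there it evaluates
     [chi] at a representative. *)
  have Dj chi j : (forall x : E, D chi j (csub_pi (L j) x) = chi x) ->
      D chi j (linf_eval j c) = chi (repr (linf_eval j c)).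
    by move=> h; rewrite -{1}(csub_pi_repr (linf_eval j c)) h.
  apply: filterS3 (DE phi) (DE psi) (DE (a *: phi + psi)) => j h1 h2 h3.
  rewrite (Dj _ _ h3).
  rewrite -[LHS]/(a * D phi j (linf_eval j c) + D psi j (linf_eval j c)).
  by rewrite (Dj _ _ h1) (Dj _ _ h2).
have vD c c' phi : v c phi - v c' phi = v (c - c') phi.
  apply/esym/cvg_lim; first exact: Rhausdorff.
  apply: cvg_trans (near_eq_cvg _) (cvgB (vP c phi) (vP c' phi)).
  by apply: nearW => j; rewrite !fctE !linearB.
(* [Q] uses chosen representatives; by [Q_le] its value depends only on the class. *)
pose Q (c : bpm (ultraproduct UU EL)) : bpm (bidual E) :=
  mkbop (vB (repr (c : ultraproduct UU EL))).
have Q_le (c c' : linf EL) :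
    `|(mkbop (vB c) : bidual E) - mkbop (vB c')| <=
    `|ultraclass UU c - ultraclass UU c'|.
  by apply: bop_norm_le => // phi; rewrite bopBE [X in `|X|]vD -linearB; exact: vb.
have QE (c : linf EL) : Q (ultraclass UU c) = mkbop (vB c).
  apply/eqP; rewrite -subr_eq0 -normr_le0; apply: le_trans (Q_le _ _) _.
  by rewrite ultraclass_repr subrr normr0.
exists Q; split.
  split.
    rewrite -[point]/(0 : ultraproduct UU EL).
    rewrite -(linear0 (@ultraclass _ _ _ UU EL)) QE; apply: bop_ext => phi.
    have := vD 0 0 phi; rewrite !subrr => /esym v0; exact: v0.
  move=> c c'; rewrite !bpm_distE -{2}(ultraclass_repr (c : ultraproduct UU EL)).
  by rewrite -{2}(ultraclass_repr (c' : ultraproduct UU EL)); exact: Q_le.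
move=> c x cx; rewrite QE; apply: bop_ext => phi.
apply: cvg_lim; first exact: Rhausdorff.
apply: cvg_near_cst; apply: filterS2 cx (DE phi) => j cj h.
by rewrite cj; exact: h.
Qed.

End ultraproduct_of_quotients.
End biduals.

Section finite_pieces.
Context {R : realType}.
Variables (X : pmetricType R) (E : completeNormedModType R).

Let J := (pointed_finset X * fc_subspace E)%type.

Let finer (i j : J) :=
  pf_set i.1 `<=` pf_set j.1 /\ csub_set j.2 `<=` csub_set i.2.

(** The pairs are directed by union and intersection. The tails beyond [({0, x}, ker 0)] and
    [({0}, ker phi)] give the two properties. *)
Lemma finite_pieces_ultrafilter : exists U : set_system J, UltraFilter U /\
  (forall x, U [set j : J | pf_set j.1 x]) /\
  (forall phi : bop E R, U [set j : J | forall x, csub_set j.2 x -> phi x = 0]).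
Proof.
pose pt (x : X) : pointed_finset X :=
  PointedFinset (finite_set2 point x) (or_introl erefl).
pose ker (phi : bop E R) := ker_fc phi finite_dim_real.
have [|||U [UU Uj]] := @directed_ultrafilter J finer (pt point, ker 0).
- by move=> j; split.
- by move=> i j k [ij1 ij2] [jk1 jk2]; split; [exact: subset_trans jk1|
    exact: subset_trans ij2].
- move=> i j.
  have fU : finite_set (pf_set i.1 `|` pf_set j.1).
    by rewrite finite_setU; split; exact: pf_finite.
  exists (PointedFinset fU (or_introl (pf_point i.1)), fcI i.2 j.2).
  by split; split=> /= x; [left|case|right|case].
exists U; split=> //; split=> [x|phi].
  by apply: filterS (Uj (pt x, ker 0)) => j [jx _]; apply: jx; right.
by apply: filterS (Uj (pt point, ker phi)) => j [_ jphi] x /jphi.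
Qed.

End finite_pieces.

(** * A criterion for the maximal and regular hulls to agree *)

Section lipschitz_hulls.
Context {R : realType}.
Local Notation banach := (completeNormedModType R).
Variable K : lip_class R.

Lemma lip_max_le (X : pmetricType R) (E : banach) (f : X -> E) :
  lip_mem (lip_max K) f -> forall (X0 : pointed_finset X) (L : fc_subspace E),
  let f' := csub_proj L \o f \o @pf_incl R X X0 in
  lip_mem K f' /\ lip_norm K f' <= lip_norm (lip_max K) f.
Proof.
move=> [_ fmax] X0 L f'.
have : (lip_enorm K f' <= lip_max_enorm K f)%E.
  by apply: ereal_sup_ubound; exists X0, L.
rewrite /lip_enorm; case: asboolP => [Kf' le|_]; last first.
  by rewrite leye_eq => /eqP h; move: fmax; rewrite h ltxx.
split=> //; rewrite -lee_fin fineK// fin_numE.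
by rewrite gt_eqF ?(lt_le_trans (ltNyr _) le)// lt_eqF.
Qed.

Lemma lip_maxI (X : pmetricType R) (E : banach) (f : X -> E) (C : R) : 0 <= C ->
  lip0 (f : X -> bpm E) ->
  (forall (X0 : pointed_finset X) (L : fc_subspace E),
    let f' := csub_proj L \o f \o @pf_incl R X X0 in
    lip_mem K f' /\ lip_norm K f' <= C) ->
  lip_mem (lip_max K) f /\ lip_norm (lip_max K) f <= C.
Proof.
move=> C0 f0 fC.
have le : (lip_max_enorm K f <= C%:E)%E.
  apply: ge_ereal_sup => _ [X0 [L ->]]; have [Kf' f'C] := fC X0 L.
  by rewrite /lip_enorm; case: asboolP => //; rewrite lee_fin.
split; first by split=> //; rewrite (le_lt_trans le)// ltry.
rewrite /=; move: le; case: (lip_max_enorm K f) => //= r.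
Qed.

(** The three properties from which [lip_max_eq_reg] is deduced; both composition classes of the
    theorem are shown to have them. *)
Hypothesis K_ge0 : forall (X : pmetricType R) (E : banach) (f : X -> E),
  lip_mem K f -> 0 <= lip_norm K f.

Hypothesis K_comp : forall (Y X : pmetricType R) (E F : banach)
    (h : bpm E -> bpm F) (f : X -> E) (g : Y -> X),
  nonexpansive h -> lip_mem K f -> nonexpansive g ->
  lip_mem K (h \o f \o g : Y -> F) /\
  lip_norm K (h \o f \o g : Y -> F) <= lip_norm K f.

Hypothesis K_ultra : forall (J : Type) (U : set_system J) (UU : UltraFilter U)
    (X : J -> pmetricType R) (E : J -> banach) (f : forall j, X j -> E j) (C : R),
  (forall j, lip_mem K (f j)) -> (forall j, lip_norm K (f j) <= C) ->
  lip_mem K (ultramap UU f) /\ lip_norm K (ultramap UU f) <= C.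

Lemma lip_reg_le_max (X : pmetricType R) (E : banach) (f : X -> E) :
  lip_mem (lip_reg K) f ->
  lip_mem (lip_max K) f /\ lip_norm (lip_max K) f <= lip_norm (lip_reg K) f.
Proof.
move=> [f0 KJf]; apply: lip_maxI => // [|X0 L]; first exact: K_ge0.
have [P [P1 PE]] := bidual_finite_quotient L.
have := K_comp (bop_nonexpansive P1) KJf (@pf_incl_nonexpansive R X X0).
suff -> : csub_proj L \o f \o @pf_incl R X X0 =
  (P : bpm (bidual E) -> bpm (csub_quot L)) \o (@bidual_incl R E \o f) \o
  @pf_incl R X X0 by [].
by apply/funext => x; rewrite /= PE.
Qed.

Lemma lip_max_le_reg (X : pmetricType R) (E : banach) (f : X -> E) :
  lip_mem (lip_max K) f ->
  lip_mem (lip_reg K) f /\ lip_norm (lip_reg K) f <= lip_norm (lip_max K) f.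
Proof.
move=> fmax; have [f0 _] := fmax.
have [U [UU [Ux Uphi]]] := finite_pieces_ultrafilter X E.
pose X0 (j : pointed_finset X * fc_subspace E) : pmetricType R := pf_space j.1.
pose EL (j : pointed_finset X * fc_subspace E) : banach := csub_quot j.2.
pose fj j : X0 j -> EL j := csub_proj j.2 \o f \o @pf_incl R X j.1.
have [Kf Kfle] := K_ultra UU (fun j => (lip_max_le fmax j.1 j.2).1)
  (fun j => (lip_max_le fmax j.1 j.2).2).
have [Q [Q1 QE]] := ultraproduct_quotients_bidual UU Uphi.
(* The finite sets that miss [x] receive the base point, which keeps the family bounded by the
   distance from [x] to the base point. *)
pose fam (x : X) j : X0 j :=
  if pselect (pf_set j.1 x) is left h then exist _ x (mem_set h) else point.
have famE x j : pf_set j.1 x -> val (fam x j) = x.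
  by rewrite /fam; case: pselect.
have fam_le x j : mdist (fam x j) point <= mdist x point.
  by rewrite /fam; case: pselect => // _; rewrite mdistxx mdist_ge0.
have fam_bound x : fam x \in @bfam_set R _ X0.
  by apply/mem_set; exists (mdist x point).
pose g x : ultralimit UU X0 := ulim_class UU (exist _ (fam x) (fam_bound x)).
have g1 : nonexpansive g.
  split.
    apply/ulim_classP; apply: cvg_lim; first exact: Rhausdorff.
    apply: cvg_near_cst; apply: nearW => j /=; rewrite /fam; case: pselect => [h|_].
      exact: mdistxx.
    exact: mdistxx.
  (* [g] is even isometric: both points lie in the finite set for almost all [j]. *)
  move=> x y; rewrite ultralimit_distE le_eqVlt; apply/orP; left; apply/eqP.
  apply: cvg_lim; first exact: Rhausdorff.
  apply: cvg_near_cst; apply: filterS2 (Ux x) (Ux y) => j jx jy.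
  by rewrite -[LHS]/(mdist (val (fam x j)) (val (fam y j))) !famE.
have [k kf] := f0.2.
have q1 j z : `|csub_proj (j : fc_subspace E) z| <= `|z|.
  exact: csub_quot_norm_le.
have fj0 j : fj j point = 0.
  rewrite -[LHS]/(csub_pi j.2 (f point)) [f point](f0.1 : _ = 0).
  exact: csub_pi0.
have fjk j : lipschitz_const (fj j : X0 j -> bpm (EL j)) k.
  split=> [|x y]; first exact: kf.1.
  rewrite bpm_distE -linearB; apply: le_trans (q1 _ _) _.
  exact: kf.2.
have JfE : @bidual_incl R E \o f = Q \o ultramap UU fj \o g.
  apply/funext => x /=.
  have xb : exists M : R, forall j,
      `|fj j (val (exist _ (fam x) (fam_bound x) : bfam X0) j)| <= M.
    exists (k * mdist x point) => j.
    have := (fjk j).2 (fam x j) point; rewrite bpm_distE fj0 subr0 => /le_trans.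
    by apply; apply: ler_wpM2l; [exact: kf.1|exact: fam_le].
  rewrite (ultramapE UU fj0 fjk xb); apply/esym/QE.
  apply: filterS (Ux x) => j jx /=.
  by rewrite -[LHS]/(csub_pi j.2 (f (val (fam x j)))) famE.
have := K_comp Q1 Kf g1; rewrite -JfE => -[KJf le].
by split=> //; exact: le_trans le Kfle.
Qed.

Theorem lip_max_eq_reg : lip_class_eq (lip_max K) (lip_reg K).
Proof.
move=> X E f; split.
  by split=> [/lip_max_le_reg[]|/lip_reg_le_max[]].
move=> fmax; have [freg le] := lip_max_le_reg fmax.
by apply/le_anti; rewrite le (lip_reg_le_max freg).2.
Qed.

End lipschitz_hulls.

(** * Ultraproducts of Lipschitz factorizations *)

Lemma nonexpansive_lipschitz (R : realType) (X Y : pmetricType R) (f : X -> Y) :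
  nonexpansive f -> lipschitz_const f 1.
Proof. by move=> [_ f1]; split=> // x y; rewrite mul1r. Qed.

Section ultramaps.
Context {R : realType} {J : Type} (U : set_system J) (UU : UltraFilter U).
Local Notation banach := (completeNormedModType R).

Section classes.
Variables (X : J -> pmetricType R) (E : J -> banach).
Variables (f : forall j, X j -> bpm (E j)) (k : R).
Arguments f : clear implicits.
Hypotheses (f0 : forall j, f j point = point)
  (fk : forall j, lipschitz_const (f j) k).

Lemma lipschitz_image (x : bfam X) :
  exists y : linf E, forall j, linf_eval j y = f j (val x j).
Proof.
have /set_mem[M xM] := valP x.
have yb : exists M : R, forall j, `|f j (val x j) : E j| <= M.
  exists (k * M) => j; have := (fk j).2 (val x j) point.
  rewrite f0 bpm_distE subr0 => /le_trans; apply.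
  by apply: ler_wpM2l; [exact: (fk j).1|exact: xM].
by exists (mklinf yb).
Qed.

Lemma ultramap_class (x : bfam X) (y : linf E) :
  (forall j, linf_eval j y = f j (val x j)) ->
  ultramap UU (f : forall j, X j -> E j) (ulim_class UU x) = ultraclass UU y.
Proof.
move=> yf.
have yb : exists M : R, forall j, `|f j (val x j) : E j| <= M.
  by exists `|y| => j; rewrite -yf; exact: linf_norm_ub.
rewrite (@ultramapE R J U UU X E f k f0 fk x yb).
apply/ultraclassP; apply: cvg_near_cst; apply: nearW => j /=.
by rewrite -[val y j]/(linf_eval j y) yf subrr normr0.
Qed.

End classes.

Lemma ultralimit_repr (X : J -> pmetricType R) (c : ultralimit UU X) :
  exists x : bfam X, ulim_class UU x = c.
Proof. by exists (repr c); exact: reprK. Qed.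

Lemma ultramap_nonexpansive (X : J -> pmetricType R) (E : J -> banach)
    (f : forall j, X j -> bpm (E j)) : (forall j, nonexpansive (f j)) ->
  nonexpansive (ultramap UU (f : forall j, X j -> E j) :
    ultralimit UU X -> bpm (ultraproduct UU E)).
Proof.
move=> f1; have f0 j := (f1 j).1; have fk j := nonexpansive_lipschitz (f1 j).
split.
  have := @ultramap_class X E f 1 f0 fk (bfam_point X) 0; rewrite linear0; apply.
  by move=> j; rewrite linear0 /= f0.
move=> c d; have [x <-] := ultralimit_repr c; have [y <-] := ultralimit_repr d.
have [x' x'E] := lipschitz_image f0 fk x; have [y' y'E] := lipschitz_image f0 fk y.
rewrite (ultramap_class f0 fk x'E) (ultramap_class f0 fk y'E) bpm_distE -linearB.
apply: (ultra_ler_cvg UU (@ultraclass_norm_cvg _ _ _ UU E (x' - y'))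
  (@ultralimit_dist_cvg _ _ _ UU X x y)).
apply: nearW => j; rewrite linearB /= x'E y'E; exact: (f1 j).2.
Qed.

Lemma linf_bfam (F : J -> banach) (y : linf F) :
  exists x : bfam (fun j => bpm (F j)), forall j, val x j = linf_eval j y.
Proof.
have yb : (fun j => linf_eval j y : bpm (F j)) \in
    @bfam_set R J (fun j => bpm (F j)).
  apply/mem_set; exists `|y| => j; rewrite bpm_distE subr0.
  exact: linf_norm_ub.
by exists (exist (fun x => x \in @bfam_set R J (fun j => bpm (F j))) _ yb).
Qed.

(** An ultramap lands in a Banach ultraproduct but starts from a metric ultralimit. This isometric
    comparison map is what allows two of them to be composed. *)
Lemma ultraproduct_ultralimit (F : J -> banach) :
  exists i : bpm (ultraproduct UU F) -> ultralimit UU (fun j => bpm (F j)),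
    nonexpansive i /\
    forall (y : linf F) (x : bfam (fun j => bpm (F j))),
      (forall j, val x j = linf_eval j y) -> i (ultraclass UU y) = ulim_class UU x.
Proof.
have [i iE] := choice (fun c : bpm (ultraproduct UU F) =>
  linf_bfam (repr (c : ultraproduct UU F))).
have iC y (x : bfam (fun j => bpm (F j))) : (forall j, val x j = linf_eval j y) ->
    ulim_class UU (i (ultraclass UU y)) = ulim_class UU x.
  move=> xy; apply/ulim_classP.
  have /ultraclassP h := ultraclass_repr (ultraclass UU y).
  apply: cvg_lim; first exact: Rhausdorff.
  suff -> : (fun j => mdist (val (i (ultraclass UU y)) j) (val x j)) =
    (fun j => `|val (repr (ultraclass UU y)) j - val y j|) by [].
  by apply/funext => j; rewrite iE xy.
exists (fun c => ulim_class UU (i c)); split=> //; split.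
  rewrite -[point in LHS]/(0 : ultraproduct UU F).
  rewrite -(linear0 (@ultraclass _ _ _ UU F)).
  by apply: iC => j; rewrite linear0.
move=> c d; rewrite bpm_distE ultralimit_distE.
rewrite -{2}(ultraclass_repr (c : ultraproduct UU F)).
rewrite -{2}(ultraclass_repr (d : ultraproduct UU F)) -linearB ultraproduct_normE.
suff -> : (fun j => mdist (val (i c) j) (val (i d) j)) =
  (fun j => `|val (repr (c : ultraproduct UU F) - repr (d : ultraproduct UU F)) j|).
  by [].
by apply/funext => j; rewrite bpm_distE !iE.
Qed.

Lemma ultramap_comp (X : J -> pmetricType R) (F E : J -> banach)
    (g : forall j, X j -> bpm (F j)) (h : forall j, bpm (F j) -> bpm (E j)) k
    (i : bpm (ultraproduct UU F) -> ultralimit UU (fun j => bpm (F j))) :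
  (forall j, g j point = point) -> (forall j, lipschitz_const (g j) k) ->
  (forall j, nonexpansive (h j)) ->
  (forall (y : linf F) (x : bfam (fun j => bpm (F j))),
    (forall j, val x j = linf_eval j y) -> i (ultraclass UU y) = ulim_class UU x) ->
  ultramap UU (fun j => h j \o g j : X j -> E j) =
  ultramap UU (h : forall j, bpm (F j) -> E j) \o i \o
    ultramap UU (g : forall j, X j -> F j).
Proof.
move=> g0 gk h1 iE; have h0 j := (h1 j).1.
have hk j := nonexpansive_lipschitz (h1 j).
have hg0 j : (h j \o g j) point = point by rewrite /= g0 h0.
have hgk j : lipschitz_const (h j \o g j) k.
  by split=> [|x y]; [exact: (gk j).1|exact: le_trans ((h1 j).2 _ _) ((gk j).2 _ _)].
apply/funext => c; have [x <-] := ultralimit_repr c; rewrite /=.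
have [y yE] := lipschitz_image g0 gk x.
have [x' x'E] := linf_bfam y.
have [z zE] := lipschitz_image h0 hk x'.
rewrite (ultramap_class g0 gk yE) (iE _ _ x'E) (ultramap_class h0 hk zE).
by apply: (ultramap_class hg0 hgk) => j; rewrite zE x'E yE.
Qed.

End ultramaps.

Section normalization.
Context {R : realType}.
Local Notation banach := (completeNormedModType R).

(* For [Lip g = 0] both formulas are correct because [0^-1 = 0] and [g = 0]. *)
Lemma lip0_absorb (F : banach) (E : banach) (g : bpm F -> bpm E) : lip0 g ->
  exists g' : bpm F -> bpm E, nonexpansive g' /\
    forall y : F, g y = g' (Lip g *: y).
Proof.
move=> g0; have [L0 gL] := LipP g0; set b := Lip g in L0 gL *.
exists (fun y : F => g (b^-1 *: y)); split.
  split=> [|x y]; first by rewrite -[X in g X]/(_ *: (0 : F)) scaler0 g0.1.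
  apply: le_trans (gL _ _) _; rewrite !bpm_distE -scalerBr normrZ mulrA.
  rewrite ger0_norm ?invr_ge0//; have [->|b0] := eqVneq b 0.
    by rewrite mul0r mul0r.
  by rewrite divff// mul1r.
move=> y; have [b0|b0] := eqVneq b 0; last by rewrite scalerK.
rewrite b0 scale0r scaler0.
apply/mdist_positivity/le_anti/andP; split; last exact: mdist_ge0.
by apply: le_trans (gL _ _) _; rewrite b0 mul0r.
Qed.

Lemma lip0_normalize (X : pmetricType R) (G : banach) (g : X -> bpm G) : lip0 g ->
  exists g' : X -> bpm G, nonexpansive g' /\
    forall x, g x = Lip g *: (g' x : G).
Proof.
move=> g0; have [L0 gL] := LipP g0; set b := Lip g in L0 gL *.
exists (fun x => b^-1 *: (g x : G)); split.
  split=> [|x y]; first by rewrite g0.1 -[point]/(0 : G) scaler0.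
  rewrite bpm_distE -scalerBr normrZ ger0_norm ?invr_ge0//.
  have := gL x y; rewrite bpm_distE; have [->|b0] := eqVneq b 0.
    by rewrite invr0 !mul0r mdist_ge0.
  by rewrite ler_pdivrMl// lt_def b0.
move=> x; have [b0|b0] := eqVneq b 0; last by rewrite scalerKV.
rewrite b0 scale0r -[RHS]/(point : bpm G) -g0.1.
apply/mdist_positivity/le_anti/andP; split; last exact: mdist_ge0.
by apply: le_trans (gL _ _) _; rewrite b0 mul0r.
Qed.

Lemma Lip_ge0 (X Y : pmetricType R) (f : X -> Y) : lip0 f -> 0 <= Lip f.
Proof. by move=> /LipP[]. Qed.

End normalization.

(** * The class of Lipschitz maps composed with an ultrastable ideal *)

Section lip0_composition.
Context {R : realType}.
Local Notation banach := (completeNormedModType R).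
Variable I : lip_class R.
Hypothesis HI : banach_lip_ideal I.

Let I_ge0 (X : pmetricType R) (E : banach) (f : X -> E) :
  lip_mem I f -> 0 <= lip_norm I f.
Proof.
by move=> /(bli_lip0 HI)[f0]; apply: le_trans; exact: Lip_ge0.
Qed.

Let lower (X : pmetricType R) (E : banach) (f : X -> E) r :
  (exists (F : banach) (g1 : X -> F) (g2 : F -> E),
    [/\ lip_mem I g1, lip0 (g2 : bpm F -> bpm E), f = g2 \o g1 &
        r = lip_norm I g1 * Lip (g2 : bpm F -> bpm E)]) -> 0 <= r.
Proof.
by move=> [F [g1 [g2 [Ig1 g20 _ ->]]]]; rewrite mulr_ge0 ?I_ge0 ?Lip_ge0.
Qed.

Lemma lip0_comp_ge0 (X : pmetricType R) (E : banach) (f : X -> E) :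
  lip_mem (lip0_comp I) f -> 0 <= lip_norm (lip0_comp I) f.
Proof.
move=> [F [g1 [g2 [Ig1 g20 fE]]]]; apply: lb_le_inf; last by move=> r /lower.
by exists (lip_norm I g1 * Lip (g2 : bpm F -> bpm E)), F, g1, g2.
Qed.

Lemma lip0_compI (X : pmetricType R) (E F : banach) (g1 : X -> F)
    (g2 : bpm F -> bpm E) : lip_mem I g1 -> nonexpansive g2 ->
  lip_mem (lip0_comp I) (g2 \o g1 : X -> E) /\
  lip_norm (lip0_comp I) (g2 \o g1 : X -> E) <= lip_norm I g1.
Proof.
move=> Ig1 g21; have g20 := nonexpansive_lip0 g21.
split; first by exists F, g1, g2.
apply: (@le_trans _ _ (lip_norm I g1 * Lip g2)).
  by apply: ge_inf; [exists 0 => r /lower|exists F, g1, g2].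
by rewrite ler_piMr ?I_ge0 ?nonexpansive_Lip.
Qed.

(** An almost optimal factorization whose inner map is multiplied by [Lip g2], so that the outer map
    becomes nonexpansive. *)
Lemma lip0_comp_factor (X : pmetricType R) (E : banach) (f : X -> E) (C : R) :
  lip_mem (lip0_comp I) f -> lip_norm (lip0_comp I) f < C ->
  exists (F : banach) (g1 : X -> F) (g2 : bpm F -> bpm E),
    [/\ lip_mem I g1, lip_norm I g1 <= C, nonexpansive g2 & f = g2 \o g1].
Proof.
move=> [F0 [h1 [h2 [Ih1 h20 fE]]]] /inf_lt[|_ [F [g1 [g2 [Ig1 g20 {}fE ->]]]] ltC].
  by exists (lip_norm I h1 * Lip (h2 : bpm F0 -> bpm E)), F0, h1, h2.
have [g2' [g2'1 g2'E]] := lip0_absorb g20.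
have [N0 _ NZ _ _] := bli_banach HI X F.
exists F, (Lip (g2 : bpm F -> bpm E) *: g1), g2'; split=> //.
- by have := N0.2 (Lip (g2 : bpm F -> bpm E)) _ _ Ig1 N0.1; rewrite addr0.
- by rewrite NZ// ger0_norm ?Lip_ge0// mulrC ltW.
- by rewrite fE; apply/funext => x /=; rewrite g2'E.
Qed.

Lemma lip0_comp_comp (Y X : pmetricType R) (E F : banach)
    (h : bpm E -> bpm F) (f : X -> E) (g : Y -> X) :
  nonexpansive h -> lip_mem (lip0_comp I) f -> nonexpansive g ->
  lip_mem (lip0_comp I) (h \o f \o g : Y -> F) /\
  lip_norm (lip0_comp I) (h \o f \o g : Y -> F) <= lip_norm (lip0_comp I) f.
Proof.
move=> h1 Kf g1.
have [c cE] : exists c, lip_norm (lip0_comp I) f = c.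
  by exists (lip_norm (lip0_comp I) f).
rewrite cE.
have bound eta : 0 < eta -> lip_mem (lip0_comp I) (h \o f \o g : Y -> F) /\
    lip_norm (lip0_comp I) (h \o f \o g : Y -> F) <= c + eta.
  move=> eta0; have [|G [f1 [f2 [If1 f1C f21 ->]]]] :=
    @lip0_comp_factor _ _ f (c + eta) Kf.
    by rewrite cE ltrDl.
  have [If1g le] := bli_ideal HI (bop_id G) (nonexpansive_lip0 g1) If1.
  have [mem le'] := lip0_compI If1g (nonexpansive_comp h1 f21).
  split=> //; apply: le_trans le' _; apply: le_trans le _; apply: le_trans _ f1C.
  have id1 : `|bop_id G| <= 1 by apply: bop_norm_le => // x; rewrite mul1r.
  rewrite -[leRHS]mulr1 -[leRHS]mul1r mulrA.
  have L0 := Lip_ge0 (nonexpansive_lip0 g1); have N0 := I_ge0 If1.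
  apply: ler_pM => //; first by rewrite mulr_ge0.
    by rewrite ler_pM.
  exact: nonexpansive_Lip.
split; first by have [] := bound 1 ltr01.
by apply/ler_addgt0Pr => eta /bound[].
Qed.

Hypothesis I_ultra : ultrastable I.

(** Factors almost optimal up to [eta] are chosen for every [j]: ultrastability of [I] handles the
    inner maps, and the outer maps have a nonexpansive ultraproduct. *)
Lemma lip0_comp_ultra (J : Type) (U : set_system J) (UU : UltraFilter U)
    (X : J -> pmetricType R) (E : J -> banach) (f : forall j, X j -> E j) (C : R) :
  (forall j, lip_mem (lip0_comp I) (f j)) ->
  (forall j, lip_norm (lip0_comp I) (f j) <= C) ->
  lip_mem (lip0_comp I) (ultramap UU f) /\
  lip_norm (lip0_comp I) (ultramap UU f) <= C.
Proof.
move=> Kf fC.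
have bound eta : 0 < eta -> lip_mem (lip0_comp I) (ultramap UU f) /\
    lip_norm (lip0_comp I) (ultramap UU f) <= C + eta.
  move=> eta0.
  (* The space and both maps are packed into one dependent pair so that a single choice selects them
     together. *)
  have fact j : exists p : {F : banach & ((X j -> F) * (bpm F -> bpm (E j)))%type},
      [/\ lip_mem I (projT2 p).1, lip_norm I (projT2 p).1 <= C + eta,
          nonexpansive (projT2 p).2 & f j = (projT2 p).2 \o (projT2 p).1].
    have [|F [g1 [g2 gP]]] := @lip0_comp_factor _ _ (f j) (C + eta) (Kf j).
      by rewrite (le_lt_trans (fC j))// ltrDl.
    by exists (existT _ F (g1, g2)).
  pose F j := projT1 (sval (cid (fact j))).
  pose g1 j : X j -> F j := (projT2 (sval (cid (fact j)))).1.
  pose g2 j : bpm (F j) -> bpm (E j) := (projT2 (sval (cid (fact j)))).2.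
  have gP j : [/\ lip_mem I (g1 j), lip_norm I (g1 j) <= C + eta,
      nonexpansive (g2 j) & f j = g2 j \o g1 j] := svalP (cid (fact j)).
  have Ig1 j : lip_mem I (g1 j) by have [] := gP j.
  have g1C j : lip_norm I (g1 j) <= C + eta by have [] := gP j.
  have [Iu ule] := I_ultra UU Ig1 (ex_intro _ _ g1C).
  have [i [i1 iE]] := ultraproduct_ultralimit UU F.
  have g2u : nonexpansive (ultramap UU (g2 : forall j, bpm (F j) -> E j) :
      _ -> bpm (ultraproduct UU E)).
    by apply: ultramap_nonexpansive => j; have [] := gP j.
  have [mem le] := lip0_compI Iu (nonexpansive_comp g2u i1).
  have g10 j := bli_lip0 HI (Ig1 j).
  (* The ideal norm dominates the Lipschitz constant, so the inner maps are uniformly Lipschitz. *)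
  have g1k j : lipschitz_const (g1 j : X j -> bpm (F j)) (C + eta).
    have [L0 gL] := LipP (g10 j).1; have Lk := le_trans (g10 j).2 (g1C j).
    split=> [|x y]; first exact: le_trans Lk.
    by apply: le_trans (gL _ _) _; apply: ler_wpM2r Lk; exact: mdist_ge0.
  have g21 j : nonexpansive (g2 j) by have [] := gP j.
  have fE : ultramap UU f = ultramap UU (g2 : forall j, bpm (F j) -> E j) \o i \o
      ultramap UU g1.
    rewrite -(ultramap_comp (fun j => (g10 j).1.1) g1k g21 iE).
    congr (ultramap UU _); apply: functional_extensionality_dep => j.
    by have [] := gP j.
  rewrite fE; split=> //; apply: le_trans le _; apply: le_trans ule _.
  apply: limr_le; last exact: nearW.
  apply: (@ultra_cvg _ _ _ UU _ (C + eta)) => j.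
  by rewrite ger0_norm ?I_ge0.
split; first by have [] := bound 1 ltr01.
by apply/ler_addgt0Pr => eta /bound[].
Qed.

End lip0_composition.

(** * Lipschitz maps factoring through an operator in a maximal hull *)

Section lip0_op_lip0_maximal.
Context {R : realType}.
Local Notation banach := (completeNormedModType R).
Variable A : op_class R.
Hypothesis HA : banach_op_ideal A.

Local Notation K := (lip0_op_lip0 (op_max A)).

Let lower (X : pmetricType R) (E : banach) (f : X -> E) r :
  (exists (G1 G2 : banach) (g1 : X -> G1) (T : bop G1 G2) (g2 : G2 -> E),
    [/\ lip0 (g1 : X -> bpm G1), op_mem (op_max A) T,
        lip0 (g2 : bpm G2 -> bpm E), f = g2 \o T \o g1 &
        r = Lip (g1 : X -> bpm G1) * op_norm (op_max A) T *
            Lip (g2 : bpm G2 -> bpm E)]) -> 0 <= r.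
Proof.
move=> [G1 [G2 [g1 [T [g2 [g10 AT g20 _ ->]]]]]].
by rewrite !mulr_ge0 ?Lip_ge0// (op_max_norm_ge0 HA).
Qed.

Lemma lip0_op_lip0_ge0 (X : pmetricType R) (E : banach) (f : X -> E) :
  lip_mem K f -> 0 <= lip_norm K f.
Proof.
move=> [G1 [G2 [g1 [T [g2 [g10 AT g20 fE]]]]]].
apply: lb_le_inf; last by move=> r /lower.
by exists (Lip (g1 : X -> bpm G1) * op_norm (op_max A) T *
  Lip (g2 : bpm G2 -> bpm E)), G1, G2, g1, T, g2.
Qed.

Lemma lip0_op_lip0I (X : pmetricType R) (G1 G2 E : banach) (g1 : X -> bpm G1)
    (T : bop G1 G2) (g2 : bpm G2 -> bpm E) :
  nonexpansive g1 -> op_mem (op_max A) T -> nonexpansive g2 ->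
  lip_mem K (g2 \o T \o g1 : X -> E) /\
  lip_norm K (g2 \o T \o g1 : X -> E) <= op_norm (op_max A) T.
Proof.
move=> g11 AT g21; have g10 := nonexpansive_lip0 g11.
have g20 := nonexpansive_lip0 g21.
split; first by exists G1, G2, g1, T, g2.
apply: (@le_trans _ _ (Lip g1 * op_norm (op_max A) T * Lip g2)).
  by apply: ge_inf; [exists 0 => r /lower|exists G1, G2, g1, T, g2].
have N0 := op_max_norm_ge0 HA AT.
rewrite -[leRHS]mulr1 -[in leRHS](mul1r (op_norm _ T)).
apply: ler_pM; rewrite ?mulr_ge0 ?Lip_ge0 ?nonexpansive_Lip//.
by rewrite ler_wpM2r ?nonexpansive_Lip.
Qed.

(** Both Lipschitz constants are absorbed into the operator, as the scalar factor [b * a]. *)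
Lemma lip0_op_lip0_factor (X : pmetricType R) (E : banach) (f : X -> E) (C : R) :
  lip_mem K f -> lip_norm K f < C ->
  exists (G1 G2 : banach) (g1 : X -> bpm G1) (T : bop G1 G2)
      (g2 : bpm G2 -> bpm E),
    [/\ nonexpansive g1, op_mem (op_max A) T /\ op_norm (op_max A) T <= C,
        nonexpansive g2 & f = g2 \o T \o g1].
Proof.
move=> [H1 [H2 [h1 [S [h2 [h10 AS h20 fE]]]]]] /inf_lt[|r].
  by exists (Lip (h1 : X -> bpm H1) * op_norm (op_max A) S *
    Lip (h2 : bpm H2 -> bpm E)), H1, H2, h1, S, h2.
move=> [G1 [G2 [g1 [T [g2 [g10 AT g20 {}fE ->]]]]]] ltC.
have [g1' [g1'1 g1'E]] := lip0_normalize g10.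
have [g2' [g2'1 g2'E]] := lip0_absorb g20.
set a := Lip _ in g1'E ltC; set b := Lip _ in g2'E ltC.
have [AT' le] := op_maxZ HA (b * a) AT.
exists G1, G2, g1', ((b * a) *: T), g2'; split=> //.
  split=> //; apply: le_trans le _.
  rewrite ger0_norm ?mulr_ge0 ?Lip_ge0//.
  by apply: ltW; rewrite (mulrC b) mulrAC.
rewrite fE; apply/funext => x /=.
by rewrite g2'E [g1 x]g1'E bopZ scalerA.
Qed.

Lemma lip0_op_lip0_comp (Y X : pmetricType R) (E F : banach)
    (h : bpm E -> bpm F) (f : X -> E) (g : Y -> X) :
  nonexpansive h -> lip_mem K f -> nonexpansive g ->
  lip_mem K (h \o f \o g : Y -> F) /\
  lip_norm K (h \o f \o g : Y -> F) <= lip_norm K f.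
Proof.
move=> h1 Kf g1; have [c cE] : exists c, lip_norm K f = c by exists (lip_norm K f).
rewrite cE.
have bound eta : 0 < eta -> lip_mem K (h \o f \o g : Y -> F) /\
    lip_norm K (h \o f \o g : Y -> F) <= c + eta.
  move=> eta0.
  have [|G1 [G2 [f1 [T [f2 [f11 [AT TC] f21 ->]]]]]] :=
    @lip0_op_lip0_factor _ _ f (c + eta) Kf.
    by rewrite cE ltrDl.
  have [mem le] := lip0_op_lip0I (nonexpansive_comp f11 g1) AT
    (nonexpansive_comp h1 f21).
  by split=> //; exact: le_trans TC.
split; first by have [] := bound 1 ltr01.
by apply/ler_addgt0Pr => eta /bound[].
Qed.

Lemma lip0_op_lip0_ultra (J : Type) (U : set_system J) (UU : UltraFilter U)
    (X : J -> pmetricType R) (E : J -> banach) (f : forall j, X j -> E j) (C : R) :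
  (forall j, lip_mem K (f j)) -> (forall j, lip_norm K (f j) <= C) ->
  lip_mem K (ultramap UU f) /\ lip_norm K (ultramap UU f) <= C.
Proof.
move=> Kf fC.
have bound eta : 0 < eta -> lip_mem K (ultramap UU f) /\
    lip_norm K (ultramap UU f) <= C + eta.
  move=> eta0.
  have fact j : exists p : {G : banach * banach &
      ((X j -> bpm G.1) * bop G.1 G.2 * (bpm G.2 -> bpm (E j)))%type},
      [/\ nonexpansive (projT2 p).1.1, op_mem (op_max A) (projT2 p).1.2 /\
          op_norm (op_max A) (projT2 p).1.2 <= C + eta,
          nonexpansive (projT2 p).2 &
          f j = (projT2 p).2 \o (projT2 p).1.2 \o (projT2 p).1.1].
    have [|G1 [G2 [g1 [T [g2 gP]]]]] :=
      @lip0_op_lip0_factor _ _ (f j) (C + eta) (Kf j).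
      by rewrite (le_lt_trans (fC j))// ltrDl.
    by exists (existT _ (G1, G2) (g1, T, g2)).
  pose G1 j := (projT1 (sval (cid (fact j)))).1.
  pose G2 j := (projT1 (sval (cid (fact j)))).2.
  pose g1 j : X j -> bpm (G1 j) := (projT2 (sval (cid (fact j)))).1.1.
  pose T j : bop (G1 j) (G2 j) := (projT2 (sval (cid (fact j)))).1.2.
  pose g2 j : bpm (G2 j) -> bpm (E j) := (projT2 (sval (cid (fact j)))).2.
  have gP j : [/\ nonexpansive (g1 j),
      op_mem (op_max A) (T j) /\ op_norm (op_max A) (T j) <= C + eta,
      nonexpansive (g2 j) & f j = g2 j \o T j \o g1 j] := svalP (cid (fact j)).
  have g11 j : nonexpansive (g1 j) by have [] := gP j.
  have g21 j : nonexpansive (g2 j) by have [] := gP j.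
  have AT j : op_mem (op_max A) (T j) by have [_ []] := gP j.
  have TC j : op_norm (op_max A) (T j) <= C + eta by have [_ []] := gP j.
  (* Some index [j] exists because [U] is a proper filter. *)
  have C0 : 0 <= C + eta.
    have [j _] := filter_ex (@filterT _ U _).
    exact: le_trans (op_max_norm_ge0 HA (AT j)) (TC j).
  have Tle j : `|T j| <= C + eta := le_trans (op_max_opnorm HA (AT j)) (TC j).
  have [TU [_ TUE]] := ultraproduct_bop UU C0 Tle.
  have [ATU TUC] := op_max_ultraproduct HA C0 AT TC TUE.
  have [i [i1 iE]] := ultraproduct_ultralimit UU G2.
  have g1u := ultramap_nonexpansive UU g11.
  have g2u := ultramap_nonexpansive UU g21.
  have [mem le] := lip0_op_lip0I g1u ATU (nonexpansive_comp g2u i1).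
  have g10 j := (g11 j).1; have g1k j := nonexpansive_lipschitz (g11 j).
  (* Grouping [T] with the inner map leaves a composite of two Lipschitz families, the form that
     [ultramap_comp] treats. *)
  pose Tg j : X j -> bpm (G2 j) := T j \o g1 j.
  have Tg0 j : Tg j point = point.
    by rewrite /Tg /= g10; exact: linear0.
  have Tgk j : lipschitz_const (Tg j) (C + eta).
    split=> // x y; rewrite bpm_distE -linearB.
    apply: le_trans (bop_norm_ub _ _) _; apply: ler_pM => //.
    exact: (g11 j).2.
  have TgE : ultramap UU (Tg : forall j, X j -> G2 j) =
      TU \o ultramap UU (g1 : forall j, X j -> G1 j).
    apply/funext => c; have [x <-] := ultralimit_repr c; rewrite /=.
    have [y yE] := lipschitz_image g10 g1k x.
    have [z zE] := lipschitz_image Tg0 Tgk x.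
    rewrite (ultramap_class UU g10 g1k yE) (ultramap_class UU Tg0 Tgk zE).
    by apply/esym/TUE => j; rewrite zE yE.
  have fE : ultramap UU f = ultramap UU (g2 : forall j, bpm (G2 j) -> E j) \o i \o
      TU \o ultramap UU (g1 : forall j, X j -> G1 j).
    transitivity (ultramap UU (g2 : forall j, bpm (G2 j) -> E j) \o i \o
        ultramap UU (Tg : forall j, X j -> G2 j)); last by rewrite TgE.
    rewrite -(ultramap_comp Tg0 Tgk g21 iE).
    congr (ultramap UU _); apply: functional_extensionality_dep => j.
    by have [] := gP j.
  by rewrite fE; split=> //; exact: le_trans TUC.
split; first by have [] := bound 1 ltr01.
by apply/ler_addgt0Pr => eta /bound[].
Qed.

End lip0_op_lip0_maximal.

Theorem corollary3p8 (R : realType) :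
  (forall I : lip_class R, banach_lip_ideal I -> ultrastable I ->
    lip_class_eq (lip_max (lip0_comp I)) (lip_reg (lip0_comp I))) /\
  (forall A : op_class R, banach_op_ideal A ->
    lip_class_eq (lip_max (lip0_op_lip0 (op_max A)))
                 (lip_reg (lip0_op_lip0 (op_max A)))).
Proof.
split=> [I HI I_ultra|A HA].
  apply: lip_max_eq_reg.
  - exact: lip0_comp_ge0.
  - exact: lip0_comp_comp.
  - exact: lip0_comp_ultra.
apply: lip_max_eq_reg.
- exact: lip0_op_lip0_ge0.
- exact: lip0_op_lip0_comp.
- exact: lip0_op_lip0_ultra.
Qed.
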